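(* For $T>0$ let $N(T)$ denote the number of pairs $\mathbf{x}=(x_1,x_2,x_3)\in\mathbb{Z}_{\neq 0}^3$, $\mathbf{y}=(y_1,y_2,y_3)\in\mathbb{Z}_{\neq 0}^3$ such that $\gcd(x_i,x_j)=1$ and $\gcd(y_i,y_j)=1$ for all $i\neq j$, each of $x_1,x_2,x_3$ is square-free, \[x_1y_1^2+x_2y_2^2=x_3y_3^2,\qquad x_1>0,\qquad x_1y_1^2\ge |x_2y_2^2|,\qquad |(x_1y_1)^2x_2x_3|\le T.\] Then there exist positive numbers $c_1,c_2,c_3$ such that \[c_1T^{1/2}(\log T)^3<N(T)<c_2T^{1/2}(\log T)^3\] for all $T>c_3$.
   Context: $\mathbb{Z}_{\neq 0}$ denotes the set of nonzero integers. $N(T)$ counts rational points on $\mathbb{P}^1$ with three ''half points'' at $0,-1,\infty$ with respect to the height $H(a,b)=\operatorname{sqf}(a)\operatorname{sqf}(b)\operatorname{sqf}(a+b)\max\{|a|,|b|\}$ on primitive integer pairs, where $\operatorname{sqf}(n)$ is $n$ divided by the largest square dividing it. *)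

(* Defs.v *)
From HB Require Import structures.
From mathcomp Require Import all_boot all_order all_algebra finmap.
From mathcomp Require Import zify ring.
From mathcomp Require Import all_classical all_reals all_analysis.

Set Implicit Arguments.
Unset Strict Implicit.
Unset Printing Implicit Defensive.

Import Order.TTheory GRing.Theory Num.Theory.
Local Open Scope classical_set_scope.
Local Open Scope ring_scope.

Definition squarefreez (n : int) : Prop :=
  forall d : int, (d ^+ 2 %| n)%Z -> d \is a GRing.unit.

Definition half_points (R : realType) (T : R) :
    set ((int * int * int) * (int * int * int)) :=
  [set p | let: ((x1, x2, x3), (y1, y2, y3)) := p in
    ([/\ x1 != 0, x2 != 0 & x3 != 0] /\
     [/\ y1 != 0, y2 != 0 & y3 != 0]) /\
    ([/\ coprimez x1 x2, coprimez x1 x3 & coprimez x2 x3] /\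
     [/\ coprimez y1 y2, coprimez y1 y3 & coprimez y2 y3]) /\
    [/\ squarefreez x1, squarefreez x2 & squarefreez x3] /\
    x1 * y1 ^+ 2 + x2 * y2 ^+ 2 = x3 * y3 ^+ 2 /\
    0 < x1 /\
    `|x2 * y2 ^+ 2| <= x1 * y1 ^+ 2 /\
    `|(x1 * y1) ^+ 2 * x2 * x3|%:~R <= T].

(* [fset_set] sends an infinite set to the empty one; [finite_half_points]
   below shows that this convention never applies here. *)
Definition N (R : realType) (T : R) : nat :=
  (#|` fset_set (half_points T) |)%fset.

Lemma half_points_bound (x1 x2 x3 y1 y2 y3 M : int) :
  [/\ x1 != 0, x2 != 0 & x3 != 0] ->
  [/\ y1 != 0, y2 != 0 & y3 != 0] ->
  x1 * y1 ^+ 2 + x2 * y2 ^+ 2 = x3 * y3 ^+ 2 -> 0 < x1 ->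
  `|x2 * y2 ^+ 2| <= x1 * y1 ^+ 2 ->
  `|(x1 * y1) ^+ 2 * x2 * x3| <= M ->
  (`|x1| <= 2 * M /\ `|x2| <= 2 * M /\ `|x3| <= 2 * M) /\
  (`|y1| <= 2 * M /\ `|y2| <= 2 * M /\ `|y3| <= 2 * M).
Proof.
move=> [nx1 nx2 nx3] [ny1 ny2 ny3] E x1_gt0 le_y2 le_M.
have ge1 (n : int) : n != 0 -> 1 <= `|n| by clear; lia.
have := (ge1 _ nx1, ge1 _ nx2, ge1 _ nx3, (ge1 _ ny1, ge1 _ ny2, ge1 _ ny3)).
case=> -[[hx1 hx2] hx3] [[hy1 hy2] hy3].
have le_y3 : `|x3 * y3 ^+ 2| <= 2 * (x1 * y1 ^+ 2).
  rewrite -E; move: (x2 * _) (x1 * _) le_y2 => s t; clear; lia.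
have lel (a b : int) : 0 <= a -> 1 <= b -> a <= a * b by clear; nia.
have ler (a b : int) : 0 <= a -> 1 <= b -> a <= b * a by clear; nia.
have p1 (a b : int) : 1 <= a -> 1 <= b -> 1 <= a * b by clear; nia.
move: le_M le_y2 le_y3; rewrite !expr2 !normrM.
rewrite [x1 * _](_ : _ = `|x1| * (`|y1| * `|y1|)); last first.
  by rewrite -normrM !ger0_norm // ?ltW // -expr2 exprn_even_gt0.
move: `|x1| `|x2| `|x3| `|y1| `|y2| `|y3| hx1 hx2 hx3 hy1 hy2 hy3.
move=> {nx1 nx2 nx3 ny1 ny2 ny3 E x1_gt0 x1 x2 x3 y1 y2 y3}.
move=> a b c u v w ha hb hc hu hv hw hM hv2 hw2.
have K : a * (u * u) <= M.
  apply: le_trans hM.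
  have -> : a * u * (a * u) * b * c = a * (u * u) * (a * b * c) by ring.
  by apply: lel; [rewrite (le_trans ler01) ?p1|rewrite !p1].
have Kb : b <= M.
  apply: le_trans hM.
  have -> : a * u * (a * u) * b * c = b * (a * u * (a * u) * c) by ring.
  by apply: lel; [exact: le_trans ler01 _|rewrite !p1].
have Kc : c <= M.
  by apply: le_trans hM; apply: ler; [exact: le_trans ler01 _|rewrite !p1].
have Ka : a <= M.
  by apply: le_trans K; apply: lel; [exact: le_trans ler01 _|rewrite !p1].
have Ku : u <= M.
  apply: le_trans K; rewrite mulrA; apply: ler; [exact: le_trans ler01 _|by rewrite !p1].
have Kv : v <= M.
  apply: le_trans K; apply: le_trans hv2; rewrite mulrA.
  by apply: ler; [exact: le_trans ler01 _|rewrite !p1].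
have Kw : w <= 2 * M.
  apply: (@le_trans _ _ (2 * (a * (u * u)))); last by rewrite ler_pM2l.
  apply: le_trans hw2; rewrite mulrA.
  by apply: ler; [exact: le_trans ler01 _|rewrite !p1].
move: ha Ka Kb Kc Ku Kv Kw; clear; lia.
Qed.

Lemma finite_int_ball (M : int) : finite_set [set n : int | `|n| <= M].
Proof.
pose f (i : nat) : int := i%:Z - M.
apply: (sub_finite_set (B := f @` `I_(absz (2 * M + 1)%R))).
  by move=> n /= hn; exists (absz (n + M)%R); rewrite /f /=; lia.
exact/finite_image/finite_II.
Qed.

Lemma finite_half_points (R : realType) (T : R) : finite_set (half_points T).
Proof.
pose B := [set n : int | `|n| <= 2 * Num.floor T].
have fB : finite_set B by exact: finite_int_ball.
apply: (@sub_finite_set _ _ ((B `*` B `*` B) `*` (B `*` B `*` B))).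
  move=> [[[x1 x2] x3] [[y1 y2] y3]] /=.
  move=> [[nx ny] [_ [_ [E [x1_gt0 [le2]]]]]].
  rewrite -floor_ge_int => leM.
  by have := half_points_bound nx ny E x1_gt0 le2 leM; rewrite /B /=; tauto.
by do !apply: finite_setX.
Qed.

(* Main.v *)
(* Upper bound.  Written symmetrically as x1 y1^2 + x2 y2^2 + x3 y3^2 = 0 with
   |x3| the largest coefficient, the solutions are cut into dyadic boxes
   |xi| ~ Ai, y3 ~ B, y1 ~ U.  A solution determines (x1, x2, y3, r) with
   r = y1 / y2 mod y3, so y3 | x1 r^2 + x2.  Over a fixed quadruple the slopes
   y2 / y1 are B^2 / U^2-separated, because y3^2 divides twice the determinant
   of two solutions, and lie in a window of size A3 B^2 / (U^2 sqrt(A1 A2)):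
   there are O(A3 / sqrt(A1 A2)) of them.  The quadruples are O(A1 A2 B): by
   Thue's lemma r = u / v mod y3 with |u|, |v| small, so y3 divides
   x1 u^2 + x2 v^2, and for given u, v and cofactor the pairs (x1, x2) are
   counted as separated slopes again.  (The corner A1 = A2 = 1 costs an extra
   logarithm but is only one line of boxes.)  Summing geometrically over B and U
   leaves O(sqrt T) for each of the O((log T)^3) triples (A1, A2, A3).

   Lower bound.  Fix Q divisible by 4 and by all primes up to K = 100.  For each
   pairwise coprime (y1, y2, y3) with yi = 1 mod Q and yi <= T^(1/64), take x1
   and x2 equal to 1 mod Q in intervals such that y3^2 | x1 y1^2 + x2 y2^2; the
   quotient x3 is then 2 mod Q.  Squarefreeness and coprimality can only fail at
   primes above K, which excludes a small proportion of the >> sqrt T / (y1 y2 y3)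
   candidates, on average over y.  Summing 1 / (y1 y2 y3) gives (log T)^3. *)
Require Import Defs.
From HB Require Import structures.
From mathcomp Require Import all_boot all_order all_algebra.
From mathcomp Require Import zify ring lra.
From mathcomp Require Import all_classical all_reals all_analysis.

Set Implicit Arguments.
Unset Strict Implicit.
Unset Printing Implicit Defensive.

Import Order.TTheory GRing.Theory Num.Theory.
Local Open Scope ring_scope.

(** * Counting by lists *)

(** The upper bound may lose no logarithm in the average over [y3]. Listing the roots of
    [x1 r^2 + x2] one modulus at a time loses one, through the divisor function. Thue's lemma avoids
    this, but its pair (u, v) may share a factor with the modulus. Removing a common part [h]
    weakens the congruence to the modulus [y3 / h], yet shrinks the box for (u, v) by [h] in both
    directions. This saving of [h^2] pays for the roots that become indistinguishable, since the sum
    of the inverse squares converges. The method fails only if [x1 u^2 + x2 v^2 = 0], which for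
    coprime square-free coefficients makes both of them units: this is the corner.

    In the lower bound the constants matter. Congruences modulo [Q] dispose of the primes up to [K],
    and the sum of [1 / p^2] over larger integers is at most [1 / K]; [K = 100] lets fixed fractions
    of the candidates and of the triples y survive all losses. The exponent 1/64 makes the numbers
    of choices for [x1] and [x2] larger than the error terms, which are of order [t^6] with
    [t = T^(1/64)]. *)

Ltac posR := repeat first [ done | exact: ltW
  | apply: mulr_ge0 | apply: mulr_gt0 | apply: divr_ge0 | apply: divr_gt0
  | apply: exprn_ge0 | apply: exprn_gt0 | rewrite ler0z; done
  | rewrite invr_ge0 | rewrite invr_gt0 | rewrite ler0n; done | rewrite ltr0n; done
  | lra | apply: addr_ge0 | apply: addr_gt0].

(** Quantifying over duplicate-free lists bounds undecidable predicates on infinite types without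
    any finiteness proof, and real-valued bounds compose through covers, fibres and injections. *)
Definition atmost (R : realType) (X : eqType) (P : X -> Prop) (c : R) :=
  forall s : seq X, uniq s -> {in s, forall x, P x} -> (size s)%:R <= c.

Section Atmost.
Variable R : realType.
Implicit Types (X Y : eqType) (c d : R).

Lemma atmost_ge0 X (P : X -> Prop) c : atmost P c -> 0 <= c.
Proof. by move/(_ [::] isT); apply. Qed.

Lemma atmost_sub X (P P' : X -> Prop) c c' :
  (forall x, P x -> P' x) -> c' <= c -> atmost P' c' -> atmost P c.
Proof.
by move=> PP' cc' H s us sP; apply: le_trans cc'; apply: H => // x /sP /PP'.
Qed.

(** One witness is free: relations between parameters that follow from the existence of a single
    object may be used in counting all of them, and empty classes cost nothing. *)
Lemma atmost_inhabited X (P : X -> Prop) c :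
  0 <= c -> (forall x, P x -> atmost P c) -> atmost P c.
Proof.
by move=> c0 H [|x s] // us sP; apply: (H x) => //; apply/sP/mem_head.
Qed.

Lemma atmost_inj X Y (P : X -> Prop) (Q : Y -> Prop) (f : X -> Y) c :
  (forall x, P x -> Q (f x)) ->
  (forall x x', P x -> P x' -> f x = f x' -> x = x') ->
  atmost Q c -> atmost P c.
Proof.
move=> PQ inj H s us sP; rewrite -(size_map f); apply: H.
  by rewrite map_inj_in_uniq // => x x' /sP ? /sP ?; exact: inj.
by move=> y /mapP[x /sP Px ->]; exact: PQ.
Qed.

Lemma atmost_cover X (I : eqType) (P : X -> Prop) (r : seq I)
    (E : I -> X -> Prop) (n : I -> R) :
  (forall x, P x -> exists2 i, i \in r & E i x) ->
  (forall i, i \in r -> atmost (fun x => P x /\ E i x) (n i)) ->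
  atmost P (\sum_(i <- r) n i).
Proof.
elim: r P => [|i r IH] P Pr En s us sP.
  rewrite big_nil; case: s us sP => [|x s] _ sP; first by [].
  by have [] := Pr x (sP x (mem_head _ _)).
rewrite big_cons -(count_predC (fun x => `[< E i x >]) s) natrD lerD //.
  rewrite -size_filter; apply: En; rewrite ?mem_head ?filter_uniq//.
  by move=> x; rewrite mem_filter => /andP[/asboolP ? /sP].
rewrite -size_filter.
apply: (IH (fun x => P x /\ ~ E i x)); rewrite ?filter_uniq//.
- move=> x [Px nE]; have [j] := Pr x Px.
  by rewrite inE => /predU1P[-> //|jr Ej]; exists j.
- move=> j jr; apply: (atmost_sub _ (lexx _) (En j _)).
    by move=> x [[]].
  by rewrite inE jr orbT.
- by move=> x; rewrite mem_filter => /andP[/= /asboolPn ? /sP].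
Qed.

Lemma atmost_or X (P P1 P2 : X -> Prop) c1 c2 :
  (forall x, P x -> P1 x \/ P2 x) -> atmost P1 c1 -> atmost P2 c2 ->
  atmost P (c1 + c2).
Proof.
move=> P12 H1 H2.
have -> : c1 + c2 = \sum_(b <- [:: true; false]) (if b then c1 else c2).
  by rewrite !big_cons big_nil addr0.
apply: (atmost_cover (E := fun b x => if b then P1 x else P2 x)).
  by move=> x /P12[]; [exists true|exists false].
by case=> _ ; [move: H1|move: H2] => H; apply: (atmost_sub _ (lexx _) H) => x [].
Qed.

Lemma atmost_fiber X Y (f : X -> Y) (P : X -> Prop) (Q : Y -> Prop) c n :
  0 <= n -> (forall x, P x -> Q (f x)) -> atmost Q c ->
  (forall y, Q y -> atmost (fun x => P x /\ f x = y) n) ->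
  atmost P (c * n).
Proof.
move=> n0 PQ Qc Pn s us sP.
apply: (@le_trans _ _ (\sum_(y <- undup (map f s)) n)).
  apply: (@atmost_cover _ _ (fun x => x \in s) _ (fun y x => f x = y)) => //.
    by move=> x xs; exists (f x); rewrite // mem_undup map_f.
  move=> y; rewrite mem_undup => /mapP[x xs ->].
  by apply: (atmost_sub _ (lexx _) (Pn (f x) (PQ _ (sP _ xs)))) => z [/sP].
rewrite big_const_seq count_predT iter_addr addr0 -mulr_natl ler_wpM2r//.
apply: Qc; rewrite ?undup_uniq// => y.
by rewrite mem_undup => /mapP[x /sP /PQ ? ->].
Qed.

Lemma atmost_pair X Y (P : X -> Prop) (Q : Y -> Prop) c d :
  0 <= d -> atmost P c -> atmost Q d ->
  atmost (fun z : X * Y => P z.1 /\ Q z.2) (c * d).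
Proof.
move=> d0 Pc Qd; apply: (atmost_fiber (f := fst)) Pc _ => // [z []//|x Px].
apply: (atmost_inj (f := snd)) Qd => [z [[]]//|[a b] [a' b']] /=.
by move=> [_ ->] [_ ->] ->.
Qed.

(** The index of the interval of length [gap] containing [g x] determines [x]. The value 0 for an
    empty window lets [atmost_posint] give [z], not [z + 1], when [z < 1]; later products need
    bounds proportional to [z]. *)
Lemma atmost_gap X (P : X -> Prop) (g : X -> R) (lo hi gap : R) :
  0 < gap -> (forall x, P x -> lo <= g x <= hi) ->
  (forall x y, P x -> P y -> x <> y -> gap <= `|g x - g y|) ->
  atmost P (if lo <= hi then 1 + (hi - lo) / gap else 0).
Proof.
move=> gap0 gP gapP; case: ifPn => lohi; last first.
  case=> [|x s] // _ /(_ x (mem_head _ _))/gP/andP[h1 h2].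
  by rewrite (le_trans h1 h2) in lohi.
pose k x := Num.truncn ((g x - lo) / gap).
pose m := (Num.truncn ((hi - lo) / gap)).+1.
have c0 : 0 <= (hi - lo) / gap by rewrite divr_ge0 ?subr_ge0// ltW.
apply: (@atmost_inj _ _ _ (fun i => (i < m)%N) k).
- move=> x /gP/andP[h1 h2]; rewrite /k /m ltnS le_truncn//.
  by apply: ler_wpM2r; [rewrite invr_ge0 ltW|rewrite lerD2r].
- move=> x y Px Py e; apply: contrapT => /(gapP _ _ Px Py).
  have B z : P z -> (k z)%:R <= (g z - lo) / gap < (k z)%:R + 1.
    move=> /gP/andP[h1 h2]; rewrite natr1; apply/truncn_itv.
    by rewrite divr_ge0 ?subr_ge0// ltW.
  have := B _ Px; have := B _ Py; rewrite e.
  rewrite ler_pdivlMr// ltr_pdivrMr// ler_pdivlMr// ltr_pdivrMr//.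
  move=> /andP[a1 a2] /andP[b1 b2].
  rewrite leNgt => /negP; apply.
  rewrite ltr_norml; apply/andP; lra.
move=> s us sm; apply: (@le_trans _ _ m%:R); last first.
  by rewrite /m -natr1 addrC lerD2l truncn_le.
rewrite ler_nat -(size_iota 0 m).
apply: uniq_leq_size => // i /sm im; by rewrite mem_iota add0n.
Qed.

Lemma atmost_gap' X (P : X -> Prop) (g : X -> R) (lo hi gap : R) :
  0 < gap -> lo <= hi -> (forall x, P x -> lo <= g x <= hi) ->
  (forall x y, P x -> P y -> x <> y -> gap <= `|g x - g y|) ->
  atmost P (1 + (hi - lo) / gap).
Proof. by move=> g0 lh H1 H2; have := atmost_gap g0 H1 H2; rewrite lh. Qed.

Lemma atmost_posint (z : R) : 0 <= z ->
  atmost (fun u : int => 0 < u /\ u%:~R <= z) z.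
Proof.
move=> z0.
have := @atmost_gap _ (fun u : int => 0 < u /\ u%:~R <= z) (fun u => u%:~R) 1 z 1 ltr01.
have H1 : forall u : int, 0 < u /\ u%:~R <= z -> 1 <= (u%:~R : R) <= z.
  by move=> u [u0 ->]; rewrite andbT ler1z; lia.
move=> /(_ H1) {}H1.
apply: (atmost_sub _ _ (H1 _)) => //; first by case: ifP => // _; lra.
move=> u v _ _ uv; rewrite -intrB -intr_norm ler1z; lia.
Qed.

Lemma atmost_nzint (z : R) : 0 <= z ->
  atmost (fun u : int => u <> 0 /\ `|u|%:~R <= z) (2 * z).
Proof.
move=> z0; have := atmost_posint z0 => H; rewrite mulr_natl mulr2n.
apply: (atmost_or (P1 := fun u : int => 0 < u /\ u%:~R <= z)
                  (P2 := fun u : int => u < 0 /\ (- u)%:~R <= z)) H _.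
  move=> u [u0 uz]; case: (ltgtP u 0) => // [u_lt|u_gt]; [right|left].
    by rewrite ltr0_norm in uz.
  by rewrite gtr0_norm in uz.
apply: (atmost_inj (f := fun u : int => - u)) (atmost_posint z0).
  by move=> u [u0 ?]; split => //; lia.
by move=> u v _ _ /oppr_inj.
Qed.

End Atmost.

(** * Divisibility *)

(** With [d = k y] the square divisibility leaves [y | 2 k n], hence [y | 2 k]. The product is the
    difference of the squares of [n + d] and [n]; keeping the factor 2 avoids a parity condition on
    [y]. *)
Lemma dvdz_sq_double (y d n : int) : y != 0 -> (y %| d)%Z ->
  (y ^+ 2 %| d * (d + 2 * n))%Z -> coprimez n y -> (y ^+ 2 %| 2 * d)%Z.
Proof.
move=> y0 /dvdzP[k ->]; rewrite expr2.
have -> : k * y * (k * y + 2 * n) = y * (k * (k * y + 2 * n)) by ring.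
have -> : 2 * (k * y) = y * (2 * k) by ring.
rewrite !dvdz_mul2l // => h cop.
have : (y %| (2 * k) * n)%Z.
  have -> : 2 * k * n = k * (k * y + 2 * n) - (k * k) * y by ring.
  by rewrite rpredB// dvdz_mull.
by rewrite Gauss_dvdzl// coprimez_sym.
Qed.

Lemma dvdz_mul_gcd (e f d : int) : (e %| d)%Z -> (f %| d)%Z ->
  (e * f %| d * gcdz e f)%Z.
Proof.
move=> /dvdzP[a da] /dvdzP[b db]; have [u [v <-]] := Bezoutz e f.
have -> : d * (u * e + v * f) = u * e * d + v * f * d by ring.
rewrite {1}db da; have -> : u * e * (b * f) + v * f * (a * e) = (u * b + v * a) * (e * f) by ring.
exact: dvdz_mull.
Qed.

Lemma coprimez_dvdl (a b c : int) : (a %| b)%Z -> coprimez b c -> coprimez a c.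
Proof. by rewrite dvdzE !coprimezE; exact: coprime_dvdl. Qed.

Lemma coprimez_dvd1 (a b : int) : (a %| b)%Z -> coprimez a b -> (a %| 1)%Z.
Proof.
move=> ab /eqP cop; have : (a %| gcdz a b)%Z by rewrite dvdz_gcd dvdzz ab.
by rewrite cop.
Qed.

Lemma coprimez_gcd_dvd1 (a b : int) : (gcdz a b %| 1)%Z -> coprimez a b.
Proof. by rewrite dvdz1 /coprimez /gcdz absz_nat => /eqP ->. Qed.

(** With [e] the common gcd and [y = f e], both roots satisfy [e | r - r0] and [f | r + r0]. So [e]
    and [f] divide [r - r1], and their gcd divides [2 r0], hence 2. *)
Lemma root_dvd (y r r1 r0 : int) : y != 0 -> coprimez r0 y ->
  (y %| r ^+ 2 - r0 ^+ 2)%Z -> (y %| r1 ^+ 2 - r0 ^+ 2)%Z ->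
  gcdz (r - r0) y = gcdz (r1 - r0) y -> (y %| 2 * (r - r1))%Z.
Proof.
move=> y0 cop; rewrite !subr_sqr.
have K z : (y %| (z - r0) * (z + r0))%Z ->
    forall e f, gcdz (z - r0) y = e -> y = f * e -> (e %| z - r0)%Z /\ (f %| z + r0)%Z.
  move=> yz e f ez yf; split; first by rewrite -ez dvdz_gcdl.
  have e0 : e != 0 by apply: contraNneq y0 => e0; rewrite yf e0 mulr0.
  have [u [v uv]] := Bezoutz (z - r0) y.
  have : (y %| e * (z + r0))%Z.
    rewrite -ez -uv mulrDl rpredD//; first by rewrite -mulrA dvdz_mull.
    by rewrite mulrAC dvdz_mull.
  by rewrite yf (mulrC f) dvdz_mul2l.
move=> yr yr1; move ee : (gcdz (r - r0) y) => e e1.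
have /dvdzP[f yf] : (e %| y)%Z by rewrite -ee dvdz_gcdr.
have [er fr] := K _ yr _ _ ee yf; have [er1 fr1] := K _ yr1 _ _ (esym e1) yf.
have h1 : (e %| r - r1)%Z.
  have -> : r - r1 = (r - r0) - (r1 - r0) by ring.
  by rewrite rpredB.
have h2 : (f %| r - r1)%Z.
  have -> : r - r1 = (r + r0) - (r1 + r0) by ring.
  by rewrite rpredB.
have : (gcdz e f %| 2)%Z.
  have : (gcdz e f %| 2 * r0)%Z.
    have -> : 2 * r0 = (r + r0) - (r - r0) by ring.
    by rewrite rpredB// (dvdz_trans _ er, dvdz_trans _ fr) ?dvdz_gcdl ?dvdz_gcdr.
  rewrite Gauss_dvdzl//; apply: coprimez_dvdl (_ : coprimez y r0).
    by rewrite yf dvdz_mull// dvdz_gcdl.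
  by rewrite coprimez_sym.
move=> /dvdzP[c c2].
have -> : 2 * (r - r1) = c * ((r - r1) * gcdz e f) by rewrite mulrCA -c2 mulrC.
by rewrite dvdz_mull// yf (mulrC f) dvdz_mul_gcd.
Qed.

(** Pigeonhole on the residues of [a - r b]. The two sides are independent because the box will be
    adapted to the ratio of [|x1|] and [|x2|]. *)
Lemma thue (y m n : nat) (r : int) : (0 < y)%N -> (y < m.+1 * n.+1)%N ->
  exists u v : int, [/\ (u != 0) || (v != 0), `|u| <= m%:Z, `|v| <= n%:Z &
    (y %| u - r * v)%Z].
Proof.
case: y => // y _ ymn.
pose f (z : 'I_m.+1 * 'I_n.+1) : 'I_y.+1 :=
  inord `|((z.1%:Z - r * z.2%:Z) %% y.+1%:Z)%Z|.
have /injectivePn [[a b] [[a' b'] ne ff]] : ~~ injectiveb f.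
  by apply/negP => /injectiveP/leq_card; rewrite card_prod !card_ord leqNgt ymn//.
exists (a%:Z - a'%:Z), (b%:Z - b'%:Z); split.
- move: ne; rewrite xpair_eqE -!val_eqE /=; lia.
- have := ltn_ord a; have := ltn_ord a'; lia.
- have := ltn_ord b; have := ltn_ord b'; lia.
have B z : (`|(z %% y.+1%:Z)%Z| < y.+1)%N.
  have := modz_ge0 z (isT : y.+1%:Z != 0); have := ltz_pmod z (isT : 0 < y.+1%:Z).
  lia.
have := congr1 val ff; rewrite /f /= !inordK// => e.
have -> : a%:Z - a'%:Z - r * (b%:Z - b'%:Z) =
  (a%:Z - r * b%:Z) - (a'%:Z - r * b'%:Z) by ring.
rewrite -eqz_mod_dvd; apply/eqP.
have := modz_ge0 (a%:Z - r * b%:Z) (isT : y.+1%:Z != 0).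
have := modz_ge0 (a'%:Z - r * b'%:Z) (isT : y.+1%:Z != 0).
move: e; set z := modz _ _; set z' := modz _ _; lia.
Qed.

Lemma squarefree_eq1 (x u : int) : squarefreez x -> (u ^+ 2 %| x)%Z -> (`|u| = 1)%N.
Proof. by move=> sq /sq /orP[] /eqP ->. Qed.

(** By coprimality [v^2] divides the square-free [x1], so [v] is a unit and [x1] divides [x2], which
    forces a unit. This isolates the case in which the value of the form does not determine its
    divisor [y]. *)
Lemma isotropic_unit (x1 x2 u v : int) : coprimez x1 x2 -> coprimez u v ->
  squarefreez x1 -> squarefreez x2 -> x1 * u ^+ 2 + x2 * v ^+ 2 = 0 ->
  (`|x1| = 1)%N /\ (`|x2| = 1)%N.
Proof.
have K (a b s t : int) : coprimez a b -> coprimez s t -> squarefreez a ->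
    a * s ^+ 2 + b * t ^+ 2 = 0 -> (`|a| = 1)%N.
  move=> cab cst sqa e.
  have : (t ^+ 2 %| a * s ^+ 2)%Z.
    have -> : a * s ^+ 2 = - b * t ^+ 2 by lia.
    exact: dvdz_mull.
  rewrite Gauss_dvdzl; last by rewrite coprimezXl// coprimezXr// coprimez_sym.
  move=> /(squarefree_eq1 sqa) t1.
  have : (a %| b * t ^+ 2)%Z.
    have -> : b * t ^+ 2 = - (s ^+ 2) * a by lia.
    exact: dvdz_mull.
  have -> : t ^+ 2 = 1 by case: (eqVneq t 1) => [->|?]//; have -> : t = -1 by lia.
  by rewrite mulr1 => /coprimez_dvd1/(_ cab); rewrite dvdz1; lia.
move=> c1 c2 s1 s2 e; split; first exact: K c1 c2 s1 e.
by apply: (K x2 x1 v u) => //; rewrite 1?coprimez_sym// addrC.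
Qed.

Lemma dvdz_norm_le (w d : int) : (w %| d)%Z -> d <> 0 -> `|w| <= `|d|.
Proof.
rewrite dvdzE => h d0; have : (0 < `|d|)%N by lia.
by move=> /dvdn_leq/(_ h); lia.
Qed.

Lemma coprime_slope_eq (a b c d : int) : coprimez a b -> coprimez c d ->
  0 < a * c -> a * d = c * b -> a = c /\ b = d.
Proof.
move=> cab ccd ac e.
have h1 : (a %| c)%Z by rewrite -(Gauss_dvdzl _ cab) -e dvdz_mulr.
have h2 : (c %| a)%Z by rewrite -(Gauss_dvdzl _ ccd) e dvdz_mulr.
have a0 : a <> 0 by move=> a0; rewrite a0 mul0r in ac.
have c0 : c <> 0 by move=> c0; rewrite c0 mulr0 in ac.
have := dvdz_norm_le h1 c0; have := dvdz_norm_le h2 a0 => h3 h4.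
have ac' : a = c by nia.
by split=> //; move: e; rewrite ac' => /mulfI -> //; exact/eqP.
Qed.

(** * Counting quadratic roots *)

Section Slope.
Variable R : realType.

Lemma slope_gap (a b c d : int) (A D : R) : 0 < A ->
  `|a|%:~R < 2 * A -> `|c|%:~R < 2 * A -> a != 0 -> c != 0 ->
  D <= `|a * d - c * b|%:~R -> 0 <= D ->
  D / (4 * A ^+ 2) <= `|b%:~R / a%:~R - d%:~R / c%:~R : R|.
Proof.
move=> A0 aA cA a0 c0 De D0.
have a0' : (a%:~R : R) != 0 by rewrite intr_eq0.
have c0' : (c%:~R : R) != 0 by rewrite intr_eq0.
have -> : b%:~R / a%:~R - d%:~R / c%:~R = - (a * d - c * b)%:~R / (a%:~R * c%:~R) :> R.
  by rewrite rmorphB !rmorphM /=; field; apply/andP.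
rewrite normrM normrN normfV -intr_norm.
have ac0 : 0 < `|a%:~R * c%:~R : R| by rewrite normr_gt0 mulf_neq0.
apply: (@le_trans _ _ (D / `|a%:~R * c%:~R|)); last first.
  by rewrite ler_pM2r ?invr_gt0.
rewrite ler_wpM2l// lef_pV2 ?posrE//; last by rewrite mulr_gt0 ?exprn_gt0.
rewrite normrM -!intr_norm; have -> : 4 * A ^+ 2 = (2 * A) * (2 * A) by ring.
by apply: ler_pM; rewrite ?ler0z// ltW.
Qed.

(** The slopes [x.2 / x.1] lie within [k |w| / (A |q|)] of [- p / q], and distinct ones are
    [|w| / (4 A^2)] apart, since [w] divides the determinant of two solutions. The factor 2
    separates the signs of [x.1], as opposite pairs have equal slopes. *)
Lemma atmost_slope (p q w : int) (A k : R) : coprimez p q -> q != 0 ->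
  w != 0 -> 0 < A -> 0 <= k ->
  atmost (fun x : int * int =>
    [/\ coprimez x.1 x.2, A <= `|x.1|%:~R, `|x.1|%:~R < 2 * A,
        (w %| x.1 * p + x.2 * q)%Z
      & `|x.1 * p + x.2 * q|%:~R <= k * `|w|%:~R])
    (2 * (1 + 8 * A * k / `|q|%:~R)).
Proof.
move=> cpq q0 w0 A0 k0.
have q0' : (q%:~R : R) != 0 by rewrite intr_eq0.
have Q0 : 0 < `|q|%:~R :> R by rewrite ltr0z normr_gt0.
have W0 : 0 < `|w|%:~R :> R by rewrite ltr0z normr_gt0.
pose P (x : int * int) := [/\ coprimez x.1 x.2, A <= `|x.1|%:~R, `|x.1|%:~R < 2 * A,
        (w %| x.1 * p + x.2 * q)%Z
      & `|x.1 * p + x.2 * q|%:~R <= k * `|w|%:~R].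
have nz x : P x -> x.1 != 0.
  by case=> _ hA _ _ _; apply: contraTneq hA => ->; rewrite normr0 leNgt A0.
suff H (S : int * int -> Prop) : (forall x x', S x -> S x' -> 0 < x.1 * x'.1) ->
    atmost (fun x => P x /\ S x) (1 + 8 * A * k / `|q|%:~R).
  set Z := 1 + _ in H *; have -> : 2 * Z = Z + Z by ring.
  apply: (atmost_or (P1 := fun x => P x /\ 0 < x.1)
                    (P2 := fun x => P x /\ x.1 < 0)).
  - by move=> x Px; have := nz x Px; case: (ltgtP x.1 0) => // ? _; [right|left].
  - by apply: (H (fun x => is_true (0 < x.1))) => x x' h h'; exact: mulr_gt0.
  - by apply: (H (fun x => is_true (x.1 < 0))) => x x' h h'; rewrite nmulr_rgt0.
move=> S1.
pose c0 : R := - (p%:~R / q%:~R); pose e : R := k * `|w|%:~R / (A * `|q|%:~R).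
have e0 : 0 <= e by rewrite /e divr_ge0 ?mulr_ge0// ltW.
have -> : 8 * A * k / `|q|%:~R = (c0 + e - (c0 - e)) / (`|w|%:~R / (4 * A ^+ 2)).
  by rewrite /e; field; do ?[apply/andP; split]; by [|exact: lt0r_neq0].
apply: (@atmost_gap' _ _ _ (fun x => x.2%:~R / x.1%:~R)).
- by rewrite divr_gt0 // mulr_gt0 ?exprn_gt0.
- by lra.
- move=> x [Px Sx]; have x0 := nz x Px; case: Px => cx xA xA2 dv le.
  have x0' : (x.1%:~R : R) != 0 by rewrite intr_eq0.
  have : `|x.2%:~R / x.1%:~R - c0| <= e.
    have -> : x.2%:~R / x.1%:~R - c0 = (x.1 * p + x.2 * q)%:~R / (x.1%:~R * q%:~R).
      by rewrite /c0 rmorphD !rmorphM /=; field; apply/andP.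
    rewrite normrM normfV -intr_norm normrM -!intr_norm /e.
    apply: ler_pM => //; rewrite ?ler0z ?invr_ge0 ?mulr_ge0 ?ler0z//.
    rewrite lef_pV2 ?posrE ?mulr_gt0// ?ltr0z ?normr_gt0//.
    by rewrite ler_pM2r.
  by rewrite ler_norml => /andP[]; lra.
- move=> x x' [Px Sx] [Px' Sx'] ne; have x0 := nz x Px; have x0' := nz x' Px'.
  case: Px => cx xA xA2 dv le; case: Px' => cx' xA' xA2' dv' le'.
  apply: slope_gap => //.
  rewrite ler_int; apply: dvdz_norm_le; last first.
    move=> /subr0_eq /(coprime_slope_eq cx cx' (S1 _ _ Sx Sx')) [e1 e2].
    by apply: ne; case: x x' e1 e2 {Sx Sx' x0 x0' cx xA xA2 dv le cx' xA' xA2' dv' le'} => ? ? [? ?] /= -> ->.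
  set D := _ - _.
  have h1 : (w %| D * p)%Z.
    have -> : D * p = x'.2 * (x.1 * p + x.2 * q) - x.2 * (x'.1 * p + x'.2 * q).
      by rewrite /D; ring.
    by rewrite rpredB// dvdz_mull.
  have h2 : (w %| D * q)%Z.
    have -> : D * q = x.1 * (x'.1 * p + x'.2 * q) - x'.1 * (x.1 * p + x.2 * q).
      by rewrite /D; ring.
    by rewrite rpredB// dvdz_mull.
  have /coprimezP[[a b] /= ab] := cpq.
  have -> : D = a * (D * p) + b * (D * q) by rewrite -[LHS]mulr1 -ab; ring.
  by rewrite rpredD// dvdz_mull.
Qed.

End Slope.

(** * Forms and divisors of their values for small arguments *)

Section Reduced.
Variable R : realType.
Variables (B h : R).

(** The cofactor of [t.2] in the value of the form has absolute value at most [4 A1 u^2 h / B]. For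
    each cofactor [atmost_slope] counts the coefficients, and the nonzero value of the form then
    gives back [t.2], so the modulus itself is never summed over. *)
Lemma atmost_forms (A1 A2 : R) (u v : int) : 1 <= B -> 1 <= h -> 0 < A1 -> 0 < A2 ->
  coprimez u v -> u != 0 -> A2 * (v ^+ 2)%:~R <= A1 * (u ^+ 2)%:~R ->
  atmost (fun t : int * int * int =>
    [/\ coprimez t.1.1 t.1.2, `|t.1.1|%:~R < 2 * A1, A2 <= `|t.1.2|%:~R
      & `|t.1.2|%:~R < 2 * A2] /\
    [/\ 0 < t.2, B <= h * t.2%:~R & h * t.2%:~R < 2 * B] /\
    ((t.2 %| t.1.1 * u ^+ 2 + t.1.2 * v ^+ 2)%Z /\
     t.1.1 * u ^+ 2 + t.1.2 * v ^+ 2 != 0))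
  (16 * A1 * (u ^+ 2)%:~R * h / B + 256 * A1 * A2).
Proof.
move=> B0 h0 A10 A20 cuv u0 le.
have h0' : 0 < h by lra.
have B0' : 0 < B by lra.
have uu : 0 < (u ^+ 2)%:~R :> R by rewrite ltr0z exprn_even_gt0.
pose z := 4 * A1 * (u ^+ 2)%:~R * h / B.
have z0 : 0 <= z by rewrite divr_ge0 ?mulr_ge0// ltW.
have -> : 16 * A1 * (u ^+ 2)%:~R * h / B + 256 * A1 * A2 =
  (2 * z) * (2 * (1 + 8 * A2 * (2 * B / h) / `|u ^+ 2|%:~R)).
  rewrite ger0_norm ?exprn_even_ge0// /z; field.
  by rewrite intr_eq0 u0 !lt0r_neq0.
apply: (atmost_fiber (f := fun t => ((t.1.1 * u ^+ 2 + t.1.2 * v ^+ 2) %/ t.2)%Z)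
   (Q := fun w : int => w <> 0 /\ `|w|%:~R <= z)).
- by posR.
- move=> [[x1 x2] y] /= [[cx a1 a2 b2] [[y0 yB yB2] [dv nz]]].
  have e := divzK dv; split; first by move=> w0; rewrite w0 mul0r in e; rewrite -e eqxx in nz.
  have : (`|(x1 * u ^+ 2 + x2 * v ^+ 2) %/ y|%Z * y)%:~R <= 4 * A1 * (u ^+ 2)%:~R :> R.
    rewrite -[X in _ * X](gtr0_norm y0) -normrM e.
    apply: (@le_trans _ _ (`|x1|%:~R * (u ^+ 2)%:~R + `|x2|%:~R * (v ^+ 2)%:~R)).
      rewrite -!intrM -intrD ler_int (le_trans (ler_normD _ _))// !normrM.
      by rewrite -!expr2 !real_normK ?num_real.
    have vv : 0 <= (v ^+ 2)%:~R :> R by rewrite ler0z exprn_even_ge0.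
    have : `|x1|%:~R * (u ^+ 2)%:~R <= 2 * A1 * (u ^+ 2)%:~R.
      by rewrite ler_wpM2r// ltW.
    have : `|x2|%:~R * (v ^+ 2)%:~R <= 2 * A2 * (v ^+ 2)%:~R.
      by rewrite ler_wpM2r// ltW.
    lra.
  rewrite intrM /z => hw; rewrite ler_pdivlMr//.
  set W := `|_|%:~R in hw *.
  have W0 : 0 <= W by rewrite ler0z.
  apply: (@le_trans _ _ (W * y%:~R * h)); last by rewrite ler_wpM2r// ltW.
  by rewrite -mulrA ler_wpM2l// mulrC.
- exact: atmost_nzint.
- move=> w [w0 wz].
  (* The coordinates are swapped so that the slope count is divided by [u^2], which cancels against
     the number of cofactors. *)
  apply: (atmost_inj (f := fun t => (t.1.2, t.1.1))); last first.
  + apply: (@atmost_slope R (v ^+ 2) (u ^+ 2) w A2 (2 * B / h)) => //.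
    * by rewrite coprimezXl// coprimezXr// coprimez_sym.
    * by rewrite expf_eq0.
    * exact/eqP.
    * by rewrite divr_ge0 ?mulr_ge0// ltW.
  + move=> [[x1 x2] y] [[x1' x2'] y'] /= [[_ [_ [d nz]]] ew] [[_ [_ [d' _]]] ew'] [e2 e1].
    rewrite -{}e2 -{}e1 in d' ew' *; congr (_, _).
    have := divzK d; have := divzK d'; rewrite ew ew' => <- /mulfI -> //.
    exact/eqP.
  + move=> [[x1 x2] y] /= [[[cx a1 a2 b2] [[y0 yB yB2] [dv nz]]] ew].
    have e := divzK dv; rewrite ew in e.
    split => //; first by rewrite coprimez_sym.
      by rewrite addrC -e dvdz_mulr.
    rewrite addrC -e normrM mulrC intrM ler_wpM2r ?ler0z//.
    by rewrite gtr0_norm// ler_pdivlMr// mulrC ltW.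
Qed.

Variables (s1 s2 alpha beta : R).

(* [(u, v)] is the Thue approximation of the root [r] after removing its gcd,
   and [h] the part of that gcd dividing the modulus, so the modulus is [h * y]. *)
Definition reduced (t : (int * int) * (int * int) * int) :=
  let: ((x1, x2), (u, v), y) := t in
  [/\ coprimez x1 x2, coprimez u v, u != 0 & v != 0] /\
  [/\ s1 ^+ 2 <= `|x1|%:~R, `|x1|%:~R < 2 * s1 ^+ 2,
      s2 ^+ 2 <= `|x2|%:~R & `|x2|%:~R < 2 * s2 ^+ 2] /\
  [/\ h * `|u|%:~R <= alpha, h * `|v|%:~R <= beta, 0 < y, B <= h * y%:~R
    & h * y%:~R < 2 * B] /\
  ((y %| x1 * u ^+ 2 + x2 * v ^+ 2)%Z /\ x1 * u ^+ 2 + x2 * v ^+ 2 != 0).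

(** The box balances the two terms of the form: [h^2 s1^2 u^2] and [h^2 s2^2 v^2] are at most
    [2 B s1 s2]. So each (u, v) admits at most [(32 + 256) s1^2 s2^2] triples, and there are at most
    [8 B / h^2] pairs (u, v); finally 8 times 288 is [48^2]. *)
Lemma atmost_reduced : 1 <= B -> 1 <= h -> 1 <= s1 -> 1 <= s2 ->
  0 < alpha -> 0 < beta -> s1 * alpha ^+ 2 = 2 * B * s2 ->
  s2 * beta ^+ 2 = 2 * B * s1 -> alpha * beta = 2 * B ->
  atmost reduced (48 ^+ 2 * s1 ^+ 2 * s2 ^+ 2 * B / h ^+ 2).
Proof.
move=> B0 h0 s10 s20 al0 be0 Hal Hbe Hab.
have h0' : 0 < h by lra.
have B0' : 0 < B by lra.
have s1p : 0 < s1 by lra.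
have s2p : 0 < s2 by lra.
have -> : 48 ^+ 2 * s1 ^+ 2 * s2 ^+ 2 * B / h ^+ 2 =
  ((2 * (alpha / h)) * (2 * (beta / h))) * (288 * s1 ^+ 2 * s2 ^+ 2).
  have -> : 2 * (alpha / h) * (2 * (beta / h)) = 4 * (alpha * beta) / h ^+ 2 by field; rewrite lt0r_neq0.
  by rewrite Hab; field; rewrite lt0r_neq0.
have key (r1 r2 g : R) (u : int) : 1 <= r1 -> 1 <= r2 ->
    0 < g -> r1 * g ^+ 2 = 2 * B * r2 -> h * `|u|%:~R <= g ->
    16 * r1 ^+ 2 * (u ^+ 2)%:~R * h / B + 256 * r1 ^+ 2 * r2 ^+ 2 <= 288 * r1 ^+ 2 * r2 ^+ 2.
  move=> r10 r20 g0 e hu.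
  have hu2 : h ^+ 2 * (u ^+ 2)%:~R <= g ^+ 2.
    have -> : h ^+ 2 * (u ^+ 2)%:~R = (h * `|u|%:~R) ^+ 2.
      by rewrite exprMn intr_norm real_normK ?num_real// -rmorphXn.
    by rewrite lerXn2r// ?nnegrE ?mulr_ge0 ?ler0z// ltW.
  have u2 : 0 <= (u ^+ 2)%:~R :> R by rewrite ler0z exprn_even_ge0.
  suff : 16 * r1 ^+ 2 * (u ^+ 2)%:~R * h / B <= 32 * r1 ^+ 2 * r2 ^+ 2 by lra.
  rewrite ler_pdivrMr//.
  have a1 : 16 * r1 ^+ 2 * (u ^+ 2)%:~R * h <= 16 * r1 ^+ 2 * (h ^+ 2 * (u ^+ 2)%:~R).
    rewrite -subr_ge0 [X in 0 <= X](_ : _ = 16 * r1 ^+ 2 * (u ^+ 2)%:~R * (h * (h - 1))); last by ring.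
    by posR.
  have a2 : 16 * r1 ^+ 2 * (h ^+ 2 * (u ^+ 2)%:~R) <= 16 * r1 ^+ 2 * g ^+ 2.
    by rewrite ler_wpM2l//; posR.
  have a3 : 16 * r1 ^+ 2 * g ^+ 2 = 32 * r1 * r2 * B.
    have -> : 16 * r1 ^+ 2 * g ^+ 2 = 16 * r1 * (r1 * g ^+ 2) by ring.
    by rewrite e; ring.
  have a4 : r1 * r2 <= r1 ^+ 2 * r2 ^+ 2.
    have -> : r1 ^+ 2 * r2 ^+ 2 = (r1 * r2) * (r1 * r2) by ring.
    have : 1 <= r1 * r2 by nra.
    by move: (r1 * r2) => q; nra.
  apply: (le_trans a1); apply: (le_trans a2); rewrite a3.
  have -> : 32 * r1 ^+ 2 * r2 ^+ 2 * B = 32 * B * (r1 ^+ 2 * r2 ^+ 2) by ring.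
  have -> : 32 * r1 * r2 * B = 32 * B * (r1 * r2) by ring.
  by rewrite ler_pM2l//; lra.
apply: (atmost_fiber (f := fun t => t.1.2)
  (Q := fun z : int * int => [/\ coprimez z.1 z.2, z.1 <> 0 /\ `|z.1|%:~R <= alpha / h &
        z.2 <> 0 /\ `|z.2|%:~R <= beta / h])).
- by posR.
- move=> [[[x1 x2] [u v]] y] /= [[cx cuv u0 v0] [_ [[hu hv _ _ _] _]]].
  by rewrite !ler_pdivlMr// !(mulrC _ h); split=> //; split=> //; apply/eqP.
- apply: atmost_sub (lexx _) (atmost_pair (P := fun z : int => z <> 0 /\ `|z|%:~R <= alpha / h)
     (Q := fun z : int => z <> 0 /\ `|z|%:~R <= beta / h) _ (atmost_nzint _) (atmost_nzint _)).
  + by move=> z [].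
  + by rewrite mulr_ge0// divr_ge0// ltW.
  + by rewrite divr_ge0// ltW.
  + by rewrite divr_ge0// ltW.
move=> [u v] /= [cuv [u0 hu] [v0 hv]].
move: hu hv; rewrite !ler_pdivlMr// !(mulrC _ h) => hu hv.
(* [atmost_forms] wants the dominant term to be that of its first variable; the opposite case
   exchanges the indices. *)
have [le|/ltW le] := leP (s2 ^+ 2 * (v ^+ 2)%:~R) (s1 ^+ 2 * (u ^+ 2)%:~R).
  have H := @atmost_forms (s1 ^+ 2) (s2 ^+ 2) u v B0 h0 (exprn_gt0 _ s1p) (exprn_gt0 _ s2p) cuv (introN eqP u0) le.
  apply: (atmost_sub (fun x H => H) (key s1 s2 alpha u _ _ _ _ hu)) => //.
    apply: (atmost_inj (f := fun t => (t.1.1, t.2))) H; last first.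
      move=> [[[x1 x2] [a b]] y] [[[x1' x2'] [a' b']] y'] /=.
      by move=> [_ [-> ->]] [_ [-> ->]] [-> -> ->].
    move=> [[[x1 x2] [a b]] y] /= [[[cx cab a0 b0] [[k1 k2 k3 k4] [[l1 l2 l3 l4 l5] [dv nz]]]] [ea eb]].
    by rewrite -ea -eb.
have H := @atmost_forms (s2 ^+ 2) (s1 ^+ 2) v u B0 h0 (exprn_gt0 _ s2p) (exprn_gt0 _ s1p) _ (introN eqP v0) le.
have -> : 288 * s1 ^+ 2 * s2 ^+ 2 = 288 * s2 ^+ 2 * s1 ^+ 2 by ring.
apply: (atmost_sub (fun x H => H) (key s2 s1 beta v s20 s10 be0 Hbe hv)).
  apply: (atmost_inj (f := fun t => ((t.1.1.2, t.1.1.1), t.2))) (H _); last by rewrite coprimez_sym.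
    move=> [[[x1 x2] [a b]] y] /= [[[cx cab a0 b0] [[k1 k2 k3 k4] [[l1 l2 l3 l4 l5] [dv nz]]]] [ea eb]].
    by rewrite -ea -eb coprimez_sym addrC.
  move=> [[[x1 x2] [a b]] y] [[[x1' x2'] [a' b']] y'] /=.
  by move=> [_ [-> ->]] [_ [-> ->]] [-> -> ->].
Qed.

End Reduced.

Lemma gcdz_cofactors (u v : int) : (u != 0) || (v != 0) ->
  exists g u' v' : int, [/\ 0 < g, u = u' * g, v = v' * g & coprimez u' v'].
Proof.
move=> uv; have g0 : 0 < gcdz u v.
  by rewrite lt_def gcdz_eq0 negb_and uv.
have /dvdzP[u' eu] := dvdz_gcdl u v; have /dvdzP[v' ev] := dvdz_gcdr u v.
exists (gcdz u v), u', v'; split => //.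
have [a [b ab]] := Bezoutz u v.
apply/coprimezP; exists (a, b) => /=.
apply: (@mulIf _ (gcdz u v)); first by rewrite gt_eqF.
by rewrite mul1r mulrDl -!mulrA -eu -ev.
Qed.

(** * From roots modulo y to reduced Thue pairs *)

Section Roots.
Variable R : realType.
Variables (s1 s2 B : R).

(* [t = ((x1, x2), (y, r))] with [r] a root of [x1 r^2 + x2] modulo [y]. *)
Definition rootquad (t : (int * int) * (int * int)) :=
  let: ((x1, x2), (y, r)) := t in
  [/\ coprimez x1 x2, squarefreez x1 & squarefreez x2] /\
  [/\ s1 ^+ 2 <= `|x1|%:~R, `|x1|%:~R < 2 * s1 ^+ 2,
      s2 ^+ 2 <= `|x2|%:~R & `|x2|%:~R < 2 * s2 ^+ 2] /\
  [/\ 0 < y, B <= y%:~R, y%:~R < 2 * B, 0 <= r & r < y] /\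
  [/\ coprimez r y, coprimez x1 y, coprimez x2 y & (y %| x1 * r ^+ 2 + x2)%Z].

(** Dividing the Thue pair by its gcd [g] keeps the congruence only modulo [y' = y / h] with
    [h = gcd(g, y)]. As [h <= g], the box shrinks by [h] at least. Outside the corner of unit
    coefficients [isotropic_unit] makes the form nonzero. *)
Lemma rootquad_reduced (alpha beta : R) x1 x2 y r :
  1 <= B -> 1 <= s1 -> 1 <= s2 -> (1 < s1 \/ 1 < s2) ->
  2 < alpha -> 2 < beta -> alpha * beta = 2 * B ->
  rootquad ((x1, x2), (y, r)) ->
  exists h y' u v : int, [/\ 0 < h, y = h * y',
    reduced B h%:~R s1 s2 alpha beta ((x1, x2), (u, v), y') &
    (y' %| u - r * v)%Z].
Proof.
move=> B0 s10 s20 s12 al0 be0 Hab.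
move=> [[cx q1 q2] [[a1 a2 b1 b2] [[y0 yB yB2 r0 ry] [cr c1 c2 dv]]]].
have [u [v [uv0 ua vb duv]]] : exists u v : int,
    [/\ (u != 0) || (v != 0), `|u|%:~R <= alpha, `|v|%:~R <= beta & (y %| u - r * v)%Z].
  have y0' : (0 < `|y|)%N by rewrite absz_gt0 gt_eqF.
  have al := truncn_itv (_ : 0 <= alpha); have be := truncn_itv (_ : 0 <= beta).
  have /andP[al1 al2] : (Num.truncn alpha)%:R <= alpha < (Num.truncn alpha).+1%:R by apply: al; lra.
  have /andP[be1 be2] : (Num.truncn beta)%:R <= beta < (Num.truncn beta).+1%:R by apply: be; lra.
  have lt : (`|y| < (Num.truncn alpha).+1 * (Num.truncn beta).+1)%N.
    rewrite -(ltr_nat R) natrM.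
    have -> : `|y|%:R = y%:~R :> R by rewrite pmulrn gtz0_abs.
    rewrite (lt_trans yB2)// -Hab; apply: ltr_pM => //; lra.
  have [u [v [uv ua vb d]]] := thue r y0' lt.
  rewrite gtz0_abs// in d; exists u, v; split => //.
    by apply: le_trans al1; rewrite pmulrn ler_int.
  by apply: le_trans be1; rewrite pmulrn ler_int.
have [g [u' [v' [g0 eu ev cuv]]]] := gcdz_cofactors uv0.
have [h [g' [y' [h0 eg ey]]]] := @gcdz_cofactors g y (introT orP (or_introl (lt0r_neq0 g0))).
move=> /coprimezP[[a b] /= ab].
have hE : a * g + b * y = h by rewrite eg ey -[RHS]mul1r -ab; ring.
have hg : h <= g.
  have : (h %| g)%Z by rewrite eg dvdz_mull.
  by move=> /dvdz_norm_le -/(_ (elimN eqP (lt0r_neq0 g0))); rewrite !gtr0_norm.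
have y'0 : 0 < y' by move: y0; rewrite ey pmulr_lgt0.
have dy : (y' %| y)%Z by rewrite ey dvdz_mulr.
have duv' : (y' %| u' - r * v')%Z.
  rewrite -(@dvdz_mul2l h) ?gt_eqF// (mulrC h y') -ey -hE.
  have -> : (a * g + b * y) * (u' - r * v') =
    a * (u - r * v) + (b * (u' - r * v')) * y by rewrite eu ev; ring.
  by rewrite rpredD ?dvdz_mull.
have dx : (y' %| x1 * u' ^+ 2 + x2 * v' ^+ 2)%Z.
  have -> : x1 * u' ^+ 2 + x2 * v' ^+ 2 = (x1 * (u' + r * v')) * (u' - r * v')
    + v' ^+ 2 * (x1 * r ^+ 2 + x2) by ring.
  rewrite rpredD ?dvdz_mull// (dvdz_trans _ dv)// ey dvdz_mulr//.
have h0r : 0 < h%:~R :> R by rewrite ltr0z.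
have bnd (w w' : int) (c : R) : w = w' * g -> `|w|%:~R <= c -> h%:~R * `|w'|%:~R <= c.
  move=> ew; apply: le_trans; rewrite -intrM ler_int ew normrM (gtr0_norm g0).
  by rewrite mulrC ler_wpM2l.
have hu := bnd _ _ _ eu ua; have hv := bnd _ _ _ ev vb.
have hy : y%:~R = h%:~R * y'%:~R :> R by rewrite -intrM mulrC -ey.
(* If one of [u'], [v'] vanished, the other would be a unit, [y'] would divide a coefficient prime
   to [y], and [y = h] would be at most one side of the box. But [y >= B], while each side is below
   [B] because [alpha * beta = 2 * B] and both exceed 2. *)
have y'1 (x w w' : int) (c : R) : coprimez x y -> w = 0 -> coprimez w w' ->
    (y' %| x * w' ^+ 2)%Z -> h%:~R * `|w'|%:~R <= c -> y%:~R <= c.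
  move=> cxy w0; rewrite w0 => /eqP; rewrite gcd0z => w1.
  have -> : w' ^+ 2 = 1 by case: (eqVneq w' 1) => [->|ne]//; have -> : w' = -1 by move: w1 ne; clear; lia.
  rewrite mulr1 -abszE w1 mulr1 => dyx; suff e : y' = 1 by rewrite hy e mulr1.
  have : (y' %| 1)%Z.
    apply: (coprimez_dvd1 dyx); rewrite coprimez_sym in cxy *.
    by apply: coprimez_dvdl cxy; exact: dy.
  by rewrite dvdz1; move: y'0; clear; lia.
exists h, y', u', v'; split => //; first by rewrite mulrC.
rewrite /reduced -hy; split; last split => //; last split => //; last split => //.
- split => //; apply/eqP => z0.
    have : y%:~R <= beta.
      apply: (y'1 x2 u' v') => //; move: dx; rewrite z0 expr0n mulr0 add0r.
      by [].
    have : 2 * beta < alpha * beta by rewrite ltr_pM2r//; lra.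
    by lra.
  have : y%:~R <= alpha.
    apply: (y'1 x1 v' u') => //; first by rewrite coprimez_sym.
    by move: dx; rewrite z0 expr0n mulr0 addr0.
  have : alpha * 2 < alpha * beta by rewrite ltr_pM2l//; lra.
  by lra.
apply/eqP => /(isotropic_unit cx cuv q1 q2) [n1 n2].
have A1 : `|x1|%:~R = 1 :> R by rewrite -abszE n1.
have A2 : `|x2|%:~R = 1 :> R by rewrite -abszE n2.
rewrite A1 in a1; rewrite A2 in b1; case: s12 => {}s12; nra.
Qed.

(* Two roots with the same [gcd(r - r0, y)] differ by a multiple of [y / 2], so a
   root is recovered up to a bounded ambiguity from this gcd. *)
Lemma atmost_root_class x1 x2 y r0 e : 0 < y -> coprimez x1 y ->
  coprimez r0 y -> (y %| x1 * r0 ^+ 2 + x2)%Z ->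
  atmost (fun r : int => [/\ 0 <= r, r < y, (y %| x1 * r ^+ 2 + x2)%Z
    & gcdz (r - r0) y = e]) (3 : R).
Proof.
move=> y0 c1 cr0 d0.
have y0' : 0 < y%:~R :> R by rewrite ltr0z.
have -> : 3 = 1 + (y%:~R - 0) / (y%:~R / 2) :> R by field; rewrite lt0r_neq0.
apply: (@atmost_gap' _ _ _ (fun r => r%:~R)).
- by posR.
- by posR.
- by move=> r [r0' ry _ _]; rewrite ler0z r0' ler_int ltW.
move=> r r' [h1 h2 d g] [h1' h2' d' g'] ne.
have K z : (y %| x1 * z ^+ 2 + x2)%Z -> (y %| z ^+ 2 - r0 ^+ 2)%Z.
  move=> dz; rewrite -(@Gauss_dvdzr y x1); last by rewrite coprimez_sym.
  have -> : x1 * (z ^+ 2 - r0 ^+ 2) = (x1 * z ^+ 2 + x2) - (x1 * r0 ^+ 2 + x2) by ring.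
  by rewrite rpredB.
have := root_dvd (lt0r_neq0 y0) cr0 (K _ d) (K _ d') (etrans g (esym g')).
move=> /dvdz_norm_le H; have {}H : y <= 2 * `|r - r'| by lia.
rewrite -intrB -intr_norm ler_pdivrMr// -[2]/(2%:~R) -intrM ler_int; lia.
Qed.

End Roots.

(** * Counting coefficient pairs together with a modulus and a root *)

Section RootCount.
Variable R : realType.

Lemma sum_inv_sq n : \sum_(1 <= k < n.+1) (k%:R ^- 2) <= 2 :> R.
Proof.
case: n => [|n]; first by rewrite big_geq.
apply: (@le_trans _ _ (2 - n.+1%:R^-1)); last by rewrite gerBl.
elim: n => [|n IH]; first by rewrite big_nat1 expr1n invr1; lra.
rewrite big_nat_recr//= (le_trans (lerD IH (lexx _)))//.
have n0 : 0 < n.+1%:R :> R by [].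
rewrite -(natr1 n.+1); move: n0; move: (n.+1%:R) => x x0.
have x1 : 0 < x + 1 by lra.
rewrite -subr_ge0 [X in 0 <= X](_ : _ = (x * (x + 1) ^+ 2)^-1).
  by posR.
by field; rewrite !lt0r_neq0.
Qed.

Variables (s1 s2 B : R).

Lemma atmost_yr : 1 <= B ->
  atmost (fun z : int * int => [/\ 0 < z.1, z.1%:~R <= 2 * B, 0 <= z.2 & (z.2 + 1)%:~R <= 2 * B])
   (2 * B * (2 * B)).
Proof.
move=> B0.
apply: atmost_sub (lexx _) (atmost_pair (P := fun z : int => 0 < z /\ z%:~R <= 2 * B)
  (Q := fun z : int => 0 <= z /\ (z + 1)%:~R <= 2 * B) _ (atmost_posint _) _); try lra.
  by move=> z [].
apply: (atmost_inj (f := fun z : int => z + 1)) (@atmost_posint R (2 * B) _); last by lra.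
  by move=> z [z0 ?]; split=> //; lia.
by move=> z z' _ _ /addIr.
Qed.

(** The condition says that the side [Num.sqrt (2 * B * s2 / s1)] of the Thue box is at most 2. Then
    [B <= 2 s1^2], so the class of [x1] modulo [y] fixed by (x2, y, r) meets its range in O(s1^2 /
    B) points, and (y, r) may be counted trivially. *)
Lemma atmost_roots_skew1 : 1 <= B -> 1 <= s1 -> 1 <= s2 -> s2 * B <= 2 * s1 ->
  atmost (rootquad s1 s2 B) (96 * s1 ^+ 2 * s2 ^+ 2 * B).
Proof.
move=> B0 s10 s20 sk.
have Bs : B <= 2 * s1 ^+ 2 by nra.
have B0' : 0 < B by lra.
have s1p : 0 <= s1 ^+ 2 by posR.
have s2p : 0 <= s2 ^+ 2 by posR.
apply: (@atmost_sub _ _ _ (rootquad s1 s2 B) _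
  ((2 * (2 * s2 ^+ 2)) * (2 * B * (2 * B)) * (1 + (2 * s1 ^+ 2 - - (2 * s1 ^+ 2)) / B))) => //.
  have -> : 2 * (2 * s2 ^+ 2) * (2 * B * (2 * B)) * (1 + (2 * s1 ^+ 2 - - (2 * s1 ^+ 2)) / B)
    = 16 * s2 ^+ 2 * B * B + 64 * s1 ^+ 2 * s2 ^+ 2 * B by field; rewrite lt0r_neq0.
  have : 16 * s2 ^+ 2 * B * B <= 16 * s2 ^+ 2 * B * (2 * s1 ^+ 2) by rewrite ler_wpM2l//; posR.
  lra.
apply: (atmost_fiber (f := fun t => (t.1.2, t.2)) (Q := fun z : int * (int * int) =>
   (z.1 <> 0 /\ `|z.1|%:~R <= 2 * s2 ^+ 2) /\
   [/\ 0 < z.2.1, z.2.1%:~R <= 2 * B, 0 <= z.2.2 & (z.2.2 + 1)%:~R <= 2 * B])).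
- by posR.
- move=> [[x1 x2] [y r]] /= [_ [[_ _ k3 k4] [[y0 yB yB2 r0 ry] _]]].
  split.
    split; last by rewrite ltW.
    by move=> x20; rewrite x20 normr0 in k3; nra.
  split=> //; first by rewrite ltW.
  by apply: le_trans (ltW yB2); rewrite ler_int; move: ry; clear; lia.
- apply: (atmost_pair _ (atmost_nzint _) (atmost_yr _)) => //; posR.
move=> [x2 [y r]] _.
apply: (@atmost_gap' _ _ _ (fun t => t.1.1%:~R)) => //; first by lra.
  move=> [[x1 x2'] [y' r']] /= [[_ [[_ k2 _ _] _]] _].
  by rewrite -ler_norml -intr_norm ltW.
move=> [[a a2] [ay ar]] [[b b2] [bY br]] /= [Ha [e1 e2 e3]] [Hb [f1 f2 f3]] ne.
subst a2 ay ar b2 bY br.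
case: Ha => _ [_ [[y0 yB _ _ _] [cr _ _ d]]]; case: Hb => _ [_ [_ [_ _ _ d']]].
rewrite -intrB -intr_norm; apply: (le_trans yB); rewrite ler_int -[leLHS](gtr0_norm y0).
apply: dvdz_norm_le; last by move=> /subr0_eq e; apply: ne; rewrite e.
rewrite -(@Gauss_dvdzl y (a - b) (r ^+ 2)); last by rewrite coprimezXr// coprimez_sym.
have -> : (a - b) * r ^+ 2 = (a * r ^+ 2 + x2) - (b * r ^+ 2 + x2) by ring.
by rewrite rpredB.
Qed.

(** The other side of the Thue box degenerates: here (x1, y, r) fixes the class of [x2] modulo
    [y]. *)
Lemma atmost_roots_skew2 : 1 <= B -> 1 <= s1 -> 1 <= s2 -> s1 * B <= 2 * s2 ->
  atmost (rootquad s1 s2 B) (96 * s1 ^+ 2 * s2 ^+ 2 * B).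
Proof.
move=> B0 s10 s20 sk.
have Bs : B <= 2 * s2 ^+ 2 by nra.
have B0' : 0 < B by lra.
have s1p : 0 <= s1 ^+ 2 by posR.
have s2p : 0 <= s2 ^+ 2 by posR.
apply: (@atmost_sub _ _ _ (rootquad s1 s2 B) _
  ((2 * (2 * s1 ^+ 2)) * (2 * B * (2 * B)) * (1 + (2 * s2 ^+ 2 - - (2 * s2 ^+ 2)) / B))) => //.
  have -> : 2 * (2 * s1 ^+ 2) * (2 * B * (2 * B)) * (1 + (2 * s2 ^+ 2 - - (2 * s2 ^+ 2)) / B)
    = 16 * s1 ^+ 2 * B * B + 64 * s1 ^+ 2 * s2 ^+ 2 * B by field; rewrite lt0r_neq0.
  have : 16 * s1 ^+ 2 * B * B <= 16 * s1 ^+ 2 * B * (2 * s2 ^+ 2) by rewrite ler_wpM2l//; posR.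
  lra.
apply: (atmost_fiber (f := fun t => (t.1.1, t.2)) (Q := fun z : int * (int * int) =>
   (z.1 <> 0 /\ `|z.1|%:~R <= 2 * s1 ^+ 2) /\
   [/\ 0 < z.2.1, z.2.1%:~R <= 2 * B, 0 <= z.2.2 & (z.2.2 + 1)%:~R <= 2 * B])).
- by posR.
- move=> [[x1 x2] [y r]] /= [_ [[k3 k4 _ _] [[y0 yB yB2 r0 ry] _]]].
  split.
    split; last by rewrite ltW.
    by move=> x20; rewrite x20 normr0 in k3; nra.
  split=> //; first by rewrite ltW.
  by apply: le_trans (ltW yB2); rewrite ler_int; move: ry; clear; lia.
- apply: (atmost_pair _ (atmost_nzint _) (atmost_yr _)) => //; posR.
move=> [x1 [y r]] _.
apply: (@atmost_gap' _ _ _ (fun t => t.1.2%:~R)) => //; first by lra.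
  move=> [[x1' x2] [y' r']] /= [[_ [[_ _ _ k2] _]] _].
  by rewrite -ler_norml -intr_norm ltW.
move=> [[a2 a] [ay ar]] [[b2 b] [bY br]] /= [Ha [e1 e2 e3]] [Hb [f1 f2 f3]] ne.
subst a2 ay ar b2 bY br.
case: Ha => _ [_ [[y0 yB _ _ _] [_ _ _ d]]]; case: Hb => _ [_ [_ [_ _ _ d']]].
rewrite -intrB -intr_norm; apply: (le_trans yB); rewrite ler_int -[leLHS](gtr0_norm y0).
apply: dvdz_norm_le; last by move=> /subr0_eq e; apply: ne; rewrite e.
have -> : a - b = (x1 * r ^+ 2 + a) - (x1 * r ^+ 2 + b) by ring.
by rewrite rpredB.
Qed.

(** Roots sharing their reduced data agree modulo [y'], so the gcd of [r - r0] and [y], for a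
    reference root [r0], is [y' k] with [k] dividing [h = k l]. For given [k], [l] there are at most
    [48^2 s1^2 s2^2 B / (k l)^2] reduced data with three roots over each, and the double sum of
    [1 / (k l)^2] is at most 4. *)
Lemma atmost_roots_bulk (alpha beta : R) : 1 <= B -> 1 <= s1 -> 1 <= s2 ->
  (1 < s1 \/ 1 < s2) -> 2 < alpha -> 2 < beta ->
  s1 * alpha ^+ 2 = 2 * B * s2 -> s2 * beta ^+ 2 = 2 * B * s1 ->
  alpha * beta = 2 * B ->
  atmost (rootquad s1 s2 B) (12 * 48 ^+ 2 * s1 ^+ 2 * s2 ^+ 2 * B).
Proof.
move=> B0 s10 s20 s12 al0 be0 Hal Hbe Hab.
have /choice[F HF] : forall t, exists d : (int * int) * (int * int),
    rootquad s1 s2 B t -> [/\ 0 < d.1.1, t.2.1 = d.1.1 * d.1.2,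
      reduced B d.1.1%:~R s1 s2 alpha beta (t.1, d.2, d.1.2) &
      (d.1.2 %| d.2.1 - t.2.2 * d.2.2)%Z].
  move=> -[[x1 x2] [y r]].
  have [H|nH] := pselect (rootquad s1 s2 B ((x1, x2), (y, r))); last by exists ((0, 0), (0, 0)).
  have [h [y' [u [v H']]]] := rootquad_reduced B0 s10 s20 s12 al0 be0 Hab H.
  by exists ((h, y'), (u, v)).
pose D t := (t.1, F t).
(* [G] fixes one reference root for each value of the reduced data. *)
have /choice[G HG] : forall q, exists r0 : int, (exists t, rootquad s1 s2 B t /\ D t = q) ->
      exists t, [/\ rootquad s1 s2 B t, D t = q & t.2.2 = r0].
  move=> q.
  have [[t [Ht Dt]]|nH] := pselect (exists t, rootquad s1 s2 B t /\ D t = q); last by exists 0.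
  by exists t.2.2 => _; exists t.
pose n := Num.truncn (2 * B).
have nP (z : nat) : z%:R <= 2 * B -> (z < n.+1)%N.
  by move=> zB; rewrite ltnS /n -ltnS -(ltr_nat R) (le_lt_trans zB)// truncnS_gt.
pose I := [seq (k, l) | k <- index_iota 1 n.+1, l <- index_iota 1 n.+1].
pose E (i : nat * nat) t := gcdz (t.2.2 - G (D t)) t.2.1 = (F t).1.2 * i.1%:Z /\
  (F t).1.1 = i.1%:Z * i.2%:Z.
pose c := 48 ^+ 2 * s1 ^+ 2 * s2 ^+ 2 * B.
have c0 : 0 <= c by rewrite /c; posR.
apply: (@atmost_sub _ _ _ (rootquad s1 s2 B) _
   (\sum_(i <- I) (c / (i.1%:R * i.2%:R) ^+ 2) * 3)) => //.
  rewrite /I big_allpairs /=.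
  have -> : \sum_(i1 <- index_iota 1 n.+1) \sum_(i2 <- index_iota 1 n.+1)
      c / (i1%:R * i2%:R) ^+ 2 * 3 =
      3 * c * ((\sum_(1 <= k < n.+1) (k%:R ^- 2)) * (\sum_(1 <= k < n.+1) (k%:R ^- 2))).
    rewrite big_distrlr /= mulr_sumr; apply: eq_bigr => k _.
    rewrite mulr_sumr; apply: eq_bigr => l _.
    by rewrite exprMn invfM; ring.
  have -> : 12 * 48 ^+ 2 * s1 ^+ 2 * s2 ^+ 2 * B = 3 * c * (2 * 2) by rewrite /c; ring.
  rewrite ler_wpM2l//; first by posR.
  by apply: ler_pM; rewrite ?sum_inv_sq// sumr_ge0// => k _; posR.
apply: (atmost_cover (E := E)).
  move=> t Ht; have [h0 ey] := HF t Ht.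
  move: (HG (D t) (ex_intro _ t (conj Ht erefl))) => [t0 [Ht0 Dt0 er0]].
  have [h00 ey0] := HF t0 Ht0.
  have [Dt1 Dt2] : t0.1 = t.1 /\ F t0 = F t by case: Dt0.
  rewrite {}Dt2 in h00 ey0 *.
  move: t Ht {Dt0} t0 Ht0 Dt1 er0 ey h00 ey0 h0 => [[x1 x2] [y r]] Ht [[x1' x2'] [y0 r0]] Ht0 /= [-> ->].
  rewrite /E /=; set q := F _; set G0 := G _; move: q G0 => [[h y'] [u v]] G0 /=.
  move=> <- ey _ ey0 h0 [[_ cuv _ _] [_ [[_ _ y'0 _ _] _]]] duv _ duv0.
  have d : (y' %| r - r0)%Z.
    have cv : coprimez v y'.
      rewrite coprimez_sym; apply: coprimez_gcd_dvd1.
      have dv := dvdz_gcdr y' v; have dy := dvdz_gcdl y' v.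
      apply: (@coprimez_dvd1 _ u); last by apply: coprimez_dvdl dv _; rewrite coprimez_sym.
      have -> : u = (u - r * v) + r * v by ring.
      by rewrite rpredD ?dvdz_mull// (dvdz_trans dy).
    rewrite -(@Gauss_dvdzl _ _ v); last by rewrite coprimez_sym.
    have -> : (r - r0) * v = (u - r0 * v) - (u - r * v) by ring.
    by rewrite rpredB.
  have /dvdzP[k ek] : (y' %| gcdz (r - r0) y)%Z by rewrite dvdz_gcd d ey dvdz_mull.
  have y00 : 0 < y by rewrite ey mulr_gt0.
  have g0 : 0 < gcdz (r - r0) y by rewrite lt_def gcdz_eq0 negb_and (gt_eqF y00) orbT.
  have k0 : 0 < k by move: g0; rewrite ek pmulr_lgt0.
  have /dvdzP[l el] : (k %| h)%Z.
    rewrite -(@dvdz_mul2r y') ?gt_eqF// -ek -ey.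
    exact: dvdz_gcdr.
  have l0 : 0 < l by move: h0; rewrite el pmulr_lgt0.
  have hB : h%:~R <= 2 * B.
    case: Ht => _ [_ [[_ _ yB _ _] _]]; apply: le_trans (ltW yB).
    by rewrite ey ler_int ler_peMr//; move: h0 y'0; clear; lia.
  exists (`|k|%N, `|l|%N); last first.
    by rewrite /= !gtz0_abs// ek el; split; rewrite mulrC.
  apply/allpairsP; exists (`|k|%N, `|l|%N); split=> //=; rewrite mem_index_iota.
    apply/andP; split; first by rewrite absz_gt0 gt_eqF.
    apply: nP; apply: le_trans hB; rewrite pmulrn gtz0_abs// ler_int el.
    by rewrite ler_peMl//; move: k0 l0; clear; lia.
  apply/andP; split; first by rewrite absz_gt0 gt_eqF.
  apply: nP; apply: le_trans hB; rewrite pmulrn gtz0_abs// ler_int el.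
  by rewrite ler_peMr//; move: k0 l0; clear; lia.
move=> [k l] /allpairsP[[k' l'] /= [+ + [-> ->]]] {k l}; move: k' l' => k l.
rewrite !mem_index_iota => /andP[k0 _] /andP[l0 _].
have kl0 : 1 <= k%:R * l%:R :> R by rewrite -natrM ler1n muln_gt0 k0 l0.
apply: (atmost_fiber (f := fun t => (t.1, (F t).2, (F t).1.2))
  (Q := reduced B (k%:R * l%:R) s1 s2 alpha beta)) => //.
- move=> t [Ht [_ e]]; have [_ _ + _] := HF t Ht.
  by rewrite e intrM -!pmulrn.
- by apply: atmost_reduced => //; lra.
move=> q _.
apply: atmost_inhabited => // t [[Ht [e1 e2]] et].
have [t0 [Ht0 Dt0 er0]] := HG (D t) (ex_intro _ t (conj Ht erefl)).
have [_ ey0 _ _] := HF t0 Ht0.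
have [Dt1 Dt2] : t0.1 = t.1 /\ F t0 = F t by case: Dt0.
rewrite Dt2 in ey0.
have yy t' : (rootquad s1 s2 B t' /\ E (k, l) t') /\ (t'.1, (F t').2, (F t').1.2) = q ->
    [/\ t'.1 = t.1, t'.2.1 = t0.2.1, F t' = F t & D t' = D t].
  move=> [[Ht' [_ e2']] et']; have [_ ey' _ _] := HF t' Ht'.
  move: et'; rewrite -et => -[q1 q2 q3].
  have FF : F t' = F t.
    by move: e2 e2' q2 q3; case: (F t) => [[? ?] ?]; case: (F t') => [[? ?] ?] /= -> -> -> ->.
  by rewrite /D ey' ey0 FF q1.
have := yy t (conj (conj Ht (conj e1 e2)) et) => -[_ ty _ _].
have rr0 : rootquad s1 s2 B (t.1, (t0.2.1, G (D t))).
  by rewrite -er0 -Dt1 -!surjective_pairing.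
move: rr0; case E1 : t.1 => [x1 x2] [_ [_ [[y0 _ _ _ _] [cr0 cx1 cx2 dr0]]]].
apply: (atmost_inj (f := fun t => t.2.2)) (@atmost_root_class R x1 x2 t0.2.1 (G (D t))
   ((F t).1.2 * k%:Z) y0 cx1 cr0 dr0).
  move=> t' H'; have [q1 q2 q3 q4] := yy t' H'.
  case: H' => [[Ht' [e1' _]] _]; rewrite q3 q4 /= in e1'.
  rewrite E1 in q1; case: t' q1 q2 e1' Ht' {q3 q4} => [[a b] [y r]] /= [-> ->] -> e1' Ht'.
  by case: Ht' => _ [_ [[_ _ _ r0 ry] [_ _ _ d]]].
move=> t1 t2 /yy[q1 q2 _ _] /yy[q1' q2' _ _].
case: t1 q1 q2 => [? [? ?]] /= -> ->; case: t2 q1' q2' => [? [? ?]] /= -> ->.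
by move=> ->.
Qed.

(** The bulk argument needs both sides of the Thue box above 2; each way to fail is one of the skew
    cases. *)
Lemma atmost_rootquad : 1 <= B -> 1 <= s1 -> 1 <= s2 -> (1 < s1 \/ 1 < s2) ->
  atmost (rootquad s1 s2 B) (12 * 48 ^+ 2 * s1 ^+ 2 * s2 ^+ 2 * B).
Proof.
move=> B0 s10 s20 s12.
have s1p : 0 < s1 by lra.
have s2p : 0 < s2 by lra.
have Bp : 0 < B by lra.
have le96 : 96 * s1 ^+ 2 * s2 ^+ 2 * B <= 12 * 48 ^+ 2 * s1 ^+ 2 * s2 ^+ 2 * B.
  rewrite !ler_wpM2r//; [by rewrite ltW|by posR|by posR|].
  have -> : 12 * 48 ^+ 2 = 96 * (12 * 24) :> R by ring.
  by rewrite ler_peMr//; lra.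
have [sk|sk] := leP (s2 * B) (2 * s1).
  exact: atmost_sub (fun x H => H) le96 (atmost_roots_skew1 B0 s10 s20 sk).
have [sk'|sk'] := leP (s1 * B) (2 * s2).
  exact: atmost_sub (fun x H => H) le96 (atmost_roots_skew2 B0 s10 s20 sk').
have e2 : 2 = Num.sqrt (2 ^+ 2) :> R by rewrite sqrtr_sqr ger0_norm.
have a0 : 0 <= 2 * B * s2 / s1 by posR.
have b0 : 0 <= 2 * B * s1 / s2 by posR.
apply: (@atmost_roots_bulk (Num.sqrt (2 * B * s2 / s1)) (Num.sqrt (2 * B * s1 / s2))) => //.
- rewrite [X in X < _]e2.
  by rewrite ltr_sqrt ?ltr_pdivlMr//; [lra|posR].
- rewrite [X in X < _]e2.
  by rewrite ltr_sqrt ?ltr_pdivlMr//; [lra|posR].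
- by rewrite sqr_sqrtr//; field; rewrite lt0r_neq0.
- by rewrite sqr_sqrtr//; field; rewrite lt0r_neq0.
- rewrite -sqrtrM//; have -> : 2 * B * s2 / s1 * (2 * B * s1 / s2) = (2 * B) ^+ 2.
    by field; rewrite !lt0r_neq0.
  by rewrite sqrtr_sqr ger0_norm//; posR.
Qed.

(** Unit coefficients can make the form vanish, so Thue's lemma is avoided. For fixed (x1, x2) the
    tuples are sorted by [e], the gcd of [y] and the distance of [r] to a reference root for [y]: at
    most [2 B / e] multiples of [e], three roots for each. *)
Lemma atmost_rootquad_log (n : nat) : 1 <= B -> 1 <= s1 -> 1 <= s2 -> 2 * B <= n%:R ->
  atmost (rootquad s1 s2 B)
    (96 * s1 ^+ 2 * s2 ^+ 2 * B * \sum_(1 <= e < n.+1) e%:R^-1).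
Proof.
move=> B0 s10 s20 Bn.
have -> : 96 * s1 ^+ 2 * s2 ^+ 2 * B * \sum_(1 <= e < n.+1) e%:R^-1 =
   ((2 * (2 * s1 ^+ 2)) * (2 * (2 * s2 ^+ 2))) * \sum_(1 <= e < n.+1) (2 * B / e%:R * 3).
  have -> : \sum_(1 <= e < n.+1) (2 * B / e%:R * 3) = 6 * B * \sum_(1 <= e < n.+1) e%:R^-1.
    by rewrite mulr_sumr; apply: eq_bigr => e _; ring.
  by ring.
have s1p : 0 <= s1 ^+ 2 by posR.
have s2p : 0 <= s2 ^+ 2 by posR.
apply: (atmost_fiber (f := fst) (Q := fun z : int * int =>
   (z.1 <> 0 /\ `|z.1|%:~R <= 2 * s1 ^+ 2) /\ (z.2 <> 0 /\ `|z.2|%:~R <= 2 * s2 ^+ 2))).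
- by apply: sumr_ge0 => e _; posR.
- move=> [[x1 x2] [y r]] /= [_ [[k1 k2 k3 k4] _]].
  split; (split; last exact: ltW) => x0; [rewrite x0 normr0 in k1|rewrite x0 normr0 in k3]; nra.
- by apply: (atmost_pair _ (atmost_nzint _) (atmost_nzint _)) => //; posR.
move=> [x1 x2] _.
have /choice[G HG] : forall y, exists r0, (exists r, rootquad s1 s2 B ((x1, x2), (y, r))) ->
    rootquad s1 s2 B ((x1, x2), (y, r0)).
  move=> y; have [[r Hr]|nH] := pselect (exists r, rootquad s1 s2 B ((x1, x2), (y, r))).
    by exists r.
  by exists 0.
apply: (atmost_cover (E := fun e t => gcdz (t.2.2 - G t.2.1) t.2.1 = e%:Z)).
  move=> [[a b] [y r]] /= [[_ [_ [[y0 yB yB2 _ _] _]]] _].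
  have g0 : 0 < gcdz (r - G y) y by rewrite lt_def gcdz_eq0 negb_and (gt_eqF y0) orbT.
  exists `|gcdz (r - G y) y|%N; last by rewrite gtz0_abs.
  rewrite mem_index_iota; apply/andP; split; first by rewrite absz_gt0 gt_eqF.
  rewrite ltnS -(ler_nat R).
  rewrite pmulrn gtz0_abs//; apply: le_trans Bn; apply: le_trans (ltW yB2).
  rewrite ler_int -[leLHS]gtr0_norm// -[leRHS]gtr0_norm//.
  by apply: dvdz_norm_le; [exact: dvdz_gcdr|exact/eqP/lt0r_neq0].
move=> e; rewrite mem_index_iota => /andP[e0 _].
have e0' : 0 < e%:R :> R by rewrite ltr0n.
apply: (atmost_fiber (f := fun t => (t.2.1 %/ e%:Z)%Z)
   (Q := fun z : int => 0 < z /\ z%:~R <= 2 * B / e%:R)) => //.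
- move=> [[a b] [y r]] /= [[[_ [_ [[y0 yB yB2 _ _] _]]] _] ge].
  have /dvdzP[f ef] : (e%:Z %| y)%Z by rewrite -ge dvdz_gcdr.
  have e00 : e%:Z != 0 by rewrite eqz_nat -lt0n.
  rewrite ef mulzK//; split; first by move: y0; rewrite ef pmulr_lgt0// ltz_nat.
  by rewrite ler_pdivlMr// (pmulrn _ e) -intrM -ef ltW.
- by apply: atmost_posint; posR.
move=> f _; apply: atmost_inhabited => // -[[a b] [y r]] [[[Ht +] +] +] /=.
move=> [ea eb] ge ef; subst a b.
have yy (t : (int * int) * (int * int)) : gcdz (t.2.2 - G t.2.1) t.2.1 = e%:Z -> (t.2.1 %/ e%:Z)%Z = f -> t.2.1 = y.
  move=> ge' ef'; have d : (e%:Z %| y)%Z by rewrite -ge dvdz_gcdr.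
  have d' : (e%:Z %| t.2.1)%Z by rewrite -ge' dvdz_gcdr.
  by rewrite -(divzK d) -(divzK d') ef ef'.
have := HG y (ex_intro _ r Ht) => -[_ [_ [[y0 _ _ _ _] [cr0 cx1 cx2 dr0]]]].
apply: (atmost_inj (f := fun t => t.2.2)) (@atmost_root_class R x1 x2 y (G y) e%:Z y0 cx1 cr0 dr0).
  move=> [[a b] [y' r']] /= [[[Ht' [ea eb]] ge'] ef']; subst a b.
  have e1 := yy ((x1, x2), (y', r')) ge' ef'; rewrite /= in e1; subst y'.
  by case: Ht' => _ [_ [[_ _ _ r0 ry] [_ _ _ d]]].
move=> t1 t2 [[[_ a1] a2] a3] [[[_ b1] b2] b3] /=.
have := yy _ a2 a3; have := yy _ b2 b3.
case: t1 a1 {a2 a3} => [? [? ?]] /= ->; case: t2 b1 {b2 b3} => [? [? ?]] /= ->.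
by move=> -> -> ->.
Qed.

End RootCount.

(** * The upper bound *)

Section Solutions.
Variable R : realType.

(** The coefficients absorb the signs of the equation. Taking [|x3|] largest yields the hypothesis
    [s1 * s2 <= A3] of [atmost_box]; ordering the first two terms makes [|x1| y1^2] the largest term
    up to a factor 2. *)
Definition sol (T : R) (t : (int * int * int) * (int * int * int)) :=
  let: ((x1, x2, x3), (y1, y2, y3)) := t in
  ([/\ x1 != 0, x2 != 0 & x3 != 0] /\ [/\ 0 < y1, 0 < y2 & 0 < y3]) /\
  ([/\ coprimez x1 x2, coprimez x1 x3 & coprimez x2 x3] /\
   [/\ coprimez y1 y2, coprimez y1 y3 & coprimez y2 y3]) /\
  [/\ squarefreez x1, squarefreez x2 & squarefreez x3] /\
  x1 * y1 ^+ 2 + x2 * y2 ^+ 2 + x3 * y3 ^+ 2 = 0 /\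
  [/\ `|x1| <= `|x3|, `|x2| <= `|x3| & `|x2| * y2 ^+ 2 <= `|x1| * y1 ^+ 2] /\
  (`|x1| * `|x2| * `|x3| * (`|x1| * y1 ^+ 2))%:~R <= T.

Lemma coprime_coef (x1 x2 x3 y1 y2 y3 : int) : coprimez x1 x2 -> coprimez y2 y3 ->
  x1 * y1 ^+ 2 + x2 * y2 ^+ 2 + x3 * y3 ^+ 2 = 0 -> coprimez x1 y3.
Proof.
move=> cx cy e; apply: coprimez_gcd_dvd1.
have dx := dvdz_gcdl x1 y3; have dy := dvdz_gcdr x1 y3.
apply: (@coprimez_dvd1 _ (x2 * y2 ^+ 2)).
  have -> : x2 * y2 ^+ 2 = - (y1 ^+ 2) * x1 + (- (x3 * y3)) * y3.
    by apply/eqP; rewrite -subr_eq0; apply/eqP; rewrite -[RHS]e; ring.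
  by rewrite rpredD// dvdz_mull.
rewrite coprimezMr (coprimez_dvdl dx cx) coprimezXr// (coprimez_dvdl dy)//.
by rewrite coprimez_sym.
Qed.

Definition in_box (s1 s2 A3 B U : R) (t : (int * int * int) * (int * int * int)) :=
  let: ((x1, x2, x3), (y1, y2, y3)) := t in
  [/\ s1 ^+ 2 <= `|x1|%:~R, `|x1|%:~R < 2 * s1 ^+ 2,
      s2 ^+ 2 <= `|x2|%:~R & `|x2|%:~R < 2 * s2 ^+ 2] /\
  [/\ A3 <= `|x3|%:~R & `|x3|%:~R < 2 * A3] /\
  [/\ B <= y3%:~R, y3%:~R < 2 * B, U <= y1%:~R & y1%:~R < 2 * U].

(** Eliminating [x2] makes [y3^2] divide [x1] times a difference of two squares, and the common
    class [r] makes [y3] divide the determinant; [dvdz_sq_double] combines both. A zero determinant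
    would force equal [y1], [y2] by coprimality, and then equal [x3]. *)
Lemma sol_det (T T' : R) x1 x2 x3 x3' y1 y2 y1' y2' y3 r :
  sol T ((x1, x2, x3), (y1, y2, y3)) -> sol T' ((x1, x2, x3'), (y1', y2', y3)) ->
  (y3 %| r * y2 - y1)%Z -> (y3 %| r * y2' - y1')%Z ->
  ((x1, x2, x3), (y1, y2, y3)) <> ((x1, x2, x3'), (y1', y2', y3)) ->
  y3 ^+ 2 <= 2 * `|y1 * y2' - y1' * y2|.
Proof.
move=> [[[x10 x20 x30] [y10 y20 y30]] [[[c12 c13 c23] [d12 d13 d23]] [_ [e _]]]].
move=> [[_ [y10' y20' _]] [[_ [d12' d13' d23']] [_ [e' _]]]] r1 r2 ne.
have c1 := coprime_coef c12 d23 e.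
have H : (y3 ^+ 2 %| 2 * (y1 * y2' - y1' * y2))%Z.
  apply: (@dvdz_sq_double y3 _ (y1' * y2)); first exact: lt0r_neq0.
  - have -> : y1 * y2' - y1' * y2 = y2 * (r * y2' - y1') - y2' * (r * y2 - y1) by ring.
    by rewrite rpredB// dvdz_mull.
  - rewrite -(@Gauss_dvdzr _ x1); last by rewrite coprimezXl// coprimez_sym.
    have -> : x1 * ((y1 * y2' - y1' * y2) * (y1 * y2' - y1' * y2 + 2 * (y1' * y2))) =
      (x3' * y2 ^+ 2 - x3 * y2' ^+ 2) * y3 ^+ 2.
      apply/eqP; rewrite -subr_eq0; apply/eqP.
      transitivity ((x1 * y1 ^+ 2 + x2 * y2 ^+ 2 + x3 * y3 ^+ 2) * y2' ^+ 2 -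
        (x1 * y1' ^+ 2 + x2 * y2' ^+ 2 + x3' * y3 ^+ 2) * y2 ^+ 2); first by ring.
      by rewrite e e' !mul0r subrr.
    exact: dvdz_mull.
  - by rewrite coprimezMl d13' d23.
have n0 : y1 * y2' - y1' * y2 <> 0.
  move=> /subr0_eq /(coprime_slope_eq d12 d12' (mulr_gt0 y10 y10')) [e1 e2].
  apply: ne; rewrite -e1 -e2; congr (_, _, _, _).
  apply: (@mulIf _ (y3 ^+ 2)); first by rewrite expf_eq0 gt_eqF.
  by apply: (addrI (x1 * y1 ^+ 2 + x2 * y2 ^+ 2)); rewrite e e1 e2 e'.
have := dvdz_norm_le H; rewrite (normrM 2) (@ger0_norm _ (y3 ^+ 2)) ?exprn_even_ge0//; apply.
by move=> /eqP; rewrite mulf_eq0 => /eqP.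
Qed.

(** With [t = Y2 / Y1] the difference of the first two terms is [X2 Y1^2 (t0^2 - t^2)]. Here
    [t0^2 - t^2 >= t0 (t0 - t)], and [t0 X2], the square root of [X1 X2], is at least [s1 s2]. *)
Lemma slope_window (X1 X2 X3 Y1 Y2 Y3 t0 s1 s2 A3 B U : R) : 0 < t0 ->
  t0 ^+ 2 = X1 / X2 -> X2 * Y2 ^+ 2 <= X1 * Y1 ^+ 2 ->
  X1 * Y1 ^+ 2 - X2 * Y2 ^+ 2 <= X3 * Y3 ^+ 2 ->
  [/\ 0 < X1, 0 < X2, 0 < Y1, 0 < Y2 & 0 < Y3] ->
  [/\ 0 < s1, 0 < s2, 0 < A3, 0 < B & 0 < U] ->
  s1 ^+ 2 <= X1 -> s2 ^+ 2 <= X2 -> 0 <= X3 <= 2 * A3 -> Y3 <= 2 * B -> U <= Y1 ->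
  t0 - 8 * A3 * B ^+ 2 / (U ^+ 2 * (s1 * s2)) <= Y2 / Y1 <= t0.
Proof.
move=> t00 t0E l3 l4 [X10 X20 Y10 Y20 Y30] [s10 s20 A30 B0 U0] k1 k2 /andP[X30 k3] k4 k5.
set t := Y2 / Y1.
have tp : 0 < t by rewrite /t; posR.
have tt0 : t <= t0.
  rewrite -(@ler_pXn2r _ 2)// ?nnegrE ?(ltW tp) ?(ltW t00)// t0E /t expr_div_n.
  by rewrite ler_pdivrMr ?exprn_gt0// mulrAC ler_pdivlMr// mulrC.
apply/andP; split => //.
rewrite lerBlDr -lerBlDl.
have h1 : (t0 - t) * t0 <= t0 ^+ 2 - t ^+ 2.
  rewrite -subr_ge0; have -> : t0 ^+ 2 - t ^+ 2 - (t0 - t) * t0 = (t0 - t) * t by ring.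
  by apply: mulr_ge0; rewrite ?subr_ge0// ltW.
have h2 : (t0 ^+ 2 - t ^+ 2) * (X2 * Y1 ^+ 2) <= 8 * A3 * B ^+ 2.
  have -> : (t0 ^+ 2 - t ^+ 2) * (X2 * Y1 ^+ 2) = X1 * Y1 ^+ 2 - X2 * Y2 ^+ 2.
    by rewrite t0E /t; field; rewrite !lt0r_neq0.
  apply: (le_trans l4).
  have -> : 8 * A3 * B ^+ 2 = (2 * A3) * (2 * B) ^+ 2 by ring.
  by apply: ler_pM => //; [posR|rewrite lerXn2r// ?nnegrE; posR].
have h3 : U ^+ 2 * (s1 * s2) <= t0 * (X2 * Y1 ^+ 2).
  have -> : t0 * (X2 * Y1 ^+ 2) = Y1 ^+ 2 * (t0 * X2) by ring.
  apply: ler_pM; [by posR|by posR|by rewrite lerXn2r// ?nnegrE; posR|].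
  rewrite -(@ler_pXn2r _ 2)// ?nnegrE; [|by posR|by posR].
  have -> : (t0 * X2) ^+ 2 = X1 * X2.
    by rewrite exprMn t0E; field; rewrite lt0r_neq0.
  by rewrite exprMn; apply: ler_pM => //; posR.
rewrite ler_pdivlMr; last by posR.
apply: (le_trans _ h2).
apply: (@le_trans _ _ ((t0 - t) * (t0 * (X2 * Y1 ^+ 2)))).
  by rewrite ler_wpM2l// subr_ge0.
by rewrite mulrA ler_wpM2r//; posR.
Qed.

(** The gap [B^2 / (8 U^2)] from [sol_det] is set against the window of [slope_window]: [B] and [U]
    cancel, leaving [8 * 8 * A3 / (s1 * s2)]. *)
Lemma atmost_sol_class (T s1 s2 A3 B U : R) (x1 x2 y3 r : int) :
  1 <= B -> 1 <= U -> 1 <= s1 -> 1 <= s2 -> 0 < A3 ->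
  atmost (fun t => [/\ sol T t, in_box s1 s2 A3 B U t,
      (t.1.1.1, t.1.1.2, t.2.2) = (x1, x2, y3) & (y3 %| r * t.2.1.2 - t.2.1.1)%Z])
    (1 + 64 * A3 / (s1 * s2)).
Proof.
move=> B0 U0 s10 s20 A30.
have [s1p s2p Bp Up] : [/\ 0 < s1, 0 < s2, 0 < B & 0 < U] by split; lra.
pose t0 : R := Num.sqrt (`|x1|%:~R / `|x2|%:~R).
pose W := 8 * A3 * B ^+ 2 / (U ^+ 2 * (s1 * s2)).
have W0 : 0 <= W by rewrite /W; posR.
have -> : 64 * A3 / (s1 * s2) = (t0 - (t0 - W)) / (B ^+ 2 / 2 / (4 * U ^+ 2)).
  have -> : t0 - (t0 - W) = W by ring.
  by rewrite /W; field; rewrite !lt0r_neq0//; lra.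
apply: (@atmost_gap' _ _ _ (fun t => t.2.1.2%:~R / t.2.1.1%:~R)).
- by posR.
- by lra.
- move=> [[[a1 a2] x3] [[y1 y2] y]] /= [+ + [e1 e2 e3] _]; rewrite {}e1 {}e2 {}e3.
  move=> [[[x10 x20 x30] [y10 y20 y30]] [_ [_ [e [[l1 l2 l3] _]]]]].
  move=> [[k1 k2 k3 k4] [[k5 k6] [k7 k8 k9 k10]]].
  have X1 : 0 < `|x1|%:~R :> R by rewrite ltr0z normr_gt0.
  have X2 : 0 < `|x2|%:~R :> R by rewrite ltr0z normr_gt0.
  have Y1 : 0 < y1%:~R :> R by rewrite ltr0z.
  have Y2 : 0 < y2%:~R :> R by rewrite ltr0z.
  have Y3 : 0 < y3%:~R :> R by rewrite ltr0z.
  have t00 : 0 < t0 by rewrite sqrtr_gt0; posR.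
  have t0E : t0 ^+ 2 = `|x1|%:~R / `|x2|%:~R by rewrite sqr_sqrtr//; posR.
  have l3' : `|x2|%:~R * y2%:~R ^+ 2 <= `|x1|%:~R * y1%:~R ^+ 2 :> R.
    by rewrite -!rmorphXn -!intrM ler_int.
  have l4 : `|x1|%:~R * y1%:~R ^+ 2 - `|x2|%:~R * y2%:~R ^+ 2 <= `|x3|%:~R * y3%:~R ^+ 2 :> R.
    rewrite -!rmorphXn -!intrM -intrB ler_int.
    have q2 (z : int) : z ^+ 2 = `|z ^+ 2| by rewrite ger0_norm// exprn_even_ge0.
    rewrite (q2 y1) (q2 y2) (q2 y3) -!normrM lerBlDr.
    have -> : x1 * y1 ^+ 2 = - (x3 * y3 ^+ 2) - x2 * y2 ^+ 2.
      by apply/eqP; rewrite -subr_eq0; apply/eqP; rewrite -[RHS]e; ring.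
    by rewrite (le_trans (ler_normB _ _))// normrN.
  apply: slope_window t00 t0E l3' l4 _ _ k1 k3 _ (ltW k8) k9 => //.
  by rewrite ler0z normr_ge0 ltW.
move=> [[[a1 a2] x3] [[y1 y2] y]] [[[b1 b2] x3'] [[y1' y2'] y']] /=.
move=> [S1 Bx1 [ea1 ea2 ey] d1] [S2 Bx2 [eb1 eb2 ey'] d2] ne; subst a1 a2 y b1 b2 y'.
have dd := sol_det S1 S2 d1 d2 ne.
case: S1 => [[_ [y10 _ y30]] _]; case: S2 => [[_ [y10' _ _]] _].
case: Bx1 => _ [_ [k7 _ _ k10]]; case: Bx2 => _ [_ [_ _ _ k10']].
apply: slope_gap => //; [by rewrite gtr0_norm|by rewrite gtr0_norm|by rewrite gt_eqF|
  by rewrite gt_eqF| |by posR].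
rewrite ler_pdivrMr//.
apply: (@le_trans _ _ (y3 ^+ 2)%:~R).
  by rewrite rmorphXn lerXn2r// ?nnegrE; [lra|rewrite ler0z ltW].
by rewrite -[2]/(2%:~R) -intrM ler_int mulrC.
Qed.

(** Dividing the equation by [y2^2] modulo [y3] makes [y1 / y2] a root, so a solution lies over a
    [rootquad]. As [s1 * s2 <= A3], the additive 1 of the fibre count is absorbed and 64 becomes
    65. *)
Lemma atmost_box (T s1 s2 A3 B U c : R) :
  1 <= B -> 1 <= U -> 1 <= s1 -> 1 <= s2 -> s1 * s2 <= A3 ->
  atmost (rootquad s1 s2 B) c ->
  atmost (fun t => sol T t /\ in_box s1 s2 A3 B U t) (c * (65 * A3 / (s1 * s2))).
Proof.
move=> B0 U0 s10 s20 sA H.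
have s0 : 0 < s1 * s2 by posR.
have /choice[r Hr] : forall t, exists r : int, sol T t ->
    [/\ 0 <= r, r < t.2.2 & (t.2.2 %| r * t.2.1.2 - t.2.1.1)%Z].
  move=> [[[x1 x2] x3] [[y1 y2] y3]] /=.
  have [S|nS] := pselect (sol T (x1, x2, x3, (y1, y2, y3))); last by exists 0.
  case: S => [[_ [_ _ y30]] [[_ [_ _ /coprimezP[[a b] /= ab]]] _]].
  exists ((a * y1) %% y3)%Z => _; rewrite modz_ge0 ?gt_eqF// ltz_pmod//; split=> //.
  have -> : ((a * y1) %% y3)%Z = a * y1 - ((a * y1) %/ y3)%Z * y3.
    by rewrite {2}(divz_eq (a * y1) y3) addrC addKr.
  have -> : (a * y1 - ((a * y1) %/ y3)%Z * y3) * y2 - y1 =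
     (- b * y1 - ((a * y1) %/ y3)%Z * y2) * y3.
    apply/eqP; rewrite -subr_eq0; apply/eqP.
    transitivity (((a * y2 + b * y3) - 1) * y1); first by ring.
    by rewrite ab subrr mul0r.
  exact: dvdz_mull.
apply: (atmost_fiber (f := fun t => ((t.1.1.1, t.1.1.2), (t.2.2, r t)))) H _; first by posR.
  move=> t [S Bx]; have [r0 ry rd] := Hr t S; move: (r t) r0 ry rd => r' r0 ry rd {Hr r}.
  move: r' t S Bx r0 ry rd => r t.
  move: t => [[[x1 x2] x3] [[y1 y2] y3]] /=.
  move=> [[[x10 x20 x30] [y10 y20 y30]] [[[c12 c13 c23] [d12 d13 d23]] [[q1 q2 _] [e _]]]].
  move=> [kk [_ [k7 k8 _ _]]] r0 ry rd.
  have c1 : coprimez x1 y3 by exact: coprime_coef e.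
  have c2 : coprimez x2 y3.
    apply: (@coprime_coef x2 x1 x3 y2 y1 y3) => //; first by rewrite coprimez_sym.
    by rewrite -[RHS]e; ring.
  have d23' : coprimez y2 y3 by [].
  split=> //; split=> //; split=> //; split=> //.
    apply: coprimez_gcd_dvd1; apply: (@coprimez_dvd1 _ y1); last first.
      by apply: (coprimez_dvdl (dvdz_gcdr r y3)); rewrite coprimez_sym.
    have -> : y1 = y2 * r - (r * y2 - y1) by ring.
    by rewrite rpredB ?dvdz_mull ?dvdz_gcdl// (dvdz_trans (dvdz_gcdr r y3)).
  rewrite -(@Gauss_dvdzl _ _ (y2 ^+ 2)); last by rewrite coprimezXr// coprimez_sym.
  have -> : (x1 * r ^+ 2 + x2) * y2 ^+ 2 = (x1 * (r * y2 + y1)) * (r * y2 - y1) + (- (x3 * y3)) * y3.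
    apply/eqP; rewrite -subr_eq0; apply/eqP; rewrite -[RHS]e; ring.
  by rewrite rpredD// dvdz_mull.
move=> [[x1 x2] [y3 r0]] _.
have A30 : 0 < A3 by lra.
apply: atmost_sub _ _ (@atmost_sol_class T s1 s2 A3 B U x1 x2 y3 r0 B0 U0 s10 s20 A30).
  move=> t [[S Bx] [e1 e2 e3 e4]]; split=> //; first by rewrite e1 e2 e3.
  by have [_ _ +] := Hr t S; rewrite e3 e4.
have : 1 <= A3 / (s1 * s2) by rewrite ler_pdivlMr// mul1r.
by rewrite -!mulrA; lra.
Qed.

End Solutions.

(** * Dyadic decomposition and geometric summation *)

Section Dyadic.
Variable R : realType.

Lemma atmost_cover_nat (X : eqType) (P : X -> Prop) (f : X -> nat) (L : nat) (n : nat -> R) :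
  (forall x, P x -> (f x <= L)%N) ->
  (forall i, (i <= L)%N -> atmost (fun x => P x /\ f x = i) (n i)) ->
  atmost P (\sum_(0 <= i < L.+1) n i).
Proof.
move=> fL Pn; apply: (atmost_cover (E := fun i x => f x = i)).
  by move=> x Px; exists (f x) => //; rewrite mem_index_iota ltnS fL.
by move=> i; rewrite mem_index_iota ltnS => /Pn.
Qed.

Lemma sum_pow2 n : \sum_(0 <= b < n) 2 ^+ b <= 2 ^+ n :> R.
Proof.
elim: n => [|n IH]; first by rewrite big_geq.
by rewrite big_nat_recr//= exprS; lra.
Qed.

Lemma sum_pow2_le (w : R) n : 0 <= w ->
  \sum_(0 <= b < n) (if 2 ^+ b <= w then 2 ^+ b else 0) <= 2 * w.
Proof.
move=> w0; elim: n => [|n IH]; first by rewrite big_geq// mulr_ge0.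
rewrite big_nat_recr//=; case: ifPn => h; last by rewrite addr0.
apply: (@le_trans _ _ (2 ^+ n + 2 ^+ n)); last by lra.
rewrite lerD2r; apply: le_trans (sum_pow2 n).
by apply: ler_sum => b _; case: ifP => // _; rewrite exprn_ge0.
Qed.

Lemma harmonic_pow2 b : \sum_(1 <= e < (2 ^ b).+1) e%:R^-1 <= b.+1%:R :> R.
Proof.
elim: b => [|b IH]; first by rewrite expn0 big_nat1 invr1.
have le : ((2 ^ b).+1 <= (2 ^ b.+1).+1)%N by rewrite ltnS leq_exp2l.
rewrite (big_cat_nat _ le)//= -natr1 lerD//.
apply: (@le_trans _ _ (\sum_((2 ^ b).+1 <= e < (2 ^ b.+1).+1) (2 ^ b)%:R^-1)).
  rewrite big_nat_cond [leRHS]big_nat_cond; apply: ler_sum => e /andP[/andP[h1 h2] _].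
  rewrite lef_pV2 ?posrE ?ltr0n ?expn_gt0//; last exact: leq_ltn_trans h1.
  by rewrite ler_nat ltnW.
rewrite sumr_const_nat subSS expnS mul2n -addnn addnK -[_ *+ _]mulr_natl mulfV//.
Qed.

Definition lg (x : int) : nat := trunc_log 2 `|x|.

Lemma lg_bounds (x : int) : x != 0 ->
  2 ^+ lg x <= `|x|%:~R :> R /\ `|x|%:~R < 2 * 2 ^+ lg x :> R.
Proof.
move=> x0; have h : (0 < `|x|)%N by rewrite absz_gt0.
have /andP[h1 h2] := trunc_log_bounds (isT : (1 < 2)%N) h.
by rewrite -exprS -abszE -pmulrn -!natrX ler_nat ltr_nat h1 h2.
Qed.

(** Boxes are indexed by square roots of the coefficient sizes, so [sq2 ^+ a] encodes the size
    [2 ^+ a]. *)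
Definition sq2 : R := Num.sqrt 2.

Lemma sq2X_sqr a : (sq2 ^+ a) ^+ 2 = 2 ^+ a.
Proof. by rewrite -exprM mulnC exprM sqr_sqrtr. Qed.

Lemma sq2_gt1 : 1 < sq2.
Proof. by rewrite -[ltLHS]sqrtr1 ltr_sqrt// ltr1n. Qed.

Lemma sq2X_ge1 a : 1 <= sq2 ^+ a.
Proof. by rewrite exprn_ege1// ltW// sq2_gt1. Qed.

Lemma sq2X_gt0 a : 0 < sq2 ^+ a.
Proof. by rewrite (lt_le_trans ltr01)// sq2X_ge1. Qed.

Lemma lg_le (x y : int) : `|x| <= `|y| -> (lg x <= lg y)%N.
Proof. by move=> h; apply: leq_trunc_log; lia. Qed.

Lemma sol_size_bounds (a b c u w P : int) : 0 < a -> 0 < b -> 0 < c -> 0 < u -> 0 < w ->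
  c * w ^+ 2 <= 2 * (a * u ^+ 2) -> P = a * b * c * (a * u ^+ 2) ->
  [/\ a <= P, b <= P, c <= P, u <= P & w <= P].
Proof.
move=> a0 b0 c0 u0 w0; rewrite !expr2 => h ->.
have mle (p q : int) : 0 < p -> 0 < q -> p <= p * q by clear; nia.
have mle' (p q : int) : 0 < p -> 0 < q -> p <= q * p by clear; nia.
have au : 0 < a * (u * u) by rewrite !mulr_gt0.
have abc : 0 < a * b * c by rewrite !mulr_gt0.
have P1 : a * (u * u) <= a * b * c * (a * (u * u)) by exact: mle'.
have P2 : a * b * c <= a * b * c * (a * (u * u)) by exact: mle.
split.
- by apply: le_trans P2; rewrite -mulrA; apply: mle => //; rewrite mulr_gt0.
- by apply: le_trans P2; rewrite -mulrA mulrCA; apply: mle => //; rewrite mulr_gt0.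
- by apply: le_trans P2; apply: mle' => //; rewrite mulr_gt0.
- apply: le_trans P1; rewrite mulrA; apply: mle' => //; rewrite mulr_gt0//.
apply: le_trans P1; have ww : w * w <= 2 * (a * (u * u)).
  by apply: le_trans h; apply: mle' => //; rewrite mulr_gt0.
by move: w0 ww au; move: (a * (u * u)) => M; clear; nia.
Qed.

(** 65 is the fibre factor of [atmost_box]; [12 * 48 ^+ 2] and the logarithmic [96 * L.+2%:R] come
    from [atmost_rootquad] and [atmost_rootquad_log], the latter for unit coefficients only. *)
Definition cell_const (L a1 a2 : nat) : R := 65 * (12 * 48 ^+ 2) +
  (if (a1 == 0%N) && (a2 == 0%N) then 65 * (96 * L.+2%:R) else 0).

Lemma sol_lg_bounds (T : R) (L : nat) x1 x2 x3 y1 y2 y3 : T < 2 ^+ L.+1 ->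
  sol T ((x1, x2, x3), (y1, y2, y3)) ->
  [/\ (lg x1 <= L)%N, (lg x2 <= L)%N, (lg x3 <= L)%N, (lg y1 <= L)%N & (lg y3 <= L)%N].
Proof.
move=> TL [[[x10 x20 x30] [y10 y20 y30]] [_ [_ [e [[l1 l2 l3] hT]]]]].
have K (x : int) : x != 0 -> `|x| <= `|x1| * `|x2| * `|x3| * (`|x1| * y1 ^+ 2) -> (lg x <= L)%N.
  move=> x0 hx; have [h1 _] := lg_bounds x0.
  have : 2 ^+ lg x < 2 ^+ L.+1 :> R.
    apply: (le_lt_trans h1); apply: le_lt_trans TL; apply: le_trans hT.
    by rewrite ler_int.
  by rewrite ltr_eXn2l ?ltr1n.
have h : `|x3| * y3 ^+ 2 <= 2 * (`|x1| * y1 ^+ 2).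
  have q2 (z : int) : z ^+ 2 = `|z ^+ 2| by rewrite ger0_norm// exprn_even_ge0.
  have -> : `|x3| * y3 ^+ 2 = `|x1 * y1 ^+ 2 + x2 * y2 ^+ 2|.
    rewrite (q2 y3) -normrM -normrN; congr `|_|; apply/eqP; rewrite -subr_eq0.
    by apply/eqP; rewrite -[RHS]oppr0 -e; ring.
  apply: (le_trans (ler_normD _ _)); rewrite (normrM x1) (normrM x2) -!q2; move: l3; clear; lia.
have n0 (x : int) : x != 0 -> 0 < `|x| by rewrite normr_gt0.
have [b1 b2 b3 b4 b5] := sol_size_bounds (n0 _ x10) (n0 _ x20) (n0 _ x30) y10 y30 h erefl.
by split; apply: K => //; rewrite ?gt_eqF// gtr0_norm.
Qed.

Lemma term3_le (T : R) x1 x2 x3 y1 y2 y3 :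
  sol T ((x1, x2, x3), (y1, y2, y3)) -> `|x3| * y3 ^+ 2 <= 2 * (`|x1| * y1 ^+ 2).
Proof.
move=> [[[x10 x20 x30] [y10 y20 y30]] [_ [_ [e [[l1 l2 l3] hT]]]]].
have q2 (z : int) : z ^+ 2 = `|z ^+ 2| by rewrite ger0_norm// exprn_even_ge0.
have -> : `|x3| * y3 ^+ 2 = `|x1 * y1 ^+ 2 + x2 * y2 ^+ 2|.
  rewrite (q2 y3) -normrM -normrN; congr `|_|; apply/eqP; rewrite -subr_eq0.
  by apply/eqP; rewrite -[RHS]oppr0 -e; ring.
apply: (le_trans (ler_normD _ _)); rewrite (normrM x1) (normrM x2) -!q2; move: l3; clear; lia.
Qed.

Lemma sol_in_box (T : R) x1 x2 x3 y1 y2 y3 : sol T ((x1, x2, x3), (y1, y2, y3)) ->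
  in_box (sq2 ^+ lg x1) (sq2 ^+ lg x2) (2 ^+ lg x3) (2 ^+ lg y3) (2 ^+ lg y1)
    ((x1, x2, x3), (y1, y2, y3)).
Proof.
move=> [[[x10 x20 x30] [y10 y20 y30]] _]; rewrite /in_box !sq2X_sqr.
have [h1 h1'] := lg_bounds x10; have [h2 h2'] := lg_bounds x20.
have [h3 h3'] := lg_bounds x30.
have [h4 h4'] := lg_bounds (lt0r_neq0 y10); have [h5 h5'] := lg_bounds (lt0r_neq0 y30).
by move: h4 h4' h5 h5'; rewrite (gtr0_norm y10) (gtr0_norm y30).
Qed.

(** These are the end points of the geometric sums over the sizes of [y1] and [y3]: the height
    bounds the former, and [term3_le] the latter in terms of the former. *)
Lemma sol_scales (T : R) x1 x2 x3 y1 y2 y3 : 0 <= T ->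
  sol T ((x1, x2, x3), (y1, y2, y3)) ->
  [/\ sq2 ^+ lg x1 * sq2 ^+ lg x2 <= 2 ^+ lg x3,
      2 ^+ lg y1 <= Num.sqrt T / ((sq2 ^+ lg x1) ^+ 2 * sq2 ^+ lg x2 * sq2 ^+ lg x3)
    & 2 ^+ lg y3 <= 4 * sq2 ^+ lg x1 * 2 ^+ lg y1 / sq2 ^+ lg x3].
Proof.
move=> T0 S; have t3 := term3_le S; have := sol_in_box S.
case: S => [[[x10 x20 x30] [y10 y20 y30]] [_ [_ [_ [[l1 l2 _] hT]]]]].
have /lg_le g1 := l1; have /lg_le g2 := l2.
rewrite /in_box.
have c1 : sq2 ^+ lg x1 <= sq2 ^+ lg x3 by rewrite ler_eXn2l// sq2_gt1.
have c2 : sq2 ^+ lg x2 <= sq2 ^+ lg x3 by rewrite ler_eXn2l// sq2_gt1.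
rewrite -(sq2X_sqr (lg x3)).
have := sq2X_gt0 (lg x1); have := sq2X_gt0 (lg x2); have := sq2X_gt0 (lg x3).
have U0 : 0 < 2 ^+ lg y1 :> R by rewrite exprn_gt0.
have B0 : 0 < 2 ^+ lg y3 :> R by rewrite exprn_gt0.
move: (2 ^+ lg y1) (2 ^+ lg y3) U0 B0 => U B U0 B0.
move: (sq2 ^+ lg x1) (sq2 ^+ lg x2) (sq2 ^+ lg x3) c1 c2 => s1 s2 s3 c1 c2 s30 s20 s10.
move=> [[k1 k2 k3 k4] [[k5 k6] [k7 k8 k9 k10]]].
have X1 : 0 <= `|x1|%:~R :> R by rewrite ler0z.
have X2 : 0 <= `|x2|%:~R :> R by rewrite ler0z.
have X3 : 0 <= `|x3|%:~R :> R by rewrite ler0z.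
have hT' : `|x1|%:~R * `|x2|%:~R * `|x3|%:~R * (`|x1|%:~R * y1%:~R ^+ 2) <= T.
  by rewrite -rmorphXn -!intrM.
have t3' : `|x3|%:~R * y3%:~R ^+ 2 <= 2 * (`|x1|%:~R * y1%:~R ^+ 2) :> R.
  by rewrite -!rmorphXn -!intrM -[2]/(2%:~R) -intrM ler_int.
move: (`|x1|%:~R) (`|x2|%:~R) (`|x3|%:~R) (y1%:~R) (y3%:~R) X1 X2 X3 hT' t3' k1 k2 k3 k4 k5 k6 k7 k8 k9 k10.
move=> a b c u w a0 b0 c0 hT' t3' k1 k2 k3 k4 k5 k6 k7 k8 k9 k10.
clear -T0 U0 B0 c1 c2 s10 s20 s30 a0 b0 c0 hT' t3' k1 k2 k3 k4 k5 k6 k7 k8 k9 k10.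
split.
- by rewrite expr2; apply: ler_pM => //; posR.
- rewrite ler_pdivlMr; last by posR.
  rewrite -(@ler_pXn2r _ 2)// ?nnegrE ?sqrtr_ge0 ?sqr_sqrtr//; last by posR.
  apply: le_trans hT'.
  have -> : (U * (s1 ^+ 2 * s2 * s3)) ^+ 2 =
    s1 ^+ 2 * s2 ^+ 2 * s3 ^+ 2 * (s1 ^+ 2 * U ^+ 2) by ring.
  do !(apply: ler_pM => //; try posR).
rewrite ler_pdivlMr//.
rewrite -(@ler_pXn2r _ 2)// ?nnegrE; [|by posR|by posR].
apply: (@le_trans _ _ (c * w ^+ 2)).
  rewrite exprMn mulrC; apply: ler_pM => //; try posR.
  by rewrite lerXn2r// ?nnegrE; posR.
apply: (le_trans t3').
have -> : (4 * s1 * U) ^+ 2 = 2 * ((2 * s1 ^+ 2) * (2 * U) ^+ 2) by ring.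
rewrite ler_pM2l//; apply: ler_pM => //; [by posR|exact: ltW|].
by rewrite lerXn2r// ?nnegrE; [posR|posR|exact: ltW].
Qed.

Lemma atmost_rootquad_dyadic (L a1 a2 b : nat) : (b <= L)%N ->
  atmost (rootquad (sq2 ^+ a1) (sq2 ^+ a2) (2 ^+ b))
   (cell_const L a1 a2 / 65 * (sq2 ^+ a1) ^+ 2 * (sq2 ^+ a2) ^+ 2 * 2 ^+ b).
Proof.
move=> bL.
have s1 := sq2X_ge1 a1; have s2 := sq2X_ge1 a2.
have B1 : 1 <= 2 ^+ b :> R by rewrite exprn_ege1// ler1n.
have s10 := sq2X_gt0 a1; have s20 := sq2X_gt0 a2.
have B0 : 0 < 2 ^+ b :> R by rewrite exprn_gt0.
rewrite /cell_const; case: ifPn => [/andP[/eqP a10 /eqP a20]|].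
  have n2 : 2 * 2 ^+ b <= (2 ^ b.+1)%:R :> R by rewrite natrX exprS.
  apply: atmost_sub (atmost_rootquad_log B1 s1 s2 n2) => //.
  have H := harmonic_pow2 b.+1.
  have LL : b.+2%:R <= L.+2%:R :> R by rewrite ler_nat !ltnS.
  move: H; move: (\sum_(1 <= e < _) _) => h H.
  apply: (@le_trans _ _ (96 * (sq2 ^+ a1) ^+ 2 * (sq2 ^+ a2) ^+ 2 * 2 ^+ b * L.+2%:R)).
    by rewrite ler_wpM2l//; [posR|exact: le_trans LL].
  rewrite -subr_ge0 [X in 0 <= X](_ : _ = 12 * 48 ^+ 2 * (sq2 ^+ a1) ^+ 2 * (sq2 ^+ a2) ^+ 2 * 2 ^+ b).
    by posR.
  by field.
move=> h; rewrite addr0 (mulrC 65) mulfK//.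
apply: atmost_rootquad => //.
have := sq2_gt1 => q; move: h; rewrite negb_and => /orP[h|h]; [left|right].
  by rewrite exprn_egt1.
by rewrite exprn_egt1.
Qed.

Lemma cell_const_ge0 L a1 a2 : 0 <= cell_const L a1 a2.
Proof. by rewrite /cell_const; apply: addr_ge0; [posR|case: ifP => // _; posR]. Qed.

(** With [k] the cell constant, a box contributes [k s1 s2 s3^2 B]. Summing over dyadic [B] up to
    [4 s1 U / s3] gives [8 k s1^2 s2 s3 U]; summing over [U] up to [Num.sqrt T / (s1^2 s2 s3)] then
    removes every power of [s1], [s2], [s3]. *)
Lemma atmost_sol_cell (T : R) (L a1 a2 a3 : nat) : 0 <= T -> T < 2 ^+ L.+1 ->
  atmost (fun t => ((sol T t /\ lg t.1.1.1 = a1) /\ lg t.1.1.2 = a2) /\ lg t.1.2 = a3)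
    (cell_const L a1 a2 * 16 * Num.sqrt T).
Proof.
move=> T0 TL.
set P := (P in atmost P).
pose s1 : R := sq2 ^+ a1; pose s2 : R := sq2 ^+ a2; pose s3 : R := sq2 ^+ a3.
have [s10 s20 s30] : [/\ 0 < s1, 0 < s2 & 0 < s3] by split; exact: sq2X_gt0.
have k0 := cell_const_ge0 L a1 a2; set k := cell_const L a1 a2 in k0 *.
pose w2 := Num.sqrt T / (s1 ^+ 2 * s2 * s3).
pose w1 c := 4 * s1 * 2 ^+ c / s3.
have U0 c : 0 < 2 ^+ c :> R by rewrite exprn_gt0.
have w20 : 0 <= w2 by rewrite divr_ge0 ?sqrtr_ge0//; posR.
have bL t : P t -> (lg t.2.1.1 <= L)%N /\ (lg t.2.2 <= L)%N.
  by case: t => [[[x1 x2] x3] [[y1 y2] y3]] [[[/(sol_lg_bounds TL)[]]]].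
(* The value 0 beyond the cut-offs is right because [sol_scales] shows those boxes to be empty. *)
pose n c b : R := if 2 ^+ c <= w2 then
  (if 2 ^+ b <= w1 c then k * (s1 * s2 * s3 ^+ 2) * 2 ^+ b else 0) else 0.
apply: (@atmost_sub _ _ _ P _ (\sum_(0 <= c < L.+1) \sum_(0 <= b < L.+1) n c b)) => //.
  apply: (@le_trans _ _ (\sum_(0 <= c < L.+1)
      k * 8 * (s1 ^+ 2 * s2 * s3) * (if 2 ^+ c <= w2 then 2 ^+ c else 0))).
    apply: ler_sum => c _; rewrite /n; case: ifPn => _; last by rewrite mulr0 big1.
    have -> : \sum_(0 <= b < L.+1)
       (if 2 ^+ b <= w1 c then k * (s1 * s2 * s3 ^+ 2) * 2 ^+ b else 0) =
       k * (s1 * s2 * s3 ^+ 2) * \sum_(0 <= b < L.+1) (if 2 ^+ b <= w1 c then 2 ^+ b else 0).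
      by rewrite mulr_sumr; apply: eq_bigr => b _; case: ifP; rewrite ?mulr0.
    apply: (@le_trans _ _ (k * (s1 * s2 * s3 ^+ 2) * (2 * w1 c))).
      rewrite ler_wpM2l//; first by posR.
      by apply: sum_pow2_le; rewrite /w1; posR.
    rewrite le_eqVlt; apply/orP; left; apply/eqP; rewrite /w1; field.
    by rewrite lt0r_neq0.
  rewrite -mulr_sumr.
  apply: (@le_trans _ _ (k * 8 * (s1 ^+ 2 * s2 * s3) * (2 * w2))).
    by rewrite ler_wpM2l//; [posR|exact: sum_pow2_le].
  rewrite le_eqVlt; apply/orP; left; apply/eqP; rewrite /w2; field.
  by rewrite !lt0r_neq0.
apply: (atmost_cover_nat (f := fun t => lg t.2.1.1)); first by move=> t /bL[].
move=> c cL.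
apply: (atmost_cover_nat (f := fun t => lg t.2.2)); first by move=> t [/bL[]].
move=> b bL'.
apply: atmost_inhabited.
  by rewrite /n; do 2!case: ifP => // _; posR.
move=> [[[x1 x2] x3] [[y1 y2] y3]] /= [[[[[S e1] e2] e3] e4] e5].
have [h1 h2 h3] := sol_scales T0 S; move: h1 h2 h3.
rewrite e1 e2 e3 e4 e5 -/s1 -/s2 -/s3 -/w2 -/(w1 c) => h1 h2 h3.
rewrite /n h2 h3.
have B1 m : 1 <= 2 ^+ m :> R by rewrite exprn_ege1// ler1n.
have := @atmost_box R T s1 s2 (2 ^+ a3) (2 ^+ b) (2 ^+ c) _ (B1 b) (B1 c)
  (sq2X_ge1 _) (sq2X_ge1 _) h1 (@atmost_rootquad_dyadic L a1 a2 b bL').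
apply: atmost_sub.
  move=> [[[x1' x2'] x3'] [[y1' y2'] y3']] /= [[[[[S' f1] f2] f3] f4] f5].
  by split=> //; have := sol_in_box S'; rewrite f1 f2 f3 f4 f5.
rewrite -/s1 -/s2 -/k -(sq2X_sqr a3) -/s3 le_eqVlt; apply/orP; left; apply/eqP.
by field; rewrite !lt0r_neq0.
Qed.

(** The extra factor [L.+2%:R] occurs for one pair (a1, a2), hence on [L.+1] triples only, and stays
    within the cube. *)
Lemma sum_corner (c d q : R) L : 0 <= c -> 0 <= d -> 0 <= q ->
  \sum_(0 <= a1 < L.+1) \sum_(0 <= a2 < L.+1) \sum_(0 <= a3 < L.+1)
    ((c + (if (a1 == 0%N) && (a2 == 0%N) then d * L.+2%:R else 0)) * 16 * q) <=
  (c + d) * 16 * L.+2%:R ^+ 3 * q.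
Proof.
move=> c0 d0 q0.
have -> : \sum_(0 <= a1 < L.+1) \sum_(0 <= a2 < L.+1) \sum_(0 <= a3 < L.+1)
    ((c + (if (a1 == 0%N) && (a2 == 0%N) then d * L.+2%:R else 0)) * 16 * q) =
   (c * L.+1%:R ^+ 2 + d * L.+2%:R) * 16 * q * L.+1%:R.
  transitivity ((\sum_(0 <= a1 < L.+1) \sum_(0 <= a2 < L.+1)
     (c + (if (a1 == 0%N) && (a2 == 0%N) then d * L.+2%:R else 0))) * (16 * q * L.+1%:R)).
    rewrite mulr_suml; apply: eq_bigr => a1 _; rewrite mulr_suml; apply: eq_bigr => a2 _.
    by rewrite sumr_const_nat subn0 -[LHS]mulr_natr !mulrA.
  rewrite -!mulrA; congr (_ * _).
  transitivity (\sum_(0 <= a1 < L.+1) (c * L.+1%:R + (if a1 == 0%N then d * L.+2%:R else 0))).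
    apply: eq_bigr => a1 _; rewrite big_split /= sumr_const_nat subn0; congr (_ + _).
      by rewrite mulr_natr.
    case: eqP => _ /=; last by rewrite big1.
    by rewrite big_nat_recl//= big1// addr0.
  rewrite big_split /= sumr_const_nat subn0; congr (_ + _).
    by rewrite -[LHS]mulr_natr -mulrA -expr2.
  by rewrite big_nat_recl//= big1// addr0.
have l1 : 1 <= L.+1%:R :> R by rewrite ler1n.
rewrite -[L.+2%:R]natr1; move: (L.+1%:R) l1 => l l1.
rewrite -subr_ge0 [X in 0 <= X](_ : _ = 16 * q * (c * ((l + 1) ^+ 3 - l ^+ 3) + d * ((l + 1) * ((l + 1) ^+ 2 - l)))).
  have e1 : 0 <= (l + 1) ^+ 3 - l ^+ 3 by rewrite (_ : _ - _ = 3 * l * l + 3 * l + 1); [nra|ring].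
  have e2 : 0 <= (l + 1) ^+ 2 - l by nra.
  by apply: mulr_ge0; [posR|apply: addr_ge0; posR].
by ring.
Qed.

Lemma atmost_sol (T : R) (L : nat) : 0 <= T -> T < 2 ^+ L.+1 ->
  atmost (sol T) ((65 * (12 * 48 ^+ 2) + 65 * 96) * 16 * L.+2%:R ^+ 3 * Num.sqrt T).
Proof.
move=> T0 TL.
have q0 := sqrtr_ge0 T.
apply: (@atmost_sub _ _ _ (sol T) _ (\sum_(0 <= a1 < L.+1) \sum_(0 <= a2 < L.+1)
  \sum_(0 <= a3 < L.+1) (cell_const L a1 a2 * 16 * Num.sqrt T))) => //; last first.
  have bL t : sol T t -> [/\ (lg t.1.1.1 <= L)%N, (lg t.1.1.2 <= L)%N & (lg t.1.2 <= L)%N].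
    by case: t => [[[x1 x2] x3] [[y1 y2] y3]] /(sol_lg_bounds TL)[].
  apply: (atmost_cover_nat (f := fun t => lg t.1.1.1)); first by move=> t /bL[].
  move=> a1 _; apply: (atmost_cover_nat (f := fun t => lg t.1.1.2)); first by move=> t [/bL[]].
  move=> a2 _; apply: (atmost_cover_nat (f := fun t => lg t.1.2)); first by move=> t [[/bL[]]].
  by move=> a3 _; exact: atmost_sol_cell.
have := @sum_corner (65 * (12 * 48 ^+ 2)) (65 * 96) (Num.sqrt T) L; rewrite /cell_const.
have -> : 65 * (96 * L.+2%:R) = 65 * 96 * L.+2%:R :> R by rewrite mulrA.
by apply => //; posR.
Qed.

End Dyadic.

(** * Symmetrization of the height and the upper bound *)

Section Upper.
Variable R : realType.

Lemma N_le (T c : R) : atmost (fun p => half_points T p) c -> (N T)%:R <= c.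
Proof.
move=> H; rewrite /N; apply: H; first exact: finmap.fset_uniq.
by move=> p; rewrite in_fset_set ?in_setE//; exact: finite_half_points.
Qed.

(** Codes [2 i] and [2 i + 1] share the last entry and exchange the other two, so [symsol_sol3] is
    needed only after the codes 0, 2 and 4. *)
Definition perm3 (k : nat) (t : int * int * int) : int * int * int :=
  let: (a, b, c) := t in
  match k with 0 => (a, b, c) | 1 => (b, a, c) | 2 => (a, c, b)
    | 3 => (c, a, b) | 4 => (b, c, a) | _ => (c, b, a) end%N.

Lemma perm3_inj k : injective (perm3 k).
Proof.
by move=> [[a b] c] [[a' b'] c']; case: k => [|[|[|[|[|k]]]]] /= [-> -> ->].
Qed.

(** Bounding the product with each of the three terms makes the condition invariant under
    permutations, so any coefficient can be moved to the last place. *)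
Definition symsol (T : R) (t : (int * int * int) * (int * int * int)) :=
  let: ((x1, x2, x3), (y1, y2, y3)) := t in
  ([/\ x1 != 0, x2 != 0 & x3 != 0] /\ [/\ 0 < y1, 0 < y2 & 0 < y3]) /\
  ([/\ coprimez x1 x2, coprimez x1 x3 & coprimez x2 x3] /\
   [/\ coprimez y1 y2, coprimez y1 y3 & coprimez y2 y3]) /\
  [/\ squarefreez x1, squarefreez x2 & squarefreez x3] /\
  x1 * y1 ^+ 2 + x2 * y2 ^+ 2 + x3 * y3 ^+ 2 = 0 /\
  [/\ (`|x1| * `|x2| * `|x3| * (`|x1| * y1 ^+ 2))%:~R <= T,
      (`|x1| * `|x2| * `|x3| * (`|x2| * y2 ^+ 2))%:~R <= T &
      (`|x1| * `|x2| * `|x3| * (`|x3| * y3 ^+ 2))%:~R <= T].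

Lemma symsol_perm T k x y : k \in [:: 2; 4]%N -> symsol T (x, y) ->
  symsol T (perm3 k x, perm3 k y).
Proof.
case: x y => [[x1 x2] x3] [[y1 y2] y3].
rewrite !inE => hk [[[x10 x20 x30] [y10 y20 y30]] [[[c12 c13 c23] [d12 d13 d23]] [[q1 q2 q3] [e [h1 h2 h3]]]]].
case/orP: hk => /eqP -> /=.
  have -> : `|x1| * `|x3| * `|x2| = `|x1| * `|x2| * `|x3| by ring.
  by rewrite [coprimez x3 x2]coprimez_sym [coprimez y3 y2]coprimez_sym addrAC.
have -> : `|x2| * `|x3| * `|x1| = `|x1| * `|x2| * `|x3| by ring.
rewrite [coprimez x3 x1]coprimez_sym [coprimez y3 y1]coprimez_sym.
rewrite [coprimez x2 x1]coprimez_sym [coprimez y2 y1]coprimez_sym.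
have -> : x2 * y2 ^+ 2 + x3 * y3 ^+ 2 + x1 * y1 ^+ 2 = 0 by rewrite -e; ring.
by [].
Qed.

Lemma symsol_sol3 T x1 x2 x3 y : symsol T ((x1, x2, x3), y) ->
  `|x1| <= `|x3| -> `|x2| <= `|x3| ->
  sol T (perm3 0 (x1, x2, x3), perm3 0 y) \/ sol T (perm3 1 (x1, x2, x3), perm3 1 y).
Proof.
case: y => [[y1 y2] y3] [[[x10 x20 x30] [y10 y20 y30]] [[[c12 c13 c23] [d12 d13 d23]] [[q1 q2 q3] [e [h1 h2 h3]]]]] l1 l2.
have [m|/ltW m] := leP (`|x1| * y1 ^+ 2) (`|x2| * y2 ^+ 2); [right|left] => //=.
rewrite [coprimez x2 x1]coprimez_sym [coprimez y2 y1]coprimez_sym.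
by rewrite (addrC (x2 * _)) (mulrC `|x2| `|x1|).
Qed.

Lemma symsol_sol T x y : symsol T (x, y) ->
  exists2 k, k \in iota 0 6 & sol T (perm3 k x, perm3 k y).
Proof.
case: x y => [[x1 x2] x3] [[y1 y2] y3] S.
have S2 := symsol_perm (isT : 2%N \in [:: 2; 4]%N) S.
have S4 := symsol_perm (isT : 4%N \in [:: 2; 4]%N) S.
have [l13|l31] := leP `|x1| `|x3|.
  have [l23|l32] := leP `|x2| `|x3|.
    by have [] := symsol_sol3 S l13 l23; [exists 0%N|exists 1%N].
  by have [] := symsol_sol3 S2 (ltW (le_lt_trans l13 l32)) (ltW l32); [exists 2%N|exists 3%N].
have [l12|l21] := leP `|x1| `|x2|.
  by have [] := symsol_sol3 S2 l12 (ltW (lt_le_trans l31 l12)); [exists 2%N|exists 3%N].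
by have [] := symsol_sol3 S4 (ltW l21) (ltW l31); [exists 4%N|exists 5%N].
Qed.

(** The third term is at most twice the first, which dominates the second; hence the bound
    [2 * T]. *)
Lemma half_points_symsol (T : R) x1 x2 x3 y1 y2 y3 :
  half_points T ((x1, x2, x3), (y1, y2, y3)) ->
  symsol (2 * T) ((x1, x2, - x3), (`|y1|, `|y2|, `|y3|)).
Proof.
move=> [[[x10 x20 x30] [y10 y20 y30]] [[[c12 c13 c23] [d12 d13 d23]] [[q1 q2 q3] [e [x1p [h hT]]]]]].
have nn (y : int) : `|y| ^+ 2 = y ^+ 2 by rewrite real_normK ?num_real.
have T0 : 0 <= T by apply: le_trans hT; rewrite ler0z.
have sqn (z : int) : squarefreez z -> squarefreez (- z).
  by move=> q d; rewrite dvdzE abszN -dvdzE; exact: q.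
have qq (z : int) : z ^+ 2 = `|z ^+ 2| by rewrite ger0_norm// exprn_even_ge0.
have hh : 0 <= `|x1| * `|x2| * `|x3| by rewrite !mulr_ge0.
have hT1 : (`|x1| * `|x2| * `|x3| * (`|x1| * y1 ^+ 2))%:~R <= T.
  apply: le_trans hT; rewrite ler_int le_eqVlt; apply/orP; left; apply/eqP.
  by rewrite !normrM (qq y1) !normrM; ring.
have h2 : `|x2| * y2 ^+ 2 <= `|x1| * y1 ^+ 2.
  by rewrite [y2 ^+ 2]qq -normrM (gtr0_norm x1p).
have h3 : `|x3| * y3 ^+ 2 <= 2 * (`|x1| * y1 ^+ 2).
  rewrite [y3 ^+ 2]qq -normrM -e; apply: (le_trans (ler_normD _ _)).
  by rewrite (normrM x1) (normrM x2) -!qq; move: h2; clear; lia.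
have K (m : int) : m <= 2 * (`|x1| * y1 ^+ 2) -> (`|x1| * `|x2| * `|x3| * m)%:~R <= 2 * T.
  move=> hm; apply: (@le_trans _ _ (2 * (`|x1| * `|x2| * `|x3| * (`|x1| * y1 ^+ 2)))%:~R).
    by rewrite ler_int [leRHS]mulrCA ler_wpM2l.
  by rewrite intrM ler_pM2l.
split; first by split; rewrite ?oppr_eq0 ?normr_gt0.
split.
  split; first by rewrite !coprimezN.
  by rewrite -!abszE !coprimezE !absz_nat -!coprimezE.
split; first by split => //; exact: sqn.
split; first by rewrite !nn e mulNr subrr.
have m0 : 0 <= `|x1| * y1 ^+ 2 by rewrite mulr_ge0// exprn_even_ge0.
by rewrite !normrN !nn; split; apply: K => //; [move: m0|move: h2 m0]; clear; lia.
Qed.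

(** 48 is 6 times 8: the orders of the indices, and the sign patterns of y lost in passing to
    absolute values. *)
Lemma atmost_half_points (T c : R) : atmost (sol (2 * T)) c ->
  atmost (fun p => half_points T p) (48 * c).
Proof.
move=> H; have c0 := atmost_ge0 H.
pose base (p : (int * int * int) * (int * int * int)) : (int * int * int) * (int * int * int) :=
  ((p.1.1.1, p.1.1.2, - p.1.2), (`|p.2.1.1|, `|p.2.1.2|, `|p.2.2|)).
pose sg (p : (int * int * int) * (int * int * int)) :=
  (p.2.1.1 < 0, p.2.1.2 < 0, p.2.2 < 0).
pose bs : seq bool := [:: true; false].
have mem_bs b : b \in bs by case: b.
pose I := [seq (k, s) | k <- iota 0 6,
   s <- [seq (a, b) | a <- [seq (a, b) | a <- bs, b <- bs], b <- bs]].
pose E (i : nat * (bool * bool * bool)) p :=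
  sol (2 * T) (perm3 i.1 (base p).1, perm3 i.1 (base p).2) /\ sg p = i.2.
have -> : 48 * c = \sum_(i <- I) c.
  by rewrite /I big_const_seq iter_addr addr0 count_predT mulr_natl.
apply: (atmost_cover (E := E)).
  move=> [[[x1 x2] x3] [[y1 y2] y3]] /half_points_symsol/symsol_sol[k k6 S].
  exists (k, sg ((x1, x2, x3), (y1, y2, y3))) => //.
  apply/allpairsP; exists (k, sg ((x1, x2, x3), (y1, y2, y3))); split => //=.
  by case: (sg _) => [[[] []] []].
move=> [k sgn] _.
apply: (atmost_inj (f := fun p => (perm3 k (base p).1, perm3 k (base p).2))) H.
  by move=> p [_ []].
move=> [[[x1 x2] x3] [[y1 y2] y3]] [[[a1 a2] a3] [[b1 b2] b3]].
move=> [_ [_ s1]] [_ [_ s2]] e.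
have := congr1 snd e; have := congr1 fst e.
move=> /(@perm3_inj k _ _) [-> -> /oppr_inj ->] /(@perm3_inj k _ _) [e1 e2 e3].
move: s1; rewrite -s2 => -[f1 f2 f3].
have K (u v : int) : (`|u| = `|v|)%N -> (u < 0) = (v < 0) -> u = v by clear; lia.
by rewrite (K _ _ e1 f1) (K _ _ e2 f2) (K _ _ e3 f3).
Qed.

Lemma N_upper : exists c2 : R, 0 < c2 /\
  forall T : R, 2 < T -> (N T)%:R < c2 * T `^ (1 / 2) * (ln T) ^+ 3.
Proof.
have [C [C0 HC]] : exists C : R, 0 < C /\ forall (T : R) (L : nat), 0 <= T ->
    T < 2 ^+ L.+1 -> atmost (sol T) (C * L.+2%:R ^+ 3 * Num.sqrt T).
  by eexists; split; last exact: atmost_sol; posR.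
have l20 : 0 < ln 2 :> R by rewrite ln_gt0// ltr1n.
(* [Num.sqrt 2] comes from the height [2 * T], [4 / ln 2] from comparing [L.+2] with [ln T]; the
   leading 2 makes the inequality strict. *)
exists (2 * (48 * C * (4 / ln 2) ^+ 3 * Num.sqrt 2)); split.
  have : 0 < Num.sqrt 2 :> R by rewrite sqrtr_gt0.
  by move=> ?; posR.
move=> T T2.
have lT : ln 2 < ln T by rewrite ltr_ln ?posrE//; lra.
have lT0 : 0 < ln T by lra.
have T0 : 0 < T by lra.
rewrite div1r powR12_sqrt; last by lra.
have e2T : ln (2 * T) = ln 2 + ln T by rewrite lnM ?posrE.
have l2T : 0 <= ln (2 * T) / ln 2 by apply: divr_ge0; [rewrite e2T; lra|exact: ltW].
have [L [LT hL]] : exists L, 2 * T < 2 ^+ L.+1 /\ L%:R <= ln (2 * T) / ln 2.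
  exists (Num.truncn (ln (2 * T) / ln 2)); rewrite truncn_le l2T; split => //.
  rewrite -ltr_ln ?posrE ?exprn_gt0 ?mulr_gt0//.
  rewrite lnXn// -[X in _ < X]mulr_natl -ltr_pdivrMr//; exact: truncnS_gt.
(* (L + 2) ln 2 is at most 3 ln 2 + ln T, which is below 4 ln T because [T > 2]. *)
have L2 : L.+2%:R <= 4 / ln 2 * ln T.
  rewrite -[L.+2%:R]natr1 -[L.+1%:R]natr1.
  have -> : 4 / ln 2 * ln T = (4 * ln T) / ln 2 by rewrite mulrAC.
  rewrite ler_pdivlMr//.
  have : L%:R * ln 2 <= ln (2 * T) by rewrite -ler_pdivlMr.
  lra.
have H := N_le (atmost_half_points (HC (2 * T) L (ltW (mulr_gt0 (ltr0n _ 2) T0)) LT)).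
apply: (le_lt_trans H).
rewrite sqrtrM//.
have sT : 0 < Num.sqrt T by rewrite sqrtr_gt0.
have s2 : 0 < Num.sqrt 2 :> R by rewrite sqrtr_gt0.
have L3 : L.+2%:R ^+ 3 <= (4 / ln 2 * ln T) ^+ 3.
  by rewrite lerXn2r// ?nnegrE; posR.
apply: (@le_lt_trans _ _ (48 * (C * (4 / ln 2 * ln T) ^+ 3 * (Num.sqrt 2 * Num.sqrt T)))).
  rewrite ler_pM2l// ler_pM2r ?mulr_gt0// ler_pM2l//.
rewrite -subr_gt0 [X in 0 < X](_ : _ = 48 * C * (4 / ln 2) ^+ 3 * Num.sqrt 2 * Num.sqrt T * ln T ^+ 3).
  by posR.
by ring.
Qed.

End Upper.

(** * Candidates for the lower bound *)

Lemma exists_modulus (K : nat) : exists Q : nat, [/\ (0 < Q)%N, (4 %| Q)%N &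
  forall p, prime p -> ~~ (p %| Q)%N -> (K < p)%N].
Proof.
exists ((maxn K 4)`!); split; first exact: fact_gt0.
  by apply: dvdn_fact; rewrite leq_max orbT.
move=> p pp; rewrite ltnNge; apply: contraNN => pK.
by apply: dvdn_fact; rewrite prime_gt0// leq_max pK.
Qed.

Lemma eqmod_mul (m n a b : nat) : coprime m n -> a = b %[mod m] -> a = b %[mod n] ->
  a = b %[mod m * n].
Proof.
move=> c e1 e2; apply/eqP; rewrite chinese_remainder//.
by apply/andP; split; apply/eqP.
Qed.

Lemma dvd_eqmod (m a b : nat) : (m %| a)%N -> (m %| b)%N -> a = b %[mod m].
Proof. by rewrite /dvdn => /eqP -> /eqP ->. Qed.

Lemma eqmod_lin (q A B a b : nat) : coprime q B -> (q %| A + a * B)%N -> (q %| A + b * B)%N ->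
  a = b %[mod q].
Proof.
move=> c; wlog le : a b / (a <= b)%N.
  move=> H h1 h2; have [ab|ba] := leqP a b; first exact: H.
  by symmetry; apply: H => //; exact: ltnW.
move=> h1 h2; apply/esym/eqP; rewrite eqn_mod_dvd// -(Gauss_dvdl _ c).
have -> : ((b - a) * B = (A + b * B) - (A + a * B))%N by rewrite mulnBl subnDl.
exact: dvdn_sub.
Qed.

Lemma solve_congruences (Q q A B : nat) : (0 < Q)%N -> (0 < q)%N -> coprime Q q ->
  coprime q B -> exists2 c, (c < Q * q)%N & c = 1 %[mod Q] /\ (q %| A + c * B)%N.
Proof.
move=> Q0 q0 cQ cB.
have [a _ ha] := Bezoutl B q0; rewrite (eqP cB) in ha.
pose c := chinese Q q 1 (A * a).
exists (c %% (Q * q))%N; first by rewrite ltn_mod muln_gt0 Q0.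
split.
  by rewrite modn_dvdm ?dvdn_mulr// chinese_modl.
rewrite /dvdn -modnDmr -modnMml modn_dvdm ?dvdn_mull// chinese_modr// modnMml modnDmr.
have -> : (A + A * a * B = A * (1 + a * B))%N by rewrite mulnDr muln1 mulnA.
by apply: dvdn_mull.
Qed.

Section Count.
Variable R : realType.

Lemma atmost_congr (P : nat -> Prop) (m lo len : nat) : (0 < m)%N ->
  (forall x, P x -> (lo <= x <= lo + len)%N) ->
  (forall x x', P x -> P x' -> x = x' %[mod m]) ->
  atmost P (1 + len%:R / m%:R : R).
Proof.
move=> m0 b c.
have -> : len%:R = (lo + len)%:R - lo%:R :> R by rewrite natrD addrC addKr.
apply: (@atmost_gap' _ _ _ (fun x => x%:R)).
- by rewrite ltr0n.
- by rewrite ler_nat leq_addr.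
- by move=> x /b; rewrite !ler_nat.
move=> x x' Px Px' /eqP ne; wlog lt : x x' Px Px' ne / (x < x')%N.
  move=> H; have [lt|gt|e] := ltngtP x x'; first exact: H.
    by rewrite distrC; apply: H => //; rewrite eq_sym.
  by rewrite e eqxx in ne.
rewrite distrC ger0_norm ?subr_ge0 ?ler_nat ?(ltnW lt)// -natrB ?(ltnW lt)// ler_nat.
apply: dvdn_leq; first by rewrite subn_gt0.
by rewrite -eqn_mod_dvd ?(ltnW lt)//; apply/eqP; exact: c.
Qed.

(** The residue class of the second coordinate may depend on the first, as it does for the
    congruence modulo [y3 ^ 2]. *)
Lemma atmost_congr2 (P : nat * nat -> Prop) (m1 lo1 len1 m2 lo2 len2 : nat) :
  (0 < m1)%N -> (0 < m2)%N ->
  (forall z, P z -> (lo1 <= z.1 <= lo1 + len1)%N /\ (lo2 <= z.2 <= lo2 + len2)%N) ->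
  (forall z z', P z -> P z' -> z.1 = z'.1 %[mod m1]) ->
  (forall z z', P z -> P z' -> z.1 = z'.1 -> z.2 = z'.2 %[mod m2]) ->
  atmost P ((1 + len1%:R / m1%:R) * (1 + len2%:R / m2%:R) : R).
Proof.
move=> m10 m20 b c1 c2.
apply: (atmost_fiber (f := fst) (Q := fun x => exists2 z, P z & z.1 = x)).
- by posR.
- by move=> z Pz; exists z.
- apply: (@atmost_congr _ m1 lo1) => //; first by move=> x [z /b[+ _] <-].
  by move=> x x' [z Pz <-] [z' Pz' <-]; exact: c1.
move=> x _.
apply: (atmost_inj (Q := fun w => exists2 z, P z & z = (x, w)) (f := snd)).
- by move=> [a w] [Pz /= e]; exists (a, w) => //=; rewrite e.
- by move=> [a w] [a' w'] [_ /= ->] [_ /= ->] /= ->.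
apply: (@atmost_congr _ m2 lo2) => //.
  by move=> w [z /b[_ +] e]; rewrite e.
by move=> w w' [z Pz e] [z' Pz' e']; have := c2 _ _ Pz Pz'; rewrite e e' => /(_ erefl).
Qed.

Lemma atmost_swap (P : nat * nat -> Prop) (c : R) :
  atmost (fun z => P (z.2, z.1)) c -> atmost P c.
Proof.
apply: (atmost_inj (f := fun z => (z.2, z.1))); first by case.
by move=> [a b] [a' b'] _ _ [-> ->].
Qed.

End Count.

(** [st_le] makes the second term at most the first for every candidate; [st_ge] keeps their sum of
    order [Q n2 (y2 y3)^2], needed to absorb the error for large squares dividing [x3]. *)
Record setting (Q K y1 y2 y3 n1 n2 : nat) : Prop := Setting {
  st_Q0 : (0 < Q)%N; st_Q4 : (4 %| Q)%N;
  st_K : forall p, prime p -> ~~ (p %| Q)%N -> (K < p)%N;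
  st_y1 : y1 = 1 %[mod Q]; st_y2 : y2 = 1 %[mod Q]; st_y3 : y3 = 1 %[mod Q];
  st_c12 : coprime y1 y2; st_c13 : coprime y1 y3; st_c23 : coprime y2 y3;
  st_n1 : (0 < n1)%N; st_n2 : (0 < n2)%N;
  st_le : (n2 * (y2 * y3) ^ 2 <= n1 * y1 ^ 2)%N;
  st_ge : (n1 * y1 ^ 2 <= 2 * (n2 * (y2 * y3) ^ 2))%N }.

Lemma coprime_mod1 Q y : y = 1 %[mod Q] -> coprime y Q.
Proof. by move=> h; rewrite coprime_sym /coprime -gcdn_modr h gcdn_modr gcdn1. Qed.

Lemma prime_ndvd_mod1 Q x p : prime p -> x = 1 %[mod Q] -> (p %| x)%N -> ~~ (p %| Q)%N.
Proof.
move=> pp /coprime_mod1 c px; apply/negP => pQ.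
have := dvdn_gcd p x Q; rewrite px pQ (eqP c) dvdn1 => /eqP p1.
by rewrite p1 in pp.
Qed.

Definition cand (Q y1 y2 y3 n1 n2 : nat) (x : nat * nat) : Prop :=
  [/\ (Q * n1 < x.1 <= 2 * (Q * n1))%N, x.1 = 1 %[mod Q],
      (0 < x.2 <= Q * (y3 ^ 2 * n2))%N, x.2 = 1 %[mod Q] &
      (y3 ^ 2 %| x.1 * y1 ^ 2 + x.2 * y2 ^ 2)%N].

(** Each of the [n1] admissible first coordinates leaves one class modulo [Q * y3 ^ 2] for the
    second, and the range of the latter consists of [n2] full periods. *)
Lemma cand_seq Q K y1 y2 y3 n1 n2 : setting Q K y1 y2 y3 n1 n2 ->
  exists s, [/\ uniq s, {in s, forall x, cand Q y1 y2 y3 n1 n2 x} & size s = (n1 * n2)%N].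
Proof.
move=> [Q0 Q4 hK e1 e2 e3 c12 c13 c23 n10 n20 le ge].
have Q1 : (1 < Q)%N by apply: leq_trans (dvdn_leq Q0 Q4).
have y30 : (0 < y3)%N.
  by rewrite lt0n; apply/eqP => y0; move: e3; rewrite y0 mod0n modn_small.
have q0 : (0 < y3 ^ 2)%N by rewrite expn_gt0 y30.
have Qq0 : (0 < Q * y3 ^ 2)%N by rewrite (muln_gt0 Q) Q0.
have cQq : coprime Q (y3 ^ 2) by rewrite coprimeXr// coprime_sym coprime_mod1.
have cqy : coprime (y3 ^ 2) (y2 ^ 2) by rewrite coprimeXl// coprimeXr// coprime_sym.
have /choice[c Hc] : forall x, exists c, [/\ (c < Q * y3 ^ 2)%N, c = 1 %[mod Q] &
    (y3 ^ 2 %| x * y1 ^ 2 + c * y2 ^ 2)%N].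
  by move=> x; have [c h1 [h2 h3]] := @solve_congruences Q (y3 ^ 2) (x * y1 ^ 2) (y2 ^ 2) Q0 q0 cQq cqy; exists c.
pose X i := (Q * (n1 + i) + 1)%N.
exists [seq (X i, c (X i) + Q * y3 ^ 2 * j)%N | i <- iota 0 n1, j <- iota 0 n2]; split.
- apply: allpairs_uniq; rewrite ?iota_uniq// => -[i j] [i' j'] _ _ /= [/eqP].
  rewrite /X eqn_add2r eqn_pmul2l// eqn_add2l => /eqP -> /eqP.
  by rewrite eqn_add2l eqn_pmul2l// => /eqP ->.
- move=> _ /allpairsP[[i j] [/= + + ->]]; rewrite !mem_iota /= !add0n => hi hj.
  have [h1 h2 h3] := Hc (X i).
  have x2 : (c (X i) + Q * y3 ^ 2 * j = 1 %[mod Q])%N.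
    by rewrite -mulnA mulnC -modnDmr modnMl addn0.
  split=> //=.
  + rewrite /X; apply/andP; split; first by rewrite mulnDr addn1 ltnS leq_addr.
    have -> : (2 * (Q * n1) = Q * (n1 + n1))%N by rewrite mulnDr mul2n addnn.
    apply: (@leq_trans (Q * (n1 + i.+1))); last by rewrite leq_mul2l leq_add2l hi orbT.
    by rewrite (addnS n1) mulnS addnC leq_add2r.
  + by rewrite /X mulnC -modnDml modnMl.
  + apply/andP; split.
      by rewrite lt0n; apply/eqP => y0; move: x2; rewrite y0 mod0n modn_small.
    apply: (@leq_trans (Q * y3 ^ 2 * j.+1)); last by rewrite mulnA leq_mul2l hj orbT.
    by rewrite mulnS leq_add2r ltnW.
  have -> : (X i * y1 ^ 2 + (c (X i) + Q * y3 ^ 2 * j) * y2 ^ 2 =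
     (X i * y1 ^ 2 + c (X i) * y2 ^ 2) + (Q * j * y2 ^ 2) * y3 ^ 2)%N by ring.
  by rewrite dvdn_add// dvdn_mull.
by rewrite size_allpairs !size_iota.
Qed.

Section Events.
Variable R : realType.
Variables (Q K y1 y2 y3 n1 n2 : nat).
Hypothesis st : setting Q K y1 y2 y3 n1 n2.
Let C := cand Q y1 y2 y3 n1 n2.

Let Q0 : (0 < Q)%N. Proof. by case: st. Qed.
Let Q1 : (1 < Q)%N. Proof. by apply: leq_trans (dvdn_leq Q0 (st_Q4 st)). Qed.

Let ygt0 y : y = 1 %[mod Q] -> (0 < y)%N.
Proof. by rewrite lt0n => h; apply/eqP => y0; move: h; rewrite y0 mod0n modn_small. Qed.

Let y10 : (0 < y1)%N. Proof. by apply: ygt0; case: st. Qed.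
Let y20 : (0 < y2)%N. Proof. by apply: ygt0; case: st. Qed.
Let y30 : (0 < y3)%N. Proof. by apply: ygt0; case: st. Qed.
Let q0 : (0 < y3 ^ 2)%N. Proof. by rewrite expn_gt0 y30. Qed.
Let cQq : coprime Q (y3 ^ 2).
Proof. by rewrite coprimeXr// coprime_sym coprime_mod1//; case: st. Qed.
Let cqy2 : coprime (y3 ^ 2) (y2 ^ 2).
Proof. by rewrite coprimeXl// coprimeXr// coprime_sym; case: st. Qed.
Let cqy1 : coprime (y3 ^ 2) (y1 ^ 2).
Proof. by rewrite coprimeXl// coprimeXr// coprime_sym; case: st. Qed.

Let range1 z : C z -> (Q * n1 <= z.1 <= Q * n1 + Q * n1)%N.
Proof. by case=> /andP[h1 h2] _ _ _ _; rewrite (ltnW h1) addnn -mul2n. Qed.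

Let range2 z : C z -> (0 <= z.2 <= 0 + Q * (y3 ^ 2 * n2))%N.
Proof. by case=> _ _ /andP[_ h2] _ _; rewrite add0n. Qed.

Let modQ1 z z' : C z -> C z' -> z.1 = z'.1 %[mod Q].
Proof. by case=> _ e _ _ _ [_ e' _ _ _]; rewrite e e'. Qed.

Let modQ2 z z' : C z -> C z' -> z.2 = z'.2 %[mod Q].
Proof. by case=> _ _ _ e _ [_ _ _ e' _]; rewrite e e'. Qed.

Let modq2 z z' : C z -> C z' -> z.1 = z'.1 -> z.2 = z'.2 %[mod y3 ^ 2].
Proof.
move=> [_ _ _ _ d] [_ _ _ _ d'] e; rewrite e in d.
exact: (eqmod_lin cqy2 d d').
Qed.

Let modq1 z z' : C z -> C z' -> z.2 = z'.2 -> z.1 = z'.1 %[mod y3 ^ 2].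
Proof.
move=> [_ _ _ _ d] [_ _ _ _ d'] e; rewrite e in d.
by apply: (eqmod_lin cqy1 (A := z'.2 * y2 ^ 2)); rewrite addnC.
Qed.

Lemma atmost_dvd1 d : (0 < d)%N -> coprime Q d ->
  atmost (fun z => C z /\ (d %| z.1)%N) ((1 + n1%:R / d%:R) * (1 + n2%:R) : R).
Proof.
move=> d0 cd.
have H := @atmost_congr2 R (fun z => C z /\ (d %| z.1)%N) (Q * d) (Q * n1) (Q * n1)
  (Q * y3 ^ 2) 0 (Q * (y3 ^ 2 * n2)).
apply: (atmost_sub _ _ (H _ _ _ _ _)) => //.
- rewrite !natrM le_eqVlt; apply/orP; left; apply/eqP; field.
  by rewrite !pnatr_eq0 -!lt0n y30 Q0 d0.
- by rewrite muln_gt0 Q0.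
- by rewrite (muln_gt0 Q) Q0.
- by move=> z [Cz _]; split; [exact: range1|exact: range2].
- move=> z z' [Cz dz] [Cz' dz']; apply: eqmod_mul => //; first exact: modQ1.
  exact: dvd_eqmod.
- move=> z z' [Cz _] [Cz' _] e; apply: eqmod_mul => //; first exact: modQ2.
  exact: modq2.
Qed.

(** The second coordinate is fixed first: [d] may share factors with [y3], and its congruence could
    then not be combined with the one modulo [y3 ^ 2]. *)
Lemma atmost_dvd2 d : (0 < d)%N -> coprime Q d ->
  atmost (fun z => C z /\ (d %| z.2)%N)
    ((1 + (y3 ^ 2 * n2)%:R / d%:R) * (1 + n1%:R / (y3 ^ 2)%:R) : R).
Proof.
move=> d0 cd; apply: atmost_swap.
have H := @atmost_congr2 R (fun z => C (z.2, z.1) /\ (d %| z.1)%N) (Q * d) 0 (Q * (y3 ^ 2 * n2))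
  (Q * y3 ^ 2) (Q * n1) (Q * n1).
apply: (atmost_sub _ _ (H _ _ _ _ _)) => //.
- rewrite !natrM le_eqVlt; apply/orP; left; apply/eqP; field.
  by rewrite !pnatr_eq0 -!lt0n y30 Q0 d0.
- by rewrite muln_gt0 Q0.
- by rewrite (muln_gt0 Q) Q0.
- by move=> z [Cz _]; split; [exact: (range2 Cz)|exact: (range1 Cz)].
- move=> z z' [Cz dz] [Cz' dz']; apply: eqmod_mul => //; first exact: (modQ2 Cz Cz').
  exact: dvd_eqmod.
- move=> z z' [Cz _] [Cz' _] e; apply: eqmod_mul => //; first exact: (modQ1 Cz Cz').
  exact: (modq1 Cz Cz' e).
Qed.

Lemma atmost_dvd12 p : (0 < p)%N -> coprime Q p -> coprime p y3 ->
  atmost (fun z => [/\ C z, (p %| z.1)%N & (p %| z.2)%N])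
    ((1 + n1%:R / p%:R) * (1 + n2%:R / p%:R) : R).
Proof.
move=> p0 cp cpy.
have H := @atmost_congr2 R (fun z => [/\ C z, (p %| z.1)%N & (p %| z.2)%N]) (Q * p) (Q * n1) (Q * n1)
  (Q * (p * y3 ^ 2)) 0 (Q * (y3 ^ 2 * n2)).
apply: (atmost_sub _ _ (H _ _ _ _ _)) => //.
- rewrite !natrM le_eqVlt; apply/orP; left; apply/eqP; field.
  by rewrite !pnatr_eq0 -!lt0n y30 Q0 p0.
- by rewrite muln_gt0 Q0.
- by rewrite (muln_gt0 Q) (muln_gt0 p) Q0 p0.
- by move=> z [Cz _ _]; split; [exact: range1|exact: range2].
- move=> z z' [Cz dz _] [Cz' dz' _]; apply: eqmod_mul => //; first exact: modQ1.
  exact: dvd_eqmod.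
- move=> z z' [Cz _ d] [Cz' _ d'] e; apply: eqmod_mul => //.
  + by rewrite coprimeMr cp.
  + exact: modQ2.
  apply: eqmod_mul; first by rewrite coprimeXr.
    exact: dvd_eqmod.
  exact: modq2.
Qed.

Lemma atmost_dvd3 d : (0 < d)%N -> coprime Q d -> coprime d y2 ->
  atmost (fun z => C z /\ (d * y3 ^ 2 %| z.1 * y1 ^ 2 + z.2 * y2 ^ 2)%N)
    ((1 + n1%:R) * (1 + n2%:R / d%:R) : R).
Proof.
move=> d0 cd cdy.
have H := @atmost_congr2 R (fun z => C z /\ (d * y3 ^ 2 %| z.1 * y1 ^ 2 + z.2 * y2 ^ 2)%N) Q (Q * n1) (Q * n1)
  (Q * (d * y3 ^ 2)) 0 (Q * (y3 ^ 2 * n2)).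
apply: (atmost_sub _ _ (H _ _ _ _ _)) => //.
- rewrite !natrM le_eqVlt; apply/orP; left; apply/eqP; field.
  by rewrite !pnatr_eq0 -!lt0n y30 Q0 d0.
- by rewrite (muln_gt0 Q) (muln_gt0 d) Q0 d0.
- by move=> z [Cz _]; split; [exact: range1|exact: range2].
- by move=> z z' [Cz _] [Cz' _]; exact: modQ1.
- move=> z z' [Cz h] [Cz' h'] e; apply: eqmod_mul => //.
  + by rewrite coprimeMr cd.
  + exact: modQ2.
  rewrite e in h; apply: eqmod_lin h h'.
  by rewrite coprimeMl cqy2 andbT coprimeXr.
Qed.

End Events.

Definition third (y1 y2 y3 : nat) (z : nat * nat) : nat :=
  ((z.1 * y1 ^ 2 + z.2 * y2 ^ 2) %/ y3 ^ 2)%N.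

Definition good (Q y1 y2 y3 n1 n2 : nat) (z : nat * nat) : Prop :=
  [/\ cand Q y1 y2 y3 n1 n2 z, coprime z.1 z.2, coprime z.1 (third y1 y2 y3 z),
      coprime z.2 (third y1 y2 y3 z) &
      forall p, prime p -> [/\ ~~ (p ^ 2 %| z.1)%N, ~~ (p ^ 2 %| z.2)%N
        & ~~ (p ^ 2 %| third y1 y2 y3 z)%N]].

Lemma common_prime (a b : nat) : (0 < a)%N -> ~~ coprime a b ->
  exists p, [/\ prime p, (p %| a)%N & (p %| b)%N].
Proof.
move=> a0 nc; have g0 : (0 < gcdn a b)%N by rewrite gcdn_gt0 a0.
have g1 : (1 < gcdn a b)%N by rewrite ltn_neqAle eq_sym nc.
exists (pdiv (gcdn a b)); split; first exact: pdiv_prime.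
  exact: dvdn_trans (pdiv_dvd _) (dvdn_gcdl _ _).
exact: dvdn_trans (pdiv_dvd _) (dvdn_gcdr _ _).
Qed.

(** All squares are 1 modulo [Q], so the quotient is 1 + 1. As 2 is nonzero modulo 4 and modulo
    every odd prime, no prime of [Q] has its square dividing [x3]. *)
Lemma third_mod Q K y1 y2 y3 n1 n2 z : setting Q K y1 y2 y3 n1 n2 ->
  cand Q y1 y2 y3 n1 n2 z -> third y1 y2 y3 z = 2 %[mod Q].
Proof.
move=> st [_ e1 _ e2 d].
have sq y : y = 1 %[mod Q] -> y ^ 2 = 1 %[mod Q].
  by move=> e; rewrite -modnXm e modnXm exp1n.
have <- : (third y1 y2 y3 z * y3 ^ 2 = third y1 y2 y3 z %[mod Q])%N.
  by rewrite -modnMmr (sq _ (st_y3 st)) modnMmr muln1.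
rewrite /third divnK// -modnDm -[(z.1 * _ %% Q)%N]modnMm -[(z.2 * _ %% Q)%N]modnMm.
by rewrite e1 e2 (sq _ (st_y1 st)) (sq _ (st_y2 st)) !modnMm !muln1 modnDm.
Qed.

(** A prime common to one coordinate and the quotient divides the other coordinate, [y1] or [y2].
    The alternatives in which [p] divides some [yi] are kept apart: they have density about [1 / p]
    instead of [1 / p^2], but concern few primes. *)
Lemma bad_prime Q K y1 y2 y3 n1 n2 z : setting Q K y1 y2 y3 n1 n2 ->
  cand Q y1 y2 y3 n1 n2 z -> ~ good Q y1 y2 y3 n1 n2 z ->
  exists p, [/\ prime p, (K < p)%N, ~~ (p %| Q)%N &
    ([/\ p %| z.1, p %| z.2 & ~~ (p %| y3)]%N \/ (p ^ 2 %| z.1)%N \/ (p ^ 2 %| z.2)%N \/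
     ((p ^ 2 * y3 ^ 2 %| z.1 * y1 ^ 2 + z.2 * y2 ^ 2)%N /\ ~~ (p %| y2)%N)) \/
    (((p %| z.1) /\ (p %| y2))%N \/ ((p %| z.1) /\ (p %| y3))%N \/ ((p %| z.2) /\ (p %| y1))%N)].
Proof.
move=> st Cz ng; apply: contrapT => nex; apply: ng.
have e3 := third_mod st Cz; case: (Cz) => /andP[x10 _] m1 /andP[x20 _] m2 d.
have Q0 := st_Q0 st.
have eq : (third y1 y2 y3 z * y3 ^ 2 = z.1 * y1 ^ 2 + z.2 * y2 ^ 2)%N by rewrite /third divnK.
have x1p : (0 < z.1)%N by exact: leq_ltn_trans x10.
have nd1 p : prime p -> (p %| z.1)%N -> ~~ (p %| Q)%N by move=> pp; exact: prime_ndvd_mod1.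
have nd2 p : prime p -> (p %| z.2)%N -> ~~ (p %| Q)%N by move=> pp; exact: prime_ndvd_mod1.
have b12 p : prime p -> ~ ((p %| z.1)%N /\ (p %| z.2)%N).
  move=> pp [p1 p2]; apply: nex; exists p; split=> //.
  - exact: st_K st _ pp (nd1 _ pp p1).
  - exact: nd1.
  by case: (boolP (p %| y3)%N) => h; [right; right; left|left; left].
have b1y p : prime p -> ~ ((p %| z.1)%N /\ (p %| y2)%N).
  move=> pp [p1 p2]; apply: nex; exists p; split=> //.
  - exact: st_K st _ pp (nd1 _ pp p1).
  - exact: nd1.
  by right; left.
have b2y p : prime p -> ~ ((p %| z.2)%N /\ (p %| y1)%N).
  move=> pp [p1 p2]; apply: nex; exists p; split=> //.
  - exact: st_K st _ pp (nd2 _ pp p1).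
  - exact: nd2.
  by right; right; right.
have d3 p : (p %| third y1 y2 y3 z)%N -> (p %| z.1 * y1 ^ 2 + z.2 * y2 ^ 2)%N.
  by move=> h; rewrite -eq dvdn_mulr.
split => //.
- apply: contrapT => /negP/(common_prime x1p)[p [pp p1 p2]]; exact: (b12 p).
- apply: contrapT => /negP/(common_prime x1p)[p [pp p1 /d3 p3]].
  move: p3; rewrite (dvdn_addr _ (dvdn_mulr _ p1)) Euclid_dvdM// Euclid_dvdX// andbT.
  by case/orP => h; [apply: (b12 p)|apply: (b1y p)].
- apply: contrapT => /negP/(common_prime x20)[p [pp p1 /d3 p3]].
  move: p3; rewrite (dvdn_addl _ (dvdn_mulr _ p1)) Euclid_dvdM// Euclid_dvdX// andbT.
  by case/orP => h; [apply: (b12 p)|apply: (b2y p)].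
move=> p pp.
have pp2 : (p %| p ^ 2)%N by rewrite dvdn_exp.
split; apply/negP => h.
- have p1 := dvdn_trans pp2 h; apply: nex; exists p; split=> //.
  + exact: st_K st _ pp (nd1 _ pp p1).
  + exact: nd1.
  by left; right; left.
- have p1 := dvdn_trans pp2 h; apply: nex; exists p; split=> //.
  + exact: st_K st _ pp (nd2 _ pp p1).
  + exact: nd2.
  by left; right; right; left.
have nQ : ~~ (p %| Q)%N.
  apply/negP => pQ; have p3 := dvdn_trans pp2 h.
  have : (third y1 y2 y3 z = 2 %[mod p])%N by rewrite -(modn_dvdm _ pQ) e3 modn_dvdm.
  rewrite (eqP p3) => /esym/eqP; rewrite -/(dvdn p 2) dvdn_prime2// => /eqP p2.
  move: h; rewrite p2 /= => h4.
  have : (third y1 y2 y3 z = 2 %[mod 4])%N by rewrite -(modn_dvdm _ (st_Q4 st)) e3 (modn_dvdm _ (st_Q4 st)).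
  by rewrite (eqP (h4 : (4 %| _)%N)).
have [p2|p2] := boolP (p %| y2)%N.
  have := d3 p (dvdn_trans pp2 h).
  rewrite dvdn_addl; last by rewrite dvdn_mull// (dvdn_trans p2)// dvdn_exp.
  rewrite Euclid_dvdM// Euclid_dvdX// andbT => /orP[p1|p1]; first by apply: (b1y p).
  have := dvdn_gcd p y1 y2; rewrite p1 p2 (eqP (st_c12 st)) dvdn1 => /eqP e.
  by rewrite e in pp.
apply: nex; exists p; split=> //; first exact: st_K st _ pp nQ.
by left; right; right; right; split=> //; rewrite -eq dvdn_mul.
Qed.

(** * Sieving the candidates *)

Section Sums.
Variable R : realType.

Lemma sum_inv_sq_tail (D M : nat) : (0 < D)%N ->
  \sum_(0 <= p < M) (if (D < p)%N then p%:R ^- 2 else 0) <= D%:R^-1 :> R.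
Proof.
move=> D0; have D0' : 0 < D%:R :> R by rewrite ltr0n.
suff H n : \sum_(0 <= p < D.+1 + n) (if (D < p)%N then p%:R ^- 2 else 0) <= D%:R^-1 - (D + n)%:R^-1 :> R.
  apply: le_trans (_ : \sum_(0 <= p < D.+1 + M) (if (D < p)%N then p%:R ^- 2 else 0) <= _).
    rewrite [leRHS](@big_cat_nat _ _ _ M)//= ?leq_addl// lerDl sumr_ge0// => p _.
    by case: ifP => // _; posR.
  by apply: (le_trans (H M)); rewrite gerBl.
elim: n => [|n IH].
  rewrite addn0 big_nat big1 ?addn0 ?subrr// => p /andP[_ pD].
  by rewrite ltnNge -ltnS pD.
rewrite addnS big_nat_recr//= (le_trans (lerD IH (lexx _)))//.
rewrite addSn ltnS leq_addr.
have n0 : 0 < (D + n)%:R :> R by rewrite ltr0n addn_gt0 D0.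
rewrite addnS -[(D + n).+1%:R]natr1; move: ((D + n)%:R) n0 => x x0.
have x1 : 0 < x + 1 by lra.
rewrite -subr_ge0 [X in 0 <= X](_ : _ = (x * (x + 1) ^+ 2)^-1); first by posR.
by field; rewrite !lt0r_neq0.
Qed.

(* The additive error [e] is affordable only for [p <= D]; beyond [D] the cruder
   bound without additive error takes over. *)
Lemma sum_two_regimes (K M D : nat) (N e c : R) (f : nat -> R) : (0 < K)%N -> (0 < D)%N ->
  0 <= N -> 0 <= e -> 0 <= c -> (forall p, (K < p)%N -> f p <= N * p%:R ^- 2 + e) ->
  (forall p, (K < p)%N -> f p <= c * N * p%:R ^- 2) ->
  \sum_(0 <= p < M) (if (K < p)%N then f p else 0) <= N / K%:R + D.+1%:R * e + c * N / D%:R.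
Proof.
move=> K0 D0 N0 e0 c0 f1 f2.
apply: (@le_trans _ _ (N * \sum_(0 <= p < M) (if (K < p)%N then p%:R ^- 2 else 0) +
   \sum_(0 <= p < M) (if (p <= D)%N then e else 0) +
   c * N * \sum_(0 <= p < M) (if (D < p)%N then p%:R ^- 2 else 0))).
  rewrite !mulr_sumr -!big_split /=; apply: ler_sum => p _.
  have p0 : 0 <= p%:R ^- 2 :> R by posR.
  have cNp : 0 <= c * N * p%:R ^- 2 by posR.
  have Np : 0 <= N * p%:R ^- 2 by posR.
  case: (leqP p D) => pD; case: ifPn => [Kp|_]; rewrite ?mulr0 ?addr0 ?add0r//.
    exact: f1.
  by apply: (le_trans (f2 _ Kp)); rewrite lerDr.
apply: lerD; [apply: lerD|].
- by rewrite ler_wpM2l// sum_inv_sq_tail.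
- apply: (@le_trans _ _ (\sum_(0 <= p < M + D.+1) (if (p <= D)%N then e else 0))).
    rewrite [leRHS](@big_cat_nat _ _ _ M)//= ?leq_addr// lerDl sumr_ge0// => p _.
    by case: ifP.
  rewrite (@big_cat_nat _ _ _ D.+1)//= ?leq_addl//.
  rewrite [X in _ + X]big_nat [X in _ + X]big1 ?addr0; last first.
    by move=> p /andP[Dp _]; rewrite leqNgt Dp.
  rewrite big_nat (eq_bigr (fun=> e)); last by move=> p /andP[_]; rewrite ltnS => ->.
  by rewrite -big_nat sumr_const_nat subn0 -[X in X <= _]mulr_natl.
by rewrite ler_wpM2l ?mulr_ge0// sum_inv_sq_tail.
Qed.

End Sums.

(** * Bounds for the exceptional events *)

Section BadCount.
Variable R : realType.

Lemma near_bound (a b i j e : R) : 0 <= a -> 0 <= b -> 0 <= i <= 1 -> 0 <= j <= 1 ->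
  a + b + 1 <= e -> (1 + a * i) * (1 + b * j) <= a * b * (i * j) + e.
Proof.
move=> a0 b0 /andP[i0 i1] /andP[j0 j1] he.
have : a * i <= a by nra.
have : b * j <= b by nra.
have -> : (1 + a * i) * (1 + b * j) = a * b * (i * j) + (a * i + b * j + 1) by ring.
lra.
Qed.

(** If an event occurs at all, the divisor is at most the number it divides. This bounds each
    additive 1 by a multiple of the main term, here [u'] or [v']. *)
Lemma far_bound (u v u' v' : R) : 0 <= u -> 0 <= v -> 1 <= u' -> 1 <= v' ->
  (1 + u) * (1 + v) <= (u' + u) * (v' + v).
Proof. by move=> *; apply: ler_pM; lra. Qed.

Variables (Q K y1 y2 y3 n1 n2 : nat).

(** The factor [y3 ^ 2] is due to [atmost_dvd2], where the range of the second coordinate enters as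
    [y3 ^ 2 * n2]. *)
Definition event_error : R := (y3 ^ 2)%:R * (n1%:R + n2%:R + 1).
(** 14 is 2 (6 + 1), from the event on [x3]; the other three events need at most 6. *)
Definition event_const : R := 14 * Q%:R ^+ 2 * (y3 ^ 2)%:R * (y2 ^ 2)%:R.

Lemma event_const_ge0 : 0 <= event_const.
Proof. by rewrite /event_const !mulr_ge0. Qed.

Lemma event_error_ge0 : 0 <= event_error.
Proof. by rewrite /event_error mulr_ge0// !addr_ge0. Qed.

Definition local_event (E p : nat) (z : nat * nat) : Prop :=
  match E with
  | 0 => [/\ p %| z.1, p %| z.2 & ~~ (p %| y3)]%N
  | 1 => is_true (p ^ 2 %| z.1)%N
  | 2 => is_true (p ^ 2 %| z.2)%N
  | _ => (p ^ 2 * y3 ^ 2 %| z.1 * y1 ^ 2 + z.2 * y2 ^ 2)%N /\ ~~ (p %| y2)%N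
  end%N.

Lemma atmost_local_event p : setting Q K y1 y2 y3 n1 n2 -> prime p -> ~~ (p %| Q)%N ->
  forall E, E \in [:: 0; 1; 2; 3]%N ->
  let ev z := cand Q y1 y2 y3 n1 n2 z /\ local_event E p z in
  atmost ev (n1%:R * n2%:R * p%:R ^- 2 + event_error) /\
  atmost ev (event_const * (n1%:R * n2%:R) * p%:R ^- 2).
Proof.
move=> st pp nQ E hE.
have cQp : coprime Q p by rewrite coprime_sym prime_coprime.
have cQp2 : coprime Q (p ^ 2) by rewrite coprimeXr.
have p0 := prime_gt0 pp.
have p20 : (0 < p ^ 2)%N by rewrite expn_gt0 p0.
have Q0 : 1 <= Q%:R :> R by rewrite ler1n; case: st.
have y30 : (0 < y3)%N.
  rewrite lt0n; apply/eqP => y0; have := st_y3 st; rewrite y0 mod0n modn_small//.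
  by apply: leq_trans (dvdn_leq (st_Q0 st) (st_Q4 st)).
have y20 : (0 < y2)%N.
  rewrite lt0n; apply/eqP => y0; have := st_y2 st; rewrite y0 mod0n modn_small//.
  by apply: leq_trans (dvdn_leq (st_Q0 st) (st_Q4 st)).
have q1 : 1 <= (y3 ^ 2)%:R :> R by rewrite ler1n expn_gt0 y30.
have w1 : 1 <= (y2 ^ 2)%:R :> R by rewrite ler1n expn_gt0 y20.
have a1 : 1 <= n1%:R :> R by rewrite ler1n; case: st.
have b1 : 1 <= n2%:R :> R by rewrite ler1n; case: st.
have i0 : 0 < p%:R^-1 :> R by rewrite invr_gt0 ltr0n.
have i1 : p%:R^-1 <= 1 :> R by rewrite invf_le1 ?ler1n ?ltr0n.
have i2 : (p ^ 2)%:R^-1 = p%:R ^- 2 :> R by rewrite natrX.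
have i20 : 0 < p%:R ^- 2 :> R by rewrite invr_gt0 exprn_gt0// ltr0n.
have i21 : p%:R ^- 2 <= 1 :> R by rewrite -i2 invf_le1 ?ler1n ?ltr0n.
have serr1 : n1%:R + n2%:R + 1 <= event_error.
  by rewrite /event_error -[leLHS]mul1r ler_pM2r//; lra.
have k1 z : cand Q y1 y2 y3 n1 n2 z -> z.1%:R <= 2 * Q%:R * n1%:R :> R.
  by case=> /andP[_ h] _ _ _ _; rewrite -mulrA -!natrM ler_nat.
have k2 z : cand Q y1 y2 y3 n1 n2 z -> z.2%:R <= Q%:R * (y3 ^ 2)%:R * n2%:R :> R.
  by case=> _ _ /andP[_ h] _ _; rewrite -mulrA -!natrM ler_nat.
have z1 z : cand Q y1 y2 y3 n1 n2 z -> (0 < z.1)%N /\ (0 < z.2)%N.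
  by case=> /andP[h _] _ /andP[h' _] _ _; split=> //; exact: leq_ltn_trans h.
have sq0 : 0 <= event_const * (n1%:R * n2%:R) * p%:R ^- 2 by rewrite /event_const; posR.
have inv1 (d : nat) (x : R) : (0 < d)%N -> d%:R <= x -> 1 <= x * d%:R^-1.
  by move=> d0 dx; rewrite ler_pdivlMr ?mul1r// ltr0n.
have QQ : 1 <= Q%:R ^+ 2 :> R by rewrite exprn_ege1.
move: hE; rewrite !inE => /or4P[] /eqP -> ev.
- have [py3|npy3] := boolP (p %| y3)%N.
    suff H (c : R) : 0 <= c -> atmost ev c by split; apply: H => //; rewrite addr_ge0 ?mulr_ge0 ?(ltW i20)//; lra.
    by move=> c0; apply: atmost_inhabited => // z [_ []]; rewrite py3.
  have cpy : coprime p y3 by rewrite prime_coprime.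
  have B := @atmost_dvd12 R _ _ _ _ _ _ _ st p p0 cQp cpy.
  have B' : atmost ev ((1 + n1%:R / p%:R) * (1 + n2%:R / p%:R) : R).
    by apply: (atmost_sub _ (lexx _) B) => z [Cz []].
  split.
    apply: atmost_sub (fun x H => H) _ B'.
    have -> : p%:R ^- 2 = p%:R^-1 * p%:R^-1 :> R by rewrite -expr2 exprVn.
    by apply: near_bound => //; rewrite ?(ltW i0) ?i1//; lra.
  apply: atmost_inhabited => // z [Cz [d1 d2 _]].
  have [z10 z20] := z1 z Cz.
  have h1 : 1 <= 2 * Q%:R * n1%:R * p%:R^-1 :> R.
    by apply: inv1 => //; apply: le_trans (k1 z Cz); rewrite ler_nat dvdn_leq.
  have h2 : 1 <= Q%:R * (y3 ^ 2)%:R * n2%:R * p%:R^-1 :> R.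
    by apply: inv1 => //; apply: le_trans (k2 z Cz); rewrite ler_nat dvdn_leq.
  apply: atmost_sub (fun x H => H) _ B'.
  apply: le_trans (far_bound _ _ h1 h2) _; [by posR|by posR|].
  have -> : (2 * Q%:R * n1%:R / p%:R + n1%:R / p%:R) *
     (Q%:R * (y3 ^ 2)%:R * n2%:R / p%:R + n2%:R / p%:R) =
     ((2 * Q%:R + 1) * (Q%:R * (y3 ^ 2)%:R + 1)) * (n1%:R * n2%:R * p%:R ^- 2) :> R.
    by rewrite -exprVn; ring.
  rewrite /event_const -[leRHS]mulrA ler_wpM2r//; try by posR.
  apply: (@le_trans _ _ ((3 * Q%:R) * (2 * (Q%:R * (y3 ^ 2)%:R)))).
    apply: ler_pM; [by posR|by posR|by lra|].
    have : 1 <= Q%:R * (y3 ^ 2)%:R :> R by rewrite mulr_ege1.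
    by lra.
  have -> : 3 * Q%:R * (2 * (Q%:R * (y3 ^ 2)%:R)) = 6 * Q%:R ^+ 2 * (y3 ^ 2)%:R * 1 :> R by ring.
  by do !(apply: ler_pM; try posR).
- have B := @atmost_dvd1 R _ _ _ _ _ _ _ st _ p20 cQp2.
  have B' : atmost ev ((1 + n1%:R / (p ^ 2)%:R) * (1 + n2%:R) : R) by [].
  rewrite i2 in B'.
  split.
    apply: atmost_sub (fun x H => H) _ B'.
    have := @near_bound n1%:R n2%:R (p%:R ^- 2) 1 event_error; rewrite !mulr1; apply => //.
      by rewrite (ltW i20) i21.
    by rewrite ler01 lexx.
  apply: atmost_inhabited => // z [Cz d1].
  have [z10 z20] := z1 z Cz.
  have h1 : 1 <= 2 * Q%:R * n1%:R * p%:R ^- 2 :> R.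
    by rewrite -i2; apply: inv1 => //; apply: le_trans (k1 z Cz); rewrite ler_nat dvdn_leq.
  apply: atmost_sub (fun x H => H) _ B'.
  apply: le_trans (far_bound _ _ h1 b1) _; [by posR|by posR|].
  have -> : (2 * Q%:R * n1%:R * p%:R ^- 2 + n1%:R * p%:R ^- 2) * (n2%:R + n2%:R) =
     (2 * (2 * Q%:R + 1)) * (n1%:R * n2%:R * p%:R ^- 2) :> R by ring.
  rewrite /event_const -[leRHS]mulrA ler_wpM2r//; try by posR.
  apply: (@le_trans _ _ (6 * Q%:R ^+ 2 * 1 * 1)).
    have : Q%:R <= Q%:R ^+ 2 :> R by rewrite expr2 ler_peMr//; lra.
    lra.
  by do !(apply: ler_pM; try posR).
- have B := @atmost_dvd2 R _ _ _ _ _ _ _ st _ p20 cQp2.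
  have B' : atmost ev ((1 + (y3 ^ 2 * n2)%:R / (p ^ 2)%:R) * (1 + n1%:R / (y3 ^ 2)%:R) : R) by [].
  rewrite i2 natrM in B'.
  have iq0 : 0 < (y3 ^ 2)%:R^-1 :> R by rewrite invr_gt0; lra.
  have iq1 : (y3 ^ 2)%:R^-1 <= 1 :> R by rewrite invf_le1; lra.
  split.
    apply: atmost_sub (fun x H => H) _ B'.
    have -> : n1%:R * n2%:R * p%:R ^- 2 = ((y3 ^ 2)%:R * n2%:R) * n1%:R * (p%:R ^- 2 * (y3 ^ 2)%:R^-1) :> R.
      by field; rewrite !pnatr_eq0 -!lt0n p0 y30.
    apply: near_bound; rewrite ?(ltW i20) ?i21 ?(ltW iq0) ?iq1//.
    rewrite /event_error; have : n1%:R <= (y3 ^ 2)%:R * n1%:R :> R by rewrite ler_peMl//; lra.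
    lra.
  apply: atmost_inhabited => // z [Cz d1].
  have [z10 z20] := z1 z Cz.
  have h1 : 1 <= Q%:R * (y3 ^ 2)%:R * n2%:R * p%:R ^- 2 :> R.
    by rewrite -i2; apply: inv1 => //; apply: le_trans (k2 z Cz); rewrite ler_nat dvdn_leq.
  apply: atmost_sub (fun x H => H) _ B'.
  apply: le_trans (far_bound _ _ h1 a1) _; [by posR|by posR|].
  apply: (@le_trans _ _ ((2 * (Q%:R * (y3 ^ 2)%:R * n2%:R * p%:R ^- 2)) * (2 * n1%:R))).
    apply: ler_pM; [by posR|by posR| |].
      have : (y3 ^ 2)%:R * n2%:R * p%:R ^- 2 <= Q%:R * ((y3 ^ 2)%:R * n2%:R * p%:R ^- 2) :> R.
        by rewrite ler_peMl//; posR.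
      lra.
    have : n1%:R * (y3 ^ 2)%:R^-1 <= n1%:R :> R by rewrite ler_piMr//; lra.
    lra.
  have -> : 2 * (Q%:R * (y3 ^ 2)%:R * n2%:R * p%:R ^- 2) * (2 * n1%:R) =
     (4 * (Q%:R * (y3 ^ 2)%:R)) * (n1%:R * n2%:R * p%:R ^- 2) :> R by ring.
  rewrite /event_const -[leRHS]mulrA ler_wpM2r//; try by posR.
  apply: (@le_trans _ _ (4 * Q%:R ^+ 2 * (y3 ^ 2)%:R * 1)).
    have : Q%:R * (y3 ^ 2)%:R <= Q%:R ^+ 2 * (y3 ^ 2)%:R :> R.
      by rewrite ler_pM2r ?expr2 ?ler_peMr//; lra.
    lra.
  by do !(apply: ler_pM; try posR).
have [py2|npy2] := boolP (p %| y2)%N.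
  suff H (c : R) : 0 <= c -> atmost ev c by split; apply: H => //; rewrite addr_ge0 ?mulr_ge0 ?(ltW i20)//; lra.
  by move=> c0; apply: atmost_inhabited => // z [_ []]; rewrite py2.
have cpy : coprime (p ^ 2) y2 by rewrite coprimeXl// prime_coprime.
have B := @atmost_dvd3 R _ _ _ _ _ _ _ st _ p20 cQp2 cpy.
have B' : atmost ev ((1 + n1%:R) * (1 + n2%:R / (p ^ 2)%:R) : R).
  by apply: (atmost_sub _ (lexx _) B) => z [Cz []].
rewrite i2 in B'; split.
  apply: atmost_sub (fun x H => H) _ B'.
  have := @near_bound n1%:R n2%:R 1 (p%:R ^- 2) event_error; rewrite !mulr1 mul1r; apply => //.
    by rewrite ler01 lexx.
  by rewrite (ltW i20) i21.
apply: atmost_inhabited => // z [Cz [d1 _]].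
(* [p ^ 2 * y3 ^ 2] divides a positive number, and the two terms of that number are at most 4 and 1
   times [Q * (n2 * (y2 * y3) ^ 2)]. *)
have h1 : 1 <= 6 * Q%:R * (y2 ^ 2)%:R * n2%:R * p%:R ^- 2 :> R.
  rewrite -i2; apply: inv1 => //.
  rewrite -(@ler_pM2r _ (y3 ^ 2)%:R) ?(lt_le_trans ltr01)//.
  have -> : 6 * Q%:R * (y2 ^ 2)%:R * n2%:R * (y3 ^ 2)%:R = (6 * (Q * (n2 * (y2 * y3) ^ 2)))%:R :> R.
    by rewrite !natrM; ring.
  rewrite -natrM ler_nat.
  have [z10 z20] := z1 z Cz; have le := st_le st; have ge := st_ge st.
  case: Cz => /andP[_ l1] _ /andP[_ l2] _ _.
  apply: (leq_trans (dvdn_leq _ d1)); first by rewrite addn_gt0 [X in _ || X]muln_gt0 z20 expn_gt0 y20 orbT.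
  have le1 : (z.1 * y1 ^ 2 <= 4 * (Q * (n2 * (y2 * y3) ^ 2)))%N.
    apply: (@leq_trans (2 * Q * (n1 * y1 ^ 2))); first by rewrite mulnA leq_mul2r -mulnA l1 orbT.
    have -> : (4 * (Q * (n2 * (y2 * y3) ^ 2)) = 2 * Q * (2 * (n2 * (y2 * y3) ^ 2)))%N by ring.
    by rewrite leq_mul2l ge orbT.
  have le2 : (z.2 * y2 ^ 2 <= Q * (n2 * (y2 * y3) ^ 2))%N.
    have -> : (Q * (n2 * (y2 * y3) ^ 2) = Q * (y3 ^ 2 * n2) * y2 ^ 2)%N by ring.
    by rewrite leq_mul2r l2 orbT.
  apply: (leq_trans (leq_add le1 le2)); rewrite -mulSnr leq_mul2r orbT//.
apply: atmost_sub (fun x H => H) _ B'.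
apply: le_trans (far_bound _ _ a1 h1) _; [by posR|by posR|].
have -> : (n1%:R + n1%:R) * (6 * Q%:R * (y2 ^ 2)%:R * n2%:R * p%:R ^- 2 + n2%:R * p%:R ^- 2) =
   (2 * (6 * (Q%:R * (y2 ^ 2)%:R) + 1)) * (n1%:R * n2%:R * p%:R ^- 2) :> R by ring.
rewrite /event_const -[leRHS]mulrA ler_wpM2r//; try by posR.
apply: (@le_trans _ _ (14 * (Q%:R * (y2 ^ 2)%:R))).
  have : 1 <= Q%:R * (y2 ^ 2)%:R :> R by rewrite mulr_ege1.
  lra.
have -> : 14 * Q%:R ^+ 2 * (y3 ^ 2)%:R * (y2 ^ 2)%:R = 14 * (Q%:R * (y2 ^ 2)%:R) * (Q%:R * (y3 ^ 2)%:R) :> R by ring.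
rewrite ler_peMr//; try by posR.
by rewrite mulr_ege1.
Qed.

(** Any crude bound will do: it only serves to make the sum over [p] finite. *)
Lemma local_event_bounded E p z : (0 < y3)%N -> E \in [:: 0; 1; 2; 3]%N ->
  cand Q y1 y2 y3 n1 n2 z -> local_event E p z ->
  (p < (2 * (Q * n1) + Q * (y3 ^ 2 * n2) + (2 * (Q * n1) * y1 ^ 2 + Q * (y3 ^ 2 * n2) * y2 ^ 2)).+1)%N.
Proof.
move=> y30 hE [/andP[l0 l1] _ /andP[m0 m1] _ _] ev; rewrite ltnS.
have z10 : (0 < z.1)%N by exact: leq_ltn_trans l0.
have pz1 : (p %| z.1)%N -> (p <= 2 * (Q * n1))%N by move=> /(dvdn_leq z10) h; exact: leq_trans l1.
have pz2 : (p %| z.2)%N -> (p <= Q * (y3 ^ 2 * n2))%N by move=> /(dvdn_leq m0) h; exact: leq_trans m1.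
have pp2 : (p %| p ^ 2)%N by rewrite dvdn_exp.
move: hE ev; rewrite !inE => /or4P[] /eqP -> /=.
- by case=> /pz1 h _ _; apply: (leq_trans h); rewrite -addnA leq_addr.
- by move=> /(dvdn_trans pp2)/pz1 h; apply: (leq_trans h); rewrite -addnA leq_addr.
- by move=> /(dvdn_trans pp2)/pz2 h; apply: (leq_trans h); rewrite -addnA addnCA leq_addr.
case=> d np; have y20 : (0 < y2)%N by move: np; case: (y2) => //; rewrite dvdn0.
have S0 : (0 < z.1 * y1 ^ 2 + z.2 * y2 ^ 2)%N by rewrite addn_gt0 [X in _ || X]muln_gt0 m0 expn_gt0 y20 orbT.
have /(dvdn_leq S0) h : (p %| z.1 * y1 ^ 2 + z.2 * y2 ^ 2)%N.
  by apply: dvdn_trans d; rewrite dvdn_mulr.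
apply: (leq_trans h); apply: leq_trans (leq_addl _ _).
by apply: leq_add; rewrite leq_mul2r ?l1 ?m1 orbT.
Qed.

Lemma atmost_local_union (E D : nat) : setting Q K y1 y2 y3 n1 n2 -> (0 < K)%N -> (0 < D)%N ->
  (0 < y3)%N -> E \in [:: 0; 1; 2; 3]%N ->
  atmost (fun z => exists p, [/\ prime p, (K < p)%N, ~~ (p %| Q)%N,
     cand Q y1 y2 y3 n1 n2 z & local_event E p z])
   (n1%:R * n2%:R / K%:R + D.+1%:R * event_error + event_const * (n1%:R * n2%:R) / D%:R).
Proof.
move=> st K0 D0 y30 hE.
pose M := (2 * (Q * n1) + Q * (y3 ^ 2 * n2) + (2 * (Q * n1) * y1 ^ 2 + Q * (y3 ^ 2 * n2) * y2 ^ 2)).+1.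
pose f p : R := Num.min (n1%:R * n2%:R * p%:R ^- 2 + event_error) (event_const * (n1%:R * n2%:R) * p%:R ^- 2).
apply: (@atmost_sub _ _ _ _ _ (\sum_(0 <= p < M) (if (K < p)%N then f p else 0)) (fun x H => H)).
  apply: sum_two_regimes; [exact: K0|exact: D0|..].
  - by posR.
  - exact: event_error_ge0.
  - exact: event_const_ge0.
  - by move=> p _; rewrite /f ge_min lexx.
  - by move=> p _; rewrite /f ge_min lexx orbT.
apply: (atmost_cover (E := fun p z => [/\ prime p, (K < p)%N, ~~ (p %| Q)%N,
     cand Q y1 y2 y3 n1 n2 z & local_event E p z])).
  move=> z [p [pp Kp nQ Cz ev]]; exists p => //.
  by rewrite mem_index_iota /= (local_event_bounded y30 hE Cz ev).
move=> p _; apply: atmost_inhabited.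
  case: ifP => // _; rewrite /f le_min; have := event_const_ge0; have := event_error_ge0 => h1 h2.
  by apply/andP; split; posR.
move=> z0 [_ [pp Kp nQ _ _]]; rewrite Kp.
have [B1 B2] := atmost_local_event st pp nQ hE.
rewrite /f; case: leP => _; [apply: (atmost_sub _ (lexx _) B1)|apply: (atmost_sub _ (lexx _) B2)];
  by move=> z [_ []].
Qed.

Definition large_divisor_sum (y : nat) : R :=
  \sum_(0 <= p < y.+1) (if (K < p)%N && (p %| y)%N then p%:R^-1 else 0).

Lemma large_divisor_sum_ge0 y : 0 <= large_divisor_sum y.
Proof. by apply: sumr_ge0 => p _; case: ifP => // _; posR. Qed.

Lemma atmost_dividing (P : nat -> nat * nat -> Prop) (y : nat) (a b : R) :
  0 <= a -> 0 <= b -> (0 < y)%N ->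
  (forall p, prime p -> ~~ (p %| Q)%N -> atmost (P p) (a * p%:R^-1 + b)) ->
  atmost (fun z => exists p, [/\ prime p, (K < p)%N, ~~ (p %| Q)%N, P p z & (p %| y)%N])
    (a * large_divisor_sum y + y.+1%:R * b).
Proof.
move=> a0 b0 y0 H.
apply: (@atmost_sub _ _ _ _ _ (\sum_(0 <= p < y.+1)
    ((if (K < p)%N && (p %| y)%N then a * p%:R^-1 else 0) + b)) (fun x H => H)).
  rewrite big_split /= sumr_const_nat subn0 -[X in _ + X <= _]mulr_natl lerD2r.
  rewrite /large_divisor_sum mulr_sumr; apply: ler_sum => p _; by case: ifP; rewrite ?mulr0.
apply: (atmost_cover (E := fun p z => [/\ prime p, (K < p)%N, ~~ (p %| Q)%N, P p z & (p %| y)%N])).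
  move=> z [p [pp Kp nQ Pz py]]; exists p => //.
  by rewrite mem_index_iota /= ltnS dvdn_leq.
move=> p _; apply: atmost_inhabited.
  by apply: addr_ge0 => //; case: ifP => // _; posR.
move=> z0 [_ [pp Kp nQ _ py]]; rewrite Kp py.
by apply: (atmost_sub _ (lexx _) (H p pp nQ)) => z [_ []].
Qed.

(** Each of the four local events costs at most 3/100 of the candidates: the tail above [K], the
    additive errors up to [D], the tail above [D]. Each family with [p] dividing some [yi] costs
    1/100 besides its divisor sum. The total 15/100 is below 1/2. *)
Lemma good_seq (t : R) : setting Q K y1 y2 y3 n1 n2 -> (100 <= K)%N ->
  y1%:R <= t -> y2%:R <= t -> y3%:R <= t ->
  100 * (100 * (14 * Q%:R ^+ 2)) * t ^+ 6 * (2 * (n1%:R + n2%:R + 1)) <= n1%:R * n2%:R ->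
  exists s, [/\ uniq s, {in s, forall z, good Q y1 y2 y3 n1 n2 z} &
    n1%:R * n2%:R * (2^-1 - large_divisor_sum y1 - large_divisor_sum y2 - large_divisor_sum y3) <= (size s)%:R].
Proof.
move=> st K100 t1 t2 t3 big.
have [s0 [us0 Cs0 ss0]] := cand_seq st.
pose s := [seq z <- s0 | `[< good Q y1 y2 y3 n1 n2 z >]].
exists s; split; first exact: filter_uniq.
  by move=> z; rewrite mem_filter => /andP[/asboolP].
have Q1 : (1 < Q)%N by apply: leq_trans (dvdn_leq (st_Q0 st) (st_Q4 st)).
have ypos y : y = 1 %[mod Q] -> (0 < y)%N.
  by rewrite lt0n => h; apply/eqP => y0; move: h; rewrite y0 mod0n modn_small.
have y10 := ypos _ (st_y1 st); have y20 := ypos _ (st_y2 st); have y30 := ypos _ (st_y3 st).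
have K0 : (0 < K)%N by exact: leq_trans K100.
(* [D] is 100 times [event_const], so that the tail above [D] costs 1/100. *)
pose D := (100 * (14 * (Q ^ 2 * y3 ^ 2 * y2 ^ 2)))%N.
have D0 : (0 < D)%N by rewrite /D !muln_gt0 (st_Q0 st) y20 y30.
have loc E : E \in [:: 0; 1; 2; 3]%N -> _ := fun h => @atmost_local_union E D st K0 D0 y30 h.
set U := n1%:R * n2%:R / K%:R + D.+1%:R * event_error + event_const * (n1%:R * n2%:R) / D%:R in loc.
set ab : R := n1%:R * n2%:R in U loc big *.
have ab0 : 0 <= ab by rewrite /ab; posR.
have serr0 := event_error_ge0.
pose C := cand Q y1 y2 y3 n1 n2.
have q1 : 1 <= (y3 ^ 2)%:R :> R by rewrite ler1n expn_gt0 y30.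
have B2 (y : nat) : (0 < y)%N -> atmost (fun z => exists p, [/\ prime p, (K < p)%N, ~~ (p %| Q)%N,
    C z /\ (p %| z.1)%N & (p %| y)%N]) (ab * large_divisor_sum y + y.+1%:R * event_error).
  move=> y0; apply: atmost_dividing => // p pp nQ.
  have cQp : coprime Q p by rewrite coprime_sym prime_coprime.
  apply: atmost_sub (fun x H => H) _ (@atmost_dvd1 R _ _ _ _ _ _ _ st p (prime_gt0 pp) cQp).
  have := @near_bound n1%:R n2%:R p%:R^-1 1 event_error; rewrite !mulr1; apply => //.
    by rewrite invr_ge0 ler0n invf_le1 ?ler1n ?ltr0n prime_gt0.
    by rewrite ler01 lexx.
  by rewrite /event_error -[leLHS]mul1r ler_pM2r//; posR.
have B1 : atmost (fun z => exists p, [/\ prime p, (K < p)%N, ~~ (p %| Q)%N,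
    C z /\ (p %| z.2)%N & (p %| y1)%N]) (ab * large_divisor_sum y1 + y1.+1%:R * event_error).
  apply: atmost_dividing => // p pp nQ.
  have cQp : coprime Q p by rewrite coprime_sym prime_coprime.
  apply: atmost_sub (fun x H => H) _ (@atmost_dvd2 R _ _ _ _ _ _ _ st p (prime_gt0 pp) cQp).
  rewrite natrM.
  have -> : ab * p%:R^-1 = ((y3 ^ 2)%:R * n2%:R) * n1%:R * (p%:R^-1 * (y3 ^ 2)%:R^-1).
    by rewrite /ab; field; rewrite !pnatr_eq0 -!lt0n y30 prime_gt0.
  apply: near_bound => //; try by posR.
  - by rewrite invr_ge0 ler0n invf_le1 ?ler1n ?ltr0n prime_gt0.
  - by rewrite invr_ge0 ler0n invf_le1//; lra.
  rewrite /event_error; have : n1%:R <= (y3 ^ 2)%:R * n1%:R :> R by rewrite ler_peMl.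
  lra.
have bad : atmost (fun z => C z /\ ~ good Q y1 y2 y3 n1 n2 z)
   ((U + (U + (U + U))) + ((ab * large_divisor_sum y2 + y2.+1%:R * event_error) + ((ab * large_divisor_sum y3 + y3.+1%:R * event_error)
      + (ab * large_divisor_sum y1 + y1.+1%:R * event_error)))).
  apply: atmost_or; last first.
  - apply: atmost_or; [|exact: B2 y20|]; last first.
      by apply: atmost_or; [|exact: B2 y30|exact: B1]; move=> z; exact: id.
    by move=> z; exact: id.
  - apply: atmost_or; [|exact: (loc 0%N isT)|]; last first.
      apply: atmost_or; [|exact: (loc 1%N isT)|]; last first.
        by apply: atmost_or; [|exact: (loc 2%N isT)|exact: (loc 3%N isT)]; move=> z; exact: id.
      by move=> z; exact: id.
    by move=> z; exact: id.
  move=> z [Cz /(bad_prime st Cz)[p [pp Kp nQ]]].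
  case=> [[h|[h|[h|h]]]|[[h h']|[[h h']|[h h']]]].
  - by left; left; exists p.
  - by left; right; left; exists p.
  - by left; right; right; left; exists p.
  - by left; right; right; right; exists p.
  - by right; left; exists p.
  - by right; right; left; exists p.
  - by right; right; right; exists p.
have sz : (size s0)%:R = (size s)%:R + (size [seq z <- s0 | ~~ `[< good Q y1 y2 y3 n1 n2 z >]])%:R :> R.
  by rewrite -natrD !size_filter count_predC.
have bs : (size [seq z <- s0 | ~~ `[< good Q y1 y2 y3 n1 n2 z >]])%:R <=
   ((U + (U + (U + U))) + ((ab * large_divisor_sum y2 + y2.+1%:R * event_error) + ((ab * large_divisor_sum y3 + y3.+1%:R * event_error)
      + (ab * large_divisor_sum y1 + y1.+1%:R * event_error)))).
  apply: bad; first exact: filter_uniq.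
  by move=> z; rewrite mem_filter => /andP[/asboolPn ng /Cs0].
move: sz; rewrite ss0 natrM -/ab => sz.
have t0 : 1 <= t by apply: le_trans t1; rewrite ler1n.
have tp : 0 < t by lra.
have QR : 1 <= Q%:R :> R by rewrite ler1n ltnW.
have K100' : 100 <= K%:R :> R by rewrite (ler_nat R 100).
have DE : D%:R = 100 * event_const by rewrite /D /event_const !natrM; ring.
have sq (y : nat) : y%:R <= t -> (y ^ 2)%:R <= t ^+ 2.
  by move=> yt; rewrite natrX lerXn2r// ?nnegrE ?ler0n// ltW.
have w1 : 1 <= (y2 ^ 2)%:R :> R by rewrite ler1n expn_gt0 y20.
have hsC : event_const <= 14 * Q%:R ^+ 2 * t ^+ 4.
  have -> : 14 * Q%:R ^+ 2 * t ^+ 4 = 14 * Q%:R ^+ 2 * t ^+ 2 * t ^+ 2 by ring.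
  rewrite /event_const; apply: ler_pM; [by rewrite !mulr_ge0|by []| |exact: sq].
  by apply: ler_pM; [by rewrite !mulr_ge0|by []|by []|exact: sq].
have sC1 : 1 <= event_const.
  rewrite /event_const; do 2![apply: mulr_ege1 => //].
  by apply: mulr_ege1; [lra|exact: exprn_ege1].
clear loc B2 B1 bad.
pose G : R := n1%:R + n2%:R + 1.
have G0 : 0 <= G by rewrite /G !addr_ge0.
have sG : event_error <= t ^+ 2 * G by rewrite /event_error -/G ler_wpM2r// sq.
rewrite -/G in big.
have e1 : D.+1%:R * event_error <= ab / 100.
  rewrite ler_pdivlMr//; apply: le_trans big.
  have h : D.+1%:R <= 200 * (14 * Q%:R ^+ 2 * t ^+ 4).
    by rewrite -natr1 DE; lra.
  apply: (@le_trans _ _ (200 * (14 * Q%:R ^+ 2 * t ^+ 4) * (t ^+ 2 * G) * 100)).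
    by rewrite ler_pM2r//; apply: ler_pM.
  by rewrite le_eqVlt; apply/orP; left; apply/eqP; ring.
have e2 (y : nat) : y%:R <= t -> y.+1%:R * event_error <= ab / 100.
  move=> yt; rewrite ler_pdivlMr//; apply: le_trans big.
  have h : y.+1%:R <= 2 * t by rewrite -natr1; lra.
  apply: (@le_trans _ _ (2 * t * (t ^+ 2 * G) * 100)).
    by rewrite ler_pM2r//; apply: ler_pM.
  have Q2 : 1 <= Q%:R ^+ 2 :> R by exact: exprn_ege1.
  have t36 : t ^+ 3 <= t ^+ 6 by rewrite ler_weXn2l.
  have t30 : 0 <= t ^+ 3 by posR.
  have -> : 2 * t * (t ^+ 2 * G) * 100 = 100 * (1 * t ^+ 3) * (2 * G) by ring.
  rewrite ler_wpM2r//; first by posR.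
  rewrite -[leRHS]mulrA ler_pM2l//; apply: ler_pM => //.
  lra.
have e3 : ab / K%:R <= ab / 100 by rewrite ler_wpM2l// lef_pV2 ?posrE//; lra.
have e4 : event_const * ab / D%:R = ab / 100.
  by rewrite DE; field; rewrite lt0r_neq0//; lra.
have hU : U <= 3 * (ab / 100) by rewrite /U e4; lra.
have := e2 _ t1; have := e2 _ t2; have := e2 _ t3 => h3 h2 h1.
move: bs sz hU h1 h2 h3.
move: (size s)%:R (size _)%:R (U) (y1.+1%:R * event_error) (y2.+1%:R * event_error) (y3.+1%:R * event_error).
move: (large_divisor_sum y1) (large_divisor_sum y2) (large_divisor_sum y3) ab0; move: (ab); clear.
move=> ab s1 s2 s3 ab0 N N' U m1 m2 m3 bs sz hU h1 h2 h3.
have -> : ab * (2^-1 - s1 - s2 - s3) = ab / 2 - ab * s1 - ab * s2 - ab * s3 by ring.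
lra.
Qed.

End BadCount.

(** * From candidates to points of bounded height *)

Section Points.
Variable R : realType.

Lemma N_ge (T : R) s : uniq s -> {in s, forall p, half_points T p} -> (size s <= N T)%N.
Proof.
move=> us sP; rewrite /N; apply: uniq_leq_size => // p /sP h.
by rewrite in_fset_set ?in_setE//; exact: finite_half_points.
Qed.

Lemma squarefreez_nat (n : nat) : (0 < n)%N -> (forall p, prime p -> ~~ (p ^ 2 %| n)%N) ->
  squarefreez n.
Proof.
move=> n0 H d; rewrite dvdzE abszX absz_nat => dn.
have [d1|d1] := leqP `|d| 1.
  have d0 : (0 < `|d|)%N.
    by rewrite lt0n; apply: contraTneq dn => ->; rewrite exp0n// dvd0n -lt0n.
  by rewrite qualifE /=; move: d0 d1; clear; lia.
have := H _ (pdiv_prime d1); rewrite (dvdn_trans _ dn)//.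
by rewrite dvdn_exp2r// pdiv_dvd.
Qed.

Definition half_point_of (y1 y2 y3 : nat) (z : nat * nat) : (int * int * int) * (int * int * int) :=
  ((z.1%:Z, z.2%:Z, (third y1 y2 y3 z)%:Z), (y1%:Z, y2%:Z, y3%:Z)).

(** The height times [(y1 y2 y3)^2] is the product of the three terms with the first one squared.
    With [M = Q n1 y1^2] the terms are at most [2 M], [M] and [3 M], whence 12. *)
Lemma good_half_points (T : R) Q K y1 y2 y3 n1 n2 z : setting Q K y1 y2 y3 n1 n2 ->
  good Q y1 y2 y3 n1 n2 z ->
  12 * (Q * n1 * y1 ^ 2)%:R ^+ 4 <= T * (y1 * y2 * y3)%:R ^+ 2 ->
  half_points T (half_point_of y1 y2 y3 z).
Proof.
move=> st [Cz c12 c13 c23 sf] hT.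
have Q1 : (1 < Q)%N by apply: leq_trans (dvdn_leq (st_Q0 st) (st_Q4 st)).
have ypos y : y = 1 %[mod Q] -> (0 < y)%N.
  by rewrite lt0n => h; apply/eqP => y0; move: h; rewrite y0 mod0n modn_small.
have y10 := ypos _ (st_y1 st); have y20 := ypos _ (st_y2 st); have y30 := ypos _ (st_y3 st).
case: Cz => /andP[l0 l1] _ /andP[m0 m1] _ d.
have z10 : (0 < z.1)%N by exact: leq_ltn_trans l0.
have eq : (third y1 y2 y3 z * y3 ^ 2 = z.1 * y1 ^ 2 + z.2 * y2 ^ 2)%N by rewrite /third divnK.
have x30 : (0 < third y1 y2 y3 z)%N.
  rewrite lt0n; apply/eqP => e0; move: eq; rewrite e0 mul0n => /esym/eqP.
  by rewrite addn_eq0 muln_eq0 (gtn_eqF z10) expn_eq0 (gtn_eqF y10).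
set M := (Q * n1 * y1 ^ 2)%N in hT.
have b2 : (z.2 * y2 ^ 2 <= M)%N.
  apply: (@leq_trans (Q * (y3 ^ 2 * n2) * y2 ^ 2)); first by rewrite leq_mul2r m1 orbT.
  have -> : (Q * (y3 ^ 2 * n2) * y2 ^ 2 = Q * (n2 * (y2 * y3) ^ 2))%N by ring.
  by rewrite /M -mulnA leq_mul2l (st_le st) orbT.
have b1 : (M <= z.1 * y1 ^ 2)%N by rewrite /M leq_mul2r (ltnW l0) orbT.
have b1' : (z.1 * y1 ^ 2 <= 2 * M)%N by rewrite /M mulnA leq_mul2r l1 orbT.
have b3 : (third y1 y2 y3 z * y3 ^ 2 <= 3 * M)%N.
  by rewrite eq (leq_trans (leq_add b1' b2))// -mulSnr.
split; first by split; split; rewrite eqz_nat -lt0n.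
split; first by split; split; rewrite coprimezE !absz_nat//; case: st.
split.
  by split; apply: squarefreez_nat => // p /sf[].
have cast (a b : nat) : a%:Z * b%:Z ^+ 2 = (a * b ^ 2)%N%:Z.
  by rewrite PoszM expnS expn1 PoszM expr2.
split; first by rewrite !cast -PoszD -eq.
split; first by rewrite ltz_nat.
split.
  by rewrite !cast lez_nat (leq_trans b2).
have -> : `|(z.1%:Z * y1%:Z) ^+ 2 * z.2%:Z * (third y1 y2 y3 z)%:Z| =
   ((z.1 * y1) ^ 2 * z.2 * third y1 y2 y3 z)%N%:Z.
  by rewrite expr2 -!PoszM -mulnn.
rewrite -pmulrn.
have P0 : 0 < (y1 * y2 * y3)%:R ^+ 2 :> R by rewrite exprn_gt0// ltr0n !muln_gt0 y10 y20 y30.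
rewrite -(ler_pM2r P0); apply: le_trans hT.
rewrite -!natrX -!natrM ler_nat.
have -> : ((z.1 * y1) ^ 2 * z.2 * third y1 y2 y3 z * (y1 * y2 * y3) ^ 2 =
  (z.1 * y1 ^ 2) * (z.1 * y1 ^ 2) * ((z.2 * y2 ^ 2) * (third y1 y2 y3 z * y3 ^ 2)))%N by ring.
have -> : (12 * M ^ 4 = (2 * M) * (2 * M) * (M * (3 * M)))%N by ring.
by apply: leq_mul; apply: leq_mul.
Qed.

(** With [P = y1 y2 y3], the height condition is an equality for [Q n1 y1^2 = Y], where
    [Y^4 = T P^2 / 12]. So [n1] is the integer part of [Y / (Q y1^2)] and [n2] that of
    [n1 y1^2 / (y2 y3)^2]; their product is about [(Y / (Q P))^2], which is [V]. *)
Lemma choose_sizes (T t : R) (Q y1 y2 y3 : nat) : (0 < Q)%N ->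
  (0 < y1)%N -> (0 < y2)%N -> (0 < y3)%N ->
  y1%:R <= t -> y2%:R <= t -> y3%:R <= t -> T = t ^+ 64 ->
  300 * (100 * 100) * Q%:R ^+ 3 <= t ->
  exists n1 n2, [/\ (0 < n1)%N /\ (0 < n2)%N,
    (n2 * (y2 * y3) ^ 2 <= n1 * y1 ^ 2)%N /\ (n1 * y1 ^ 2 <= 2 * (n2 * (y2 * y3) ^ 2))%N,
    12 * (Q * n1 * y1 ^ 2)%:R ^+ 4 <= T * (y1 * y2 * y3)%:R ^+ 2,
    100 * (100 * (14 * Q%:R ^+ 2)) * t ^+ 6 * (2 * (n1%:R + n2%:R + 1)) <= n1%:R * n2%:R &
    let V := Num.sqrt (T / 12) / Q%:R ^+ 2 * (y1%:R^-1 * y2%:R^-1 * y3%:R^-1) in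
    V / 2 <= n1%:R * n2%:R <= V].
Proof.
move=> Q0 y10 y20 y30 t1 t2 t3 HT ht.
have QR : 1 <= Q%:R :> R by rewrite ler1n.
have Qp : 0 < Q%:R :> R by lra.
have Q3 : 1 <= Q%:R ^+ 3 :> R by exact: exprn_ege1.
have a1 : 1 <= y1%:R :> R by rewrite ler1n.
have a2 : 1 <= y2%:R :> R by rewrite ler1n.
have a3 : 1 <= y3%:R :> R by rewrite ler1n.
have tbig : 300 * (100 * 100) <= t.
  by apply: le_trans ht; lra.
have t0 : 1 <= t by apply: le_trans a1 t1.
have tp : 0 < t by lra.
set P : R := (y1 * y2 * y3)%:R; have PE : P = y1%:R * y2%:R * y3%:R by rewrite /P !natrM.
have P1 : 1 <= P by rewrite PE; do 2!apply: mulr_ege1 => //.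
pose r : R := Num.sqrt (T / 12).
have T0 : 0 < T by rewrite HT; posR.
have r0 : 0 < r by rewrite sqrtr_gt0; posR.
have rE : Num.sqrt (T / 12) = r by [].
have r2 : r ^+ 2 = T / 12 by rewrite sqr_sqrtr//; posR.
pose Y : R := Num.sqrt (r * P).
have Y0 : 0 < Y by rewrite sqrtr_gt0; posR.
have Y2 : Y ^+ 2 = r * P by rewrite sqr_sqrtr//; posR.
have rt : t ^+ 32 / 4 <= r.
  rewrite -(@ler_pXn2r _ 2)// ?nnegrE ?(ltW r0)//; last by posR.
  rewrite r2 HT expr_div_n -exprM ler_pM2l ?exprn_gt0// lef_pV2 ?posrE//; lra.
have Yt : t ^+ 16 / 2 <= Y.
  rewrite -(@ler_pXn2r _ 2)// ?nnegrE ?(ltW Y0)//; last by posR.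
  rewrite Y2 expr_div_n -exprM; apply: le_trans (_ : r <= _); last by rewrite ler_peMr// ltW.
  by apply: le_trans rt; rewrite ler_pM2l ?exprn_gt0// lef_pV2 ?posrE//; lra.
pose a : R := Y / (Q%:R * y1%:R ^+ 2).
have ap : 0 < a by rewrite /a; posR.
have aE : a * (Q%:R * y1%:R ^+ 2) = Y by rewrite /a divfK// lt0r_neq0//; posR.
clearbody Y r a.
have at14 : t ^+ 14 / (2 * Q%:R) <= a.
  rewrite ler_pdivrMr; last by posR.
  rewrite -(@ler_pM2r _ (t ^+ 2)) ?exprn_gt0// -exprD.
  apply: (@le_trans _ _ (2 * Y)); first by rewrite -[(14 + 2)%N]/16%N; lra.
  rewrite -aE.
  have -> : 2 * (a * (Q%:R * y1%:R ^+ 2)) = a * (2 * Q%:R) * y1%:R ^+ 2 by ring.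
  rewrite ler_wpM2l//; first by posR.
  by rewrite lerXn2r// ?nnegrE; posR.
have tX n : t <= t ^+ n.+1 by rewrite exprS ler_peMr ?exprn_ege1// ltW.
pose d : R := ((y2 * y3) ^ 2)%:R.
have dE : d = (y2%:R * y3%:R) ^+ 2 by rewrite /d natrX natrM.
have d1 : 1 <= d by rewrite dE exprn_ege1// mulr_ege1.
have dp : 0 < d by lra.
have dt : d <= t ^+ 4.
  rewrite dE (_ : t ^+ 4 = (t * t) ^+ 2); last by ring.
  by rewrite lerXn2r// ?nnegrE; try posR; apply: ler_pM => //; posR.
have small : 300 * (100 * 100) * Q%:R ^+ 2 * t ^+ 6 <= t ^+ 10 / Q%:R.
  rewrite ler_pdivlMr//.
  have -> : 300 * (100 * 100) * Q%:R ^+ 2 * t ^+ 6 * Q%:R = 300 * (100 * 100) * Q%:R ^+ 3 * t ^+ 6 by ring.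
  rewrite (_ : t ^+ 10 = t ^+ 4 * t ^+ 6); last by ring.
  rewrite ler_pM2r ?exprn_gt0//; exact: le_trans ht (tX 3%N).
have Q2 : 1 <= Q%:R ^+ 2 :> R by exact: exprn_ege1.
have t6 : 1 <= t ^+ 6 by exact: exprn_ege1.
have Qt : 1 <= Q%:R ^+ 2 * t ^+ 6 by exact: mulr_ege1.
have t10Q : 300 * (100 * 100) <= t ^+ 10 / Q%:R by apply: le_trans small; lra.
have a10 : t ^+ 10 / Q%:R * t ^+ 4 / 2 <= a.
  apply: le_trans at14; rewrite le_eqVlt; apply/orP; left; apply/eqP.
  by field; rewrite lt0r_neq0.
have a10' : t ^+ 10 / Q%:R / 2 <= a.
  apply: le_trans a10; rewrite ler_pM2r// ler_peMr ?exprn_ege1//; lra.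
have [n1 [n1a n1a']] : exists n : nat, n%:R <= a /\ a < n%:R + 1.
  by have /andP[] := truncn_itv (ltW ap); rewrite -natr1; exists (Num.trunc a).
(* Taking the integer part of a number that is at least 5 loses at most a fifth. *)
have n1b : 4 / 5 * a <= n1%:R by lra.
pose m : R := (n1 * y1 ^ 2)%:R.
have mE : m = n1%:R * y1%:R ^+ 2 by rewrite /m natrM natrX.
have y2R : 1 <= y1%:R ^+ 2 :> R by exact: exprn_ege1.
have dN : (0 < (y2 * y3) ^ 2)%N by rewrite expn_gt0 muln_gt0 y20 y30.
pose n2 := ((n1 * y1 ^ 2) %/ (y2 * y3) ^ 2)%N.
have n2N : (n2 * (y2 * y3) ^ 2 <= n1 * y1 ^ 2)%N by exact: leq_trunc_div.
have n2N' : (n1 * y1 ^ 2 < n2.+1 * (y2 * y3) ^ 2)%N by exact: ltn_ceil.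
clearbody n2.
have n2m : n2%:R * d <= m by rewrite /d /m -natrM ler_nat.
have n2m' : m < (n2%:R + 1) * d by rewrite /d /m natr1 -natrM ltr_nat.
have md : t ^+ 10 / Q%:R * (2 / 5) <= m / d.
  rewrite ler_pdivlMr//; apply: (@le_trans _ _ n1%:R); last first.
    by rewrite mE ler_peMr//; lra.
  apply: le_trans n1b; apply: (@le_trans _ _ (4 / 5 * (t ^+ 10 / Q%:R * t ^+ 4 / 2))); last by lra.
  have -> : 4 / 5 * (t ^+ 10 / Q%:R * t ^+ 4 / 2) = t ^+ 10 / Q%:R * (2 / 5) * t ^+ 4 by field; rewrite lt0r_neq0.
  by rewrite ler_wpM2l//; lra.
have n2lt : m / d < n2%:R + 1 by rewrite ltr_pdivrMr.
have n2le : n2%:R <= m / d by rewrite ler_pdivlMr.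
have n2b : 4 / 5 * (m / d) <= n2%:R by lra.
exists n1, n2.
have n1p : 0 < n1%:R :> R by lra.
have n2p : 0 < n2%:R :> R by lra.
have n20 : (0 < n2)%N by rewrite -(ltr0n R).
split.
- by split=> //; rewrite -(ltr0n R).
- split=> //; rewrite (leq_trans (ltnW n2N'))// mulnA leq_mul2r; apply/orP; right.
  by move: n20; clear; lia.
- have -> : T * P ^+ 2 = 12 * Y ^+ 4.
    have -> : T = 12 * r ^+ 2 by rewrite r2; field.
    have -> : Y ^+ 4 = (r * P) ^+ 2 by rewrite -Y2; ring.
    by ring.
  rewrite ler_pM2l// lerXn2r// ?nnegrE ?(ltW Y0)//.
  rewrite -aE natrM natrX natrM (_ : a * _ = Q%:R * a * y1%:R ^+ 2); last by ring.
  by rewrite ler_pM2r ?ler_pM2l//; posR.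
- set G := Q%:R ^+ 2 * t ^+ 6 in Qt *.
  have -> : 100 * (100 * (14 * Q%:R ^+ 2)) * t ^+ 6 * (2 * (n1%:R + n2%:R + 1)) =
     (28 * (100 * 100) * G) * (n1%:R + n2%:R + 1) by rewrite /G; ring.
  have sG : 300 * (100 * 100) * G <= t ^+ 10 / Q%:R by rewrite /G mulrA.
  (* In units of [100 * 100 * G], 3 times 28 is 84, while [n1] is at least 300 times 2/5 and [n2] at
     least 300 times 8/25, that is 120 and 96. *)
  have c1 : 28 * (100 * 100) * G <= n1%:R / 3 by lra.
  have c2 : 28 * (100 * 100) * G <= n2%:R / 3 by lra.
  have n11 : 1 <= n2%:R :> R by rewrite ler1n.
  have := ler_wpM2r (ltW n1p) c2.
  have := ler_wpM2r (ltW n2p) c1.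
  have : n1%:R <= n1%:R * n2%:R :> R by rewrite ler_peMr// ltW.
  move: c1 c2; move: (28 * (100 * 100) * G) (n1%:R) (n2%:R) => c u v c1 c2 h1 h2 h3.
  have -> : c * (u + v + 1) = c * u + c * v + c by ring.
  have e : v / 3 * u = u * v / 3 by ring.
  have e' : u / 3 * v = u * v / 3 by ring.
  lra.
move=> V.
have VE : V = a ^+ 2 * y1%:R ^+ 2 / d.
  apply: (@mulIf _ (Q%:R ^+ 2 * y1%:R ^+ 2 * d)); first by rewrite lt0r_neq0//; posR.
  have -> : a ^+ 2 * y1%:R ^+ 2 / d * (Q%:R ^+ 2 * y1%:R ^+ 2 * d) = (a * (Q%:R * y1%:R ^+ 2)) ^+ 2.
    have gen (u v e : R) : 0 < e -> u / e * (v * e) = u * v.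
      by move=> e0; field; rewrite lt0r_neq0.
    by rewrite gen//; ring.
  have nz (y : nat) : (0 < y)%N -> y%:R != 0 :> R by rewrite pnatr_eq0 lt0n.
  by rewrite aE Y2 PE dE /V rE; field; rewrite !nz.
have mdE : m / d = n1%:R * (y1%:R ^+ 2 / d) by rewrite mE mulrA.
have w0 : 0 < y1%:R ^+ 2 / d by posR.
rewrite mdE in n2b n2le.
have -> : V = a * a * (y1%:R ^+ 2 / d) by rewrite VE; ring.
move: (y1%:R ^+ 2 / d) w0 n2b n2le => w w0 n2b n2le.
apply/andP; split.
  (* The three roundings leave the fraction (4/5)^3 = 64/125, just above 1/2. *)
  apply: (@le_trans _ _ (n1%:R * (4 / 5 * (n1%:R * w)))); last by rewrite ler_pM2l.
  have : (4 / 5 * a) * (4 / 5 * a) <= n1%:R * n1%:R.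
    by apply: ler_pM => //; lra.
  move/(ler_wpM2r (ltW w0)) => h.
  have : 0 <= a * a * w by posR.
  have -> : n1%:R * (4 / 5 * (n1%:R * w)) = 4 / 5 * (n1%:R * n1%:R * w) by ring.
  move: h; rewrite (_ : 4 / 5 * a * (4 / 5 * a) * w = 16 / 25 * (a * a * w)); last by field.
  lra.
apply: (@le_trans _ _ (n1%:R * (n1%:R * w))); first by rewrite ler_pM2l.
by rewrite mulrA ler_pM2r//; apply: ler_pM => //; lra.
Qed.

End Points.

(** * Averaging over y *)

Section ArithmeticProgression.
Variables (R : realType) (Q K J : nat).
Hypotheses (Q1 : (1 < Q)%N) (K0 : (0 < K)%N) (J0 : (0 < J)%N).
Hypothesis QK : forall p, prime p -> ~~ (p %| Q)%N -> (K < p)%N.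

Definition prog (j : nat) : nat := (1 + Q * j)%N.
Definition wt (j : nat) : R := (prog j)%:R^-1.
Definition wsum : R := \sum_(j < J) wt j.

Lemma prog_gt0 j : (0 < prog j)%N. Proof. by []. Qed.

Lemma prog_mod j : prog j = 1 %[mod Q].
Proof. by rewrite /prog addnC mulnC modnMDl. Qed.

Lemma prog_div j : (prog j %/ Q = j)%N.
Proof. by rewrite /prog addnC mulnC divnMDl ?(ltnW Q1)// divn_small ?addn0. Qed.

Lemma prog_inj : injective prog.
Proof. by move=> i j e; rewrite -(prog_div i) e prog_div. Qed.

Lemma wt_gt0 j : 0 < wt j. Proof. by rewrite invr_gt0 ltr0n prog_gt0. Qed.

Lemma wt_ge0 j : 0 <= wt j. Proof. exact/ltW/wt_gt0. Qed.

Lemma wsum_ge1 : 1 <= wsum.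
Proof.
rewrite /wsum; case: J J0 => // n _; rewrite big_ord_recl /wt /prog muln0 addn0 invr1.
by rewrite lerDl sumr_ge0// => i _; exact: wt_ge0.
Qed.

(** The quotients [m j = prog j / d] lie in one class modulo [Q], so their integer parts [i] after
    division by [Q] are distinct and below [J]. As [m j >= Q i >= prog (i - 1)] for [i > 0], the sum
    of [1 / m j] is at most [1 + wsum], hence [2 * wsum]. *)
Lemma class_sum (d : nat) : (0 < d)%N ->
  \sum_(j < J | (d %| prog j)%N) wt j <= 2 * wsum / d%:R.
Proof.
move=> d0; have dR : 0 < d%:R :> R by rewrite ltr0n.
pose m j := (prog j %/ d)%N.
have lt (j : 'I_J) : (m j %/ Q < J)%N.
  apply: leq_ltn_trans (ltn_ord j); rewrite -[X in (_ <= X)%N]prog_div leq_div2r//.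
  exact: leq_div.
pose g (j : 'I_J) : 'I_J := Ordinal (lt j).
pose h (i : nat) : R := if i is i'.+1 then wt i' else 1.
have h0 i : 0 <= h i by case: i => //= i; exact: wt_ge0.
pose A : {set 'I_J} := [set j : 'I_J | (d %| prog j)%N].
have gI : {in A &, injective g}.
  move=> i j; rewrite !inE => di dj [e]; apply: val_inj; apply: prog_inj => /=.
  rewrite -(divnK di) -(divnK dj) -/(m i) -/(m j); congr (_ * _)%N.
  rewrite (divn_eq (m i) Q) (divn_eq (m j) Q) e; congr (_ + _)%N.
  have cQ : coprime Q d.
    by rewrite coprime_sym (coprime_dvdl di)// coprime_mod1//; exact: prog_mod.
  have D k : (d %| prog k)%N -> (Q %| Q.-1 + m k * d)%N.
    by move=> dk; rewrite /m divnK// /prog addnA addn1 prednK ?(ltnW Q1)// -mulnS dvdn_mulr.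
  by apply: (@eqmod_lin Q Q.-1 d) => //; exact: D.
rewrite (eq_bigl (fun j => j \in A)); last by move=> j; rewrite inE.
rewrite ler_pdivlMr// mulr_suml.
apply: (@le_trans _ _ (\sum_(j in A) h (g j))).
  apply: ler_sum => j; rewrite inE => dj.
  have m0 : (0 < m j)%N by rewrite divn_gt0// dvdn_leq.
  have -> : wt j * d%:R = (m j)%:R^-1.
    rewrite /wt -(divnK dj) -/(m j) natrM invfM -mulrA mulVf ?mulr1//.
    by rewrite lt0r_neq0.
  rewrite /g /=; case e : (m j %/ Q)%N => [|i] /=.
    by rewrite invf_le1 ?ler1n ?ltr0n.
  rewrite /wt lef_pV2 ?posrE ?ltr0n// ler_nat.
  rewrite (leq_trans _ (leq_trunc_div (m j) Q))// e /prog mulSn mulnC leq_add2r.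
  exact: ltnW.
rewrite -(big_imset (fun i : 'I_J => h i) gI) /=.
apply: (@le_trans _ _ (\sum_(i < J) h i)).
  by rewrite [leRHS](bigID (fun i => i \in g @: A)) /= lerDl sumr_ge0.
have := wsum_ge1; rewrite /wsum; case: J J0 => // n _ w1.
rewrite big_ord_recl /=; move: w1; rewrite big_ord_recr /= => w1.
by have := wt_ge0 n; move: w1; move: (\sum_(i < n) wt i) (wt n) => u v; lra.
Qed.

Lemma sum_large_divisor_sum : \sum_(j < J) wt j * large_divisor_sum R K (prog j) <= 2 * wsum / K%:R.
Proof.
pose M := (prog J).+1.
pose F (j p : nat) : R := if (K < p)%N && (p %| prog j)%N then p%:R^-1 else 0.
have F0 j p : 0 <= F j p by rewrite /F; case: ifP => // _; posR.
apply: (@le_trans _ _ (\sum_(j < J) \sum_(0 <= p < M) wt j * F j p)).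
  apply: ler_sum => j _; rewrite -mulr_sumr ler_pM2l ?wt_gt0//.
  rewrite [leRHS](@big_cat_nat _ _ _ (prog j).+1)//=; last first.
    by rewrite /M ltnS /prog leq_add2l leq_mul2l (ltnW (ltn_ord j)) orbT.
  by rewrite lerDl sumr_ge0.
rewrite exchange_big /=.
apply: (@le_trans _ _ (\sum_(0 <= p < M) 2 * wsum * (if (K < p)%N then p%:R ^- 2 else 0))).
  apply: ler_sum => p _; rewrite /F; case: ltnP => Kp /=; last first.
    by rewrite big1 ?mulr0// => j _; rewrite mulr0.
  rewrite (eq_bigr (fun j : 'I_J => p%:R^-1 * (if (p %| prog j)%N then wt j else 0))); last first.
    by move=> j _; case: ifP; rewrite ?mulr0// mulrC.
  rewrite -mulr_sumr -big_mkcond /=.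
  apply: (@le_trans _ _ (p%:R^-1 * (2 * wsum / p%:R))).
    by rewrite ler_wpM2l ?class_sum// (leq_ltn_trans _ Kp).
  by rewrite mulrCA -exprVn expr2.
rewrite -mulr_sumr ler_wpM2l ?sum_inv_sq_tail//.
by have := wsum_ge1; lra.
Qed.

(** A common prime exceeds [K], so summing over all common divisors [p > K] is enough; [class_sum]
    bounds each contribution by [(2 wsum / p)^2]. *)
Lemma sum_noncoprime : \sum_(j < J) \sum_(k < J)
  wt j * wt k * (~~ coprime (prog j) (prog k))%:R <= 4 * wsum ^+ 2 / K%:R.
Proof.
pose M := (prog J).+1.
pose G (p j : nat) : R := if (p %| prog j)%N then wt j else 0.
have G0 p j : 0 <= G p j by rewrite /G; case: ifP => // _; exact: wt_ge0.
pose H (p j k : nat) : R := if (K < p)%N then G p j * G p k else 0.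
have H0 p j k : 0 <= H p j k by rewrite /H; case: ifP => // _; rewrite mulr_ge0.
apply: (@le_trans _ _ (\sum_(j < J) \sum_(k < J) \sum_(0 <= p < M) H p j k)).
  apply: ler_sum => j _; apply: ler_sum => k _.
  case: (boolP (coprime _ _)) => cp; first by rewrite mulr0 sumr_ge0.
  have [p [pp pj pk]] := common_prime (prog_gt0 j) cp.
  have Kp : (K < p)%N.
    by apply: QK => //; apply: prime_ndvd_mod1 pp _ pj; exact: prog_mod.
  have pM : (p < M)%N.
    rewrite /M ltnS (leq_trans (dvdn_leq _ pj))// /prog leq_add2l leq_mul2l.
    by rewrite (ltnW (ltn_ord j)) orbT.
  rewrite mulr1 (bigD1_seq p) ?mem_index_iota ?iota_uniq//=.
  by rewrite {1}/H Kp /G pj pk lerDl sumr_ge0.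
under eq_bigr do rewrite exchange_big /=.
rewrite exchange_big /=.
apply: (@le_trans _ _ (\sum_(0 <= p < M) 4 * wsum ^+ 2 * (if (K < p)%N then p%:R ^- 2 else 0))).
  apply: ler_sum => p _; rewrite /H; case: ltnP => Kp /=; last first.
    by rewrite big1 ?mulr0// => j _; rewrite big1.
  under eq_bigr do rewrite -mulr_sumr.
  rewrite -mulr_suml /G -big_mkcond /=.
  have c := class_sum (leq_ltn_trans (leq0n _) Kp).
  apply: (@le_trans _ _ ((2 * wsum / p%:R) * (2 * wsum / p%:R))).
    by apply: ler_pM => //; apply: sumr_ge0 => j _; exact: wt_ge0.
  by rewrite -exprVn le_eqVlt; apply/orP; left; apply/eqP; ring.
rewrite -mulr_sumr ler_wpM2l ?sum_inv_sq_tail//.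
by have := wsum_ge1 => ?; posR.
Qed.

Lemma sum3_prod n (a b c : 'I_n -> R) :
  \sum_i \sum_j \sum_k a i * b j * c k = (\sum_i a i) * (\sum_i b i) * (\sum_i c i).
Proof.
rewrite -mulrA mulr_suml; apply: eq_bigr => i _; rewrite mulr_suml mulr_sumr.
by apply: eq_bigr => j _; rewrite mulrA mulr_sumr.
Qed.

(** Relative to [wsum ^+ 3] each divisor sum costs at most 1/50 and each coprimality condition a
    quarter of 1/25; what remains, 1/4 - 3/50 - 3/100 = 4/25, exceeds 1/8. *)
Lemma sum_triples : (100 <= K)%N -> wsum ^+ 3 / 8 <= \sum_(i < J) \sum_(j < J) \sum_(k < J)
  wt i * wt j * wt k * (4^-1 - large_divisor_sum R K (prog i) - large_divisor_sum R K (prog j) - large_divisor_sum R K (prog k) -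
   ((~~ coprime (prog i) (prog j))%:R + (~~ coprime (prog i) (prog k))%:R
     + (~~ coprime (prog j) (prog k))%:R) / 4).
Proof.
move=> K100.
pose w (i : 'I_J) := wt i; pose s (i : 'I_J) := wt i * large_divisor_sum R K (prog i).
pose nc (i j : 'I_J) : R := wt i * wt j * (~~ coprime (prog i) (prog j))%:R.
have B1 := sum_large_divisor_sum; have B2 := sum_noncoprime.
rewrite -[X in X <= _]/(\sum_i s i) in B1.
rewrite -[X in X <= _]/(\sum_i \sum_j nc i j) in B2.
have E1 : \sum_i \sum_j \sum_k nc i j * w k = (\sum_i \sum_j nc i j) * wsum.
  rewrite mulr_suml; apply: eq_bigr => i _; rewrite mulr_suml; apply: eq_bigr => j _.
  by rewrite mulr_sumr.
have E2 : \sum_i \sum_j \sum_k nc i k * w j = (\sum_i \sum_j nc i j) * wsum.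
  rewrite -E1; apply: eq_bigr => i _; rewrite exchange_big //=.
have E3 : \sum_i \sum_j \sum_k nc j k * w i = (\sum_i \sum_j nc i j) * wsum.
  rewrite -E2 exchange_big /=; apply: eq_bigr => i _; by [].
have -> : \sum_(i < J) \sum_(j < J) \sum_(k < J)
  wt i * wt j * wt k * (4^-1 - large_divisor_sum R K (prog i) - large_divisor_sum R K (prog j) - large_divisor_sum R K (prog k) -
   ((~~ coprime (prog i) (prog j))%:R + (~~ coprime (prog i) (prog k))%:R
     + (~~ coprime (prog j) (prog k))%:R) / 4) =
  4^-1 * (\sum_i \sum_j \sum_k w i * w j * w k) - (\sum_i \sum_j \sum_k s i * w j * w k)
   - (\sum_i \sum_j \sum_k w i * s j * w k) - (\sum_i \sum_j \sum_k w i * w j * s k)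
   - 4^-1 * (\sum_i \sum_j \sum_k nc i j * w k) - 4^-1 * (\sum_i \sum_j \sum_k nc i k * w j)
   - 4^-1 * (\sum_i \sum_j \sum_k nc j k * w i).
  rewrite !mulr_sumr -!sumrB; apply: eq_bigr => i _.
  rewrite !mulr_sumr -!sumrB; apply: eq_bigr => j _.
  rewrite !mulr_sumr -!sumrB; apply: eq_bigr => k _.
  by rewrite /nc /s /w; field.
rewrite E1 E2 E3 !sum3_prod -/wsum.
have S1 := wsum_ge1.
have K100' : 100 <= K%:R :> R by rewrite (ler_nat R 100).
have iK : K%:R^-1 <= 100^-1 :> R by rewrite lef_pV2 ?posrE//; lra.
move: wsum (\sum_i s i) (\sum_i \sum_j nc i j) (K%:R^-1) B1 B2 S1 iK; clear.
move=> S A B k B1 B2 S1 iK.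
have A1 : A <= S / 50.
  apply: (le_trans B1); have : S * k <= S * 100^-1 by rewrite ler_wpM2l//; lra.
  lra.
have A2 : B <= S ^+ 2 / 25.
  apply: (le_trans B2); have : S ^+ 2 * k <= S ^+ 2 * 100^-1 by rewrite ler_wpM2l//; posR.
  lra.
have := ler_wpM2r (ltac:(posR) : 0 <= S ^+ 2) A1.
have := ler_wpM2r (ltac:(lra) : 0 <= S) A2.
have : 0 <= S ^+ 3 by posR.
have -> : S / 50 * S ^+ 2 = S ^+ 3 / 50 by ring.
have -> : S ^+ 2 / 25 * S = S ^+ 3 / 25 by ring.
have -> : S * S * S = S ^+ 3 by ring.
have -> : A * S * S = A * S ^+ 2 by ring.
have -> : S * A * S = A * S ^+ 2 by ring.
have -> : S * S * A = A * S ^+ 2 by ring.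
lra.
Qed.

End ArithmeticProgression.

(** * Assembling the lower bound *)

Section LowerBound.
Variable R : realType.

(** If two of the y share a factor the bracket is at most 0 and the empty list suffices, so the
    average may run over all triples. Otherwise [n1 n2] lies between [V / 2] and [V]: the lower
    bound serves the constant term, the upper one the subtracted divisor sums. *)
Lemma triple_points (T t : R) (Q K y1 y2 y3 : nat) : (0 < Q)%N -> (4 %| Q)%N ->
  (forall p, prime p -> ~~ (p %| Q)%N -> (K < p)%N) -> (100 <= K)%N ->
  T = t ^+ 64 -> 300 * (100 * 100) * Q%:R ^+ 3 <= t ->
  y1 = 1 %[mod Q] -> y2 = 1 %[mod Q] -> y3 = 1 %[mod Q] ->
  y1%:R <= t -> y2%:R <= t -> y3%:R <= t ->
  exists s, [/\ uniq s, {in s, forall z, half_points T (half_point_of y1 y2 y3 z)} &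
    Num.sqrt (T / 12) / Q%:R ^+ 2 * (y1%:R^-1 * y2%:R^-1 * y3%:R^-1 *
     (4^-1 - large_divisor_sum R K y1 - large_divisor_sum R K y2 - large_divisor_sum R K y3 -
     ((~~ coprime y1 y2)%:R + (~~ coprime y1 y3)%:R + (~~ coprime y2 y3)%:R) / 4)) <= (size s)%:R].
Proof.
move=> Q0 Q4 QK K100 HT ht e1 e2 e3 t1 t2 t3.
have s1 := large_divisor_sum_ge0 R K y1; have s2 := large_divisor_sum_ge0 R K y2; have s3 := large_divisor_sum_ge0 R K y3.
have [|nc] := boolP [&& coprime y1 y2, coprime y1 y3 & coprime y2 y3]; last first.
  exists [::]; split=> //.
  apply: mulr_ge0_le0; first by rewrite divr_ge0 ?sqrtr_ge0 ?exprn_ge0.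
  apply: mulr_ge0_le0; first by rewrite !mulr_ge0.
  suff : 1 <= (~~ coprime y1 y2)%:R + (~~ coprime y1 y3)%:R + (~~ coprime y2 y3)%:R :> R by lra.
  by move: nc; case: (coprime y1 y2); case: (coprime y1 y3); case: (coprime y2 y3) => //= _; lra.
case/and3P => c12 c13 c23; rewrite c12 c13 c23 /= !addr0 mul0r subr0.
have Q1 : (1 < Q)%N by apply: leq_trans (dvdn_leq Q0 Q4).
have ypos y : y = 1 %[mod Q] -> (0 < y)%N.
  by rewrite lt0n => h; apply/eqP => y0; move: h; rewrite y0 mod0n modn_small.
have [n1 [n2 [[n10 n20] [le ge] hT big /=]]] :=
  choose_sizes Q0 (ypos _ e1) (ypos _ e2) (ypos _ e3) t1 t2 t3 HT ht.
set V := (X in X / 2 <= _) => /andP[V1 V2]; rewrite -/V in V2.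
have st : setting Q K y1 y2 y3 n1 n2 by [].
have [s [us gs ss]] := good_seq st K100 t1 t2 t3 big.
exists s; split=> //; last rewrite [X in X <= _]mulrA -/V.
  by move=> z /gs gz; exact: good_half_points st gz hT.
apply: le_trans ss; move: s1 s2 s3 V1 V2.
move: (large_divisor_sum R K y1) (large_divisor_sum R K y2) (large_divisor_sum R K y3) (n1%:R * n2%:R) (V); clear.
move=> a b c n V a0 b0 c0 V1 V2.
have h1 := ler_wpM2r a0 V2; have h2 := ler_wpM2r b0 V2; have h3 := ler_wpM2r c0 V2.
have -> : n * (2^-1 - a - b - c) = n / 2 - n * a - n * b - n * c by ring.
have -> : V * (4^-1 - a - b - c) = V / 4 - V * a - V * b - V * c by ring.
lra.
Qed.

Lemma N_ge_wsum (T t : R) (Q K J : nat) : (0 < Q)%N -> (4 %| Q)%N ->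
  (forall p, prime p -> ~~ (p %| Q)%N -> (K < p)%N) -> (100 <= K)%N -> (0 < J)%N ->
  T = t ^+ 64 -> 300 * (100 * 100) * Q%:R ^+ 3 <= t -> (Q * J)%:R <= t ->
  Num.sqrt (T / 12) / Q%:R ^+ 2 * (wsum R Q J ^+ 3 / 8) <= (N T)%:R.
Proof.
move=> Q0 Q4 QK K100 J0 HT ht Jt.
have Q1 : (1 < Q)%N by apply: leq_trans (dvdn_leq Q0 Q4).
have K0 : (0 < K)%N by exact: leq_trans K100.
have progt (j : 'I_J) : (prog Q j)%:R <= t.
  apply: le_trans Jt; rewrite ler_nat /prog.
  apply: (@leq_trans (Q * j.+1)); first by rewrite mulnS leq_add2r.
  by rewrite leq_mul2l ltn_ord orbT.
pose I : finType := ('I_J * ('I_J * 'I_J))%type.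
have pm j := prog_mod Q j.
have /choice[S HS] (x : I) := triple_points Q0 Q4 QK K100 HT ht
  (pm x.1) (pm x.2.1) (pm x.2.2) (progt x.1) (progt x.2.1) (progt x.2.2).
pose f (x : I) z := half_point_of (prog Q x.1) (prog Q x.2.1) (prog Q x.2.2) z.
pose s := [seq f x z | x <- enum I, z <- S x].
have us : uniq s.
  apply: allpairs_uniq_dep; first exact: enum_uniq.
    by move=> x _; case: (HS x).
  move=> [[i [j k]] [a b]] [[i' [j' k']] [a' b']] _ _ /= [ea eb _ ei ej ek].
  have inj (u v : 'I_J) : prog Q u = prog Q v -> u = v.
    by move/(prog_inj Q1)/val_inj.
  by rewrite ea eb (inj _ _ (congr1 succn ei)) (inj _ _ (congr1 succn ej)) (inj _ _ (congr1 succn ek)).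
have Ps : {in s, forall p, half_points T p}.
  by move=> p /allpairsPdep[x [z [_ zS ->]]]; case: (HS x) => _ /(_ z zS).
have sz : (size s)%:R = \sum_(x : I) (size (S x))%:R :> R.
  by rewrite size_allpairs_dep sumnE big_map big_enum /= natr_sum.
apply: (@le_trans _ _ (size s)%:R); last by rewrite ler_nat N_ge.
rewrite sz; apply: (@le_trans _ _ (\sum_(x : I) Num.sqrt (T / 12) / Q%:R ^+ 2 *
  (wt R Q x.1 * wt R Q x.2.1 * wt R Q x.2.2 *
  (4^-1 - large_divisor_sum R K (prog Q x.1) - large_divisor_sum R K (prog Q x.2.1) - large_divisor_sum R K (prog Q x.2.2) -
   ((~~ coprime (prog Q x.1) (prog Q x.2.1))%:R + (~~ coprime (prog Q x.1) (prog Q x.2.2))%:R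
     + (~~ coprime (prog Q x.2.1) (prog Q x.2.2))%:R) / 4)))); last first.
  by apply: ler_sum => x _; case: (HS x).
rewrite -mulr_sumr; apply: ler_wpM2l; first by rewrite divr_ge0 ?sqrtr_ge0 ?exprn_ge0.
apply: (le_trans (sum_triples R Q1 K0 J0 QK K100)).
by under eq_bigr do rewrite pair_bigA; rewrite pair_bigA.
Qed.

Lemma ln_le_harmonic (n : nat) : ln n.+1%:R <= \sum_(j < n) j.+1%:R^-1 :> R.
Proof.
elim: n => [|n IH]; first by rewrite big_ord0 ln1.
rewrite big_ord_recr /=; apply: le_trans (lerD IH (lexx _)).
have n0 : 0 < n.+1%:R :> R by rewrite ltr0n.
have -> : n.+2%:R = n.+1%:R * (1 + n.+1%:R^-1) :> R.
  by rewrite mulrDr mulr1 mulfV ?lt0r_neq0// natr1.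
have i0 : 0 < n.+1%:R^-1 :> R by rewrite invr_gt0.
rewrite lnM ?posrE ?addr_gt0//.
by rewrite lerD2l le_ln1Dx// (lt_trans _ i0)// ltrN10.
Qed.

Lemma wsum_ge_ln (Q J : nat) : (0 < Q)%N -> ln J.+1%:R / Q%:R <= wsum R Q J.
Proof.
move=> Q0; have QR : 0 < Q%:R :> R by rewrite ltr0n.
rewrite ler_pdivrMr//; apply: (le_trans (ln_le_harmonic J)).
rewrite /wsum mulr_suml; apply: ler_sum => j _.
have -> : wt R Q j * Q%:R = ((prog Q j)%:R / Q%:R)^-1 by rewrite /wt invf_div mulrC.
rewrite lef_pV2 ?posrE ?ltr0n ?divr_gt0 ?ltr0n//.
by rewrite ler_pdivrMr// -natrM ler_nat /prog mulSn mulnC leq_add2r.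
Qed.

(** With [t = T^(1/64)] and [J] the integer part of [t / Q], every y stays below [t]. The threshold
    gives [Q^2 <= t], hence ln (t / Q) >= (ln t) / 2 = (ln T) / 128: this is the origin of 128. *)
Lemma N_lower : exists c1 c3 : R, [/\ 0 < c1, 0 < c3 & forall T, c3 < T ->
  c1 * T `^ (1 / 2) * (ln T) ^+ 3 < (N T)%:R].
Proof.
have [Q [Q0 Q4 QK]] := exists_modulus 100.
have Q1 : (1 < Q)%N by apply: leq_trans (dvdn_leq Q0 Q4).
have QR : 1 <= Q%:R :> R by rewrite ler1n.
have Qp : 0 < Q%:R :> R by lra.
pose t0 : R := 300 * (100 * 100) * Q%:R ^+ 3.
have Q3 : 1 <= Q%:R ^+ 3 :> R by exact: exprn_ege1.
have Q23 : Q%:R ^+ 2 <= Q%:R ^+ 3 :> R by rewrite ler_weXn2l.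
have t01 : 1 <= t0 by rewrite /t0; lra.
have t0Q : Q%:R ^+ 2 <= t0 by rewrite /t0; lra.
have ht0 : t0 = 300 * (100 * 100) * Q%:R ^+ 3 by [].
clearbody t0.
pose c : R := Num.sqrt 12^-1 / Q%:R ^+ 2 * ((128 * Q%:R) ^- 3 / 8).
have c0 : 0 < c.
  have s0 : 0 < Num.sqrt 12^-1 :> R by rewrite sqrtr_gt0 invr_gt0.
  by rewrite /c; posR.
(* Halving [c] makes the inequality strict; the 64th power turns [T > c3] into [t >= t0]. *)
exists (c / 2), (t0 ^+ 64); split; [by lra|by rewrite exprn_gt0//; lra|].
move=> T hT.
have T1 : 1 < T by apply: le_lt_trans hT; exact: exprn_ege1.
have T0 : 0 < T by lra.
have lT0 : 0 < ln T by rewrite ln_gt0.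
have [t [tp HT lt]] : exists t : R, [/\ 0 < t, T = t ^+ 64 & ln t = ln T / 64].
  exists (expR (ln T / 64)); split; [exact: expR_gt0| |by rewrite expRK].
  by rewrite -expRM_natr divfK// lnK.
have tt0 : t0 <= t.
  rewrite leNgt; apply/negP => tlt; move: hT; rewrite ltNge HT.
  by rewrite lerXn2r// ?nnegrE; lra.
have tQ : Q%:R ^+ 2 <= t by lra.
have QQ : Q%:R <= Q%:R ^+ 2 :> R by rewrite expr2 ler_peMr//; lra.
have [J [J1 J2]] : exists J : nat, J%:R <= t / Q%:R /\ t / Q%:R < J.+1%:R.
  have /truncn_itv/andP[h1 h2] : 0 <= t / Q%:R by rewrite divr_ge0// ltW.
  by exists (Num.trunc (t / Q%:R)).
have J0 : (0 < J)%N.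
  rewrite lt0n; apply: contraTneq J2 => ->; rewrite -leNgt ler_pdivlMr// mul1r; lra.
have Jt : (Q * J)%:R <= t.
  by rewrite natrM mulrC -ler_pdivlMr.
have ht : 300 * (100 * 100) * Q%:R ^+ 3 <= t by rewrite -ht0.
have B := N_ge_wsum Q0 Q4 QK (leqnn 100) J0 HT ht Jt.
have W : ln T / (128 * Q%:R) <= wsum R Q J.
  apply: le_trans (wsum_ge_ln J Q0); rewrite invfM mulrA ler_pM2r ?invr_gt0//.
  have tQ0 : 0 < t / Q%:R by rewrite divr_gt0.
  apply: (@le_trans _ _ (ln (t / Q%:R))); last by rewrite ler_ln ?posrE ?ltr0n// ltW.
  rewrite ln_div ?posrE// lt.
  have : ln (Q%:R ^+ 2) <= ln t by rewrite ler_ln ?posrE// exprn_gt0.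
  rewrite lnXn// -[X in X <= _]mulr_natl lt; lra.
have W3 : (ln T / (128 * Q%:R)) ^+ 3 <= wsum R Q J ^+ 3.
  have W0 : 0 <= ln T / (128 * Q%:R) by apply: divr_ge0; [exact: ltW|lra].
  by rewrite lerXn2r// ?nnegrE//; apply: le_trans W.
apply: lt_le_trans B.
have sT : 0 < Num.sqrt T by rewrite sqrtr_gt0.
apply: (@lt_le_trans _ _ (Num.sqrt (T / 12) / Q%:R ^+ 2 * ((ln T / (128 * Q%:R)) ^+ 3 / 8))); last first.
  apply: ler_wpM2l; first by rewrite divr_ge0 ?sqrtr_ge0 ?exprn_ge0.
  by rewrite ler_pM2r ?invr_gt0.
rewrite div1r powR12_sqrt ?(ltW T0)// sqrtrM ?(ltW T0)//.
have -> : Num.sqrt T * Num.sqrt 12^-1 / Q%:R ^+ 2 * ((ln T / (128 * Q%:R)) ^+ 3 / 8) =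
  c * (Num.sqrt T * ln T ^+ 3).
  by rewrite /c expr_div_n; ring.
rewrite -mulrA ltr_pM2r; last by posR.
lra.
Qed.

End LowerBound.

Theorem theorem1p2 (R : realType) :
  exists c1 c2 c3 : R,
    [/\ 0 < c1, 0 < c2, 0 < c3 &
      forall T : R, c3 < T ->
        c1 * T `^ (1 / 2) * (ln T) ^+ 3 < (N T)%:R < c2 * T `^ (1 / 2) * (ln T) ^+ 3].
Proof.
have [c1 [c3 [c10 c30 lower]]] := N_lower R.
have [c2 [c20 upper]] := N_upper R.
exists c1, c2, (Num.max c3 2); split => //; first by rewrite lt_max c30.
by move=> T; rewrite gt_max => /andP[hT T2]; rewrite lower ?upper.
Qed.
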